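(* Let $\mathbb{F}$ be a field, $E$ an associative $\mathbb{F}$-algebra, $\rho:E\to\mathrm{End}_{\mathbb{F}}(V)$ an absolutely irreducible representation on a finite-dimensional $\mathbb{F}$-vector space, $C=C^\bullet(E,\mathrm{End}_{\mathbb{F}}(\rho))$ the Hochschild cochain dg-algebra and $H=H^\bullet(C)$. Choose a homotopy retract of $C$ onto $H$, and let $(H,m)$ and $f:(H,m)\to C$ be the induced minimal $A_\infty$-structure and $A_\infty$-quasi-isomorphism. Then for every $A\in\mathcal A_{\mathbb{F}}$ these data determine bijections \[ \overline{\mathrm{MC}}(H,A)\xrightarrow[\ \bar f_*\ ]{\sim}\overline{\mathrm{MC}}(C,A)\xrightarrow{\sim}\mathrm{Def}^{\mathrm{nc}}_\rho(A), \] functorial in $A$, where $\bar f_*$ is induced by the map $f_*$ on Maurer–Cartan sets and the second bijection is induced by $\xi\mapsto\rho\oplus\xi$.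
   Context: $\mathcal A_{\mathbb{F}}$: finite-dimensional local Artinian associative $\mathbb{F}$-algebras with maximal ideal $\mathfrak m_A$ and residue field $\mathbb{F}$. Hochschild complex $C^n=\mathrm{Hom}_{\mathbb{F}}(E^{\otimes n},\mathrm{End}_{\mathbb{F}}(\rho))$, bimodule structure $((x,y)\phi)(v)=\rho(x)\phi(\rho(y)v)$, differential $(d\phi)(x_1,\dots,x_{n+1})=x_1\phi(x_2,\dots)+(-1)^{n+1}\phi(\dots,x_n)x_{n+1}+\sum_{j=1}^n(-1)^j\phi(\dots,x_jx_{j+1},\dots)$, product $(\phi\psi)(x_1,\dots,x_{a+b})=\phi(x_1..x_a)\psi(x_{a+1}..x_{a+b})$. Homotopy retract: for each $n$ choose a decomposition $C^n=B^n\oplus\tilde H^n\oplus L^n$ with $B^n$ the coboundaries, $\tilde H^n$ cocycles mapping isomorphically onto $H^n$, and $L^n$ a complement to the cocycles (so $d:L^n\xrightarrow\sim B^{n+1}$). Let $i:H\to C$ be the inclusion via $\tilde H$, $p:C\to H$ the projection killing $B\oplus L$, and $h$ of degree $-1$ equal to $(d|_{L^n})^{-1}$ on $B^{n+1}$ and $0$ on $\tilde H\oplus L$. Put $\tilde m_2$ the product of $C$, $h\circ\tilde m_1:=-\mathrm{id}$, $\tilde m_n=\sum_{s+t=n,\,s,t\ge1}(-1)^{s+1}\tilde m_2((h\tilde m_s)\otimes(h\tilde m_t))$ for $n\ge3$; then $m_1=0$, $m_n=p\tilde m_ni^{\otimes n}$ ($n\ge2$), $f_n=-h\tilde m_ni^{\otimes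 n}$ (so $f_1=i$); these define a minimal $A_\infty$-algebra and an $A_\infty$-quasi-isomorphism. For an $A_\infty$-algebra $(X,m)$ and $A\in\mathcal A_{\mathbb{F}}$ put $m^A_n(a_1\otimes x_1,\dots,a_n\otimes x_n)=a_1\cdots a_n\otimes m_n(x_1\otimes\cdots\otimes x_n)$ (Koszul signs). $\mathrm{MC}(X,A)=\{\xi\in X^1\otimes\mathfrak m_A:\sum_{n\ge1}(-1)^{n(n+1)/2}m^A_n(\xi^{\otimes n})=0\}$; for $X=C$ this is $d\xi+\xi\xi=0$. $\beta,\beta'\in\mathrm{MC}(X,A)$ are gauge equivalent via $\gamma\in X^0\otimes\mathfrak m_A$ if $\beta-\beta'=\sum_{n\ge1}\sum_{j=1}^n(-1)^jm^A_n(\beta^{\otimes(j-1)}\otimes\gamma\otimes\beta'^{\otimes(n-j)})$; $\overline{\mathrm{MC}}(X,A)$ is the set of classes for the equivalence relation so generated (for $X=C$ this agrees with orbits of $\gamma\cdot\beta=\beta-(1-\gamma)^{-1}(\beta\gamma-\gamma\beta+d\gamma)$). $f_*:\mathrm{MC}(H,A)\to\mathrm{MC}(C,A)$ is the map induced by $f$ on Maurer–Cartan elements (via the bar construction: $\xi\mapsto s^{-1}\sum_n g^A_n((s\xi)^{\otimes n})$ with $g_n=s\circ f_n\circ\omega^{\otimes n}$, $s$ the degree $-1$ suspension isomorphism, $\omega=s^{-1}$). $(\rho\oplus\xi)(x)=\rho(x)\otimes1+\xi(x)$. A deformation of $\rho$ over $A$ is a lift $E\to\mathrm{End}_{\mathbb{F}}(V)\otimes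 A$ of $\rho$ modulo conjugation by elements reducing to $\mathrm{id}_V$; $\mathrm{Def}^{\mathrm{nc}}_\rho(A)$ is the set of them.
   Formalization: Signs corrected: f_*(ξ) = Σ −(−1)^{n(n+1)/2} f_n(ξ^n), and the n-th term of the gauge relation carries an extra (−1)^{n(n−1)/2}; with the literal signs f_* need not preserve Maurer–Cartan elements and the gauge relation on C is not the orbit relation. *)

(* Defs.v *)
From HB Require Import structures.
From Stdlib Require Import Relation_Operators.
From mathcomp Require Import all_boot all_order all_algebra all_field.
From mathcomp Require Import zify.
From mathcomp Require Import boolp classical_sets functions fsbigop.

Set Implicit Arguments.
Unset Strict Implicit.
Unset Printing Implicit Defensive.

Import GRing.Theory passmx.
Local Open Scope ring_scope.

(* [amax] is the set of non-units (so "the non-units form an ideal", which for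
   a possibly noncommutative ring is locality), and [A = F.1 + amax] says that
   [F -> A / amax] is onto.  Finite dimension is part of [falgType]. *)
Record artAlg (F : fieldType) := ArtAlg {
  asort :> falgType F;
  amax : {vspace asort};
  amaxE : forall a : asort, (a \in amax) = (a \isn't a GRing.unit);
  ares : (1 + amax)%VS = fullv }.

(* [W (x) U], in coordinates with respect to the basis [vbasis U] of [U]:
   [t] stands for [\sum_k t k (x) (vbasis U)`_k].  [tpure w u], for [u \in U],
   is the pure tensor [w (x) u]. *)
Notation tens W U := {ffun 'I_(\dim U) -> W}.

Section Tensor.
Variables (F : fieldType) (W : lmodType F).

Definition tpure (T : vectType F) (U : {vspace T}) (w : W) (u : T) : tens W U :=
  [ffun k => coord (vbasis U) k u *: w].

(* [id (x) theta], for a linear map [theta] sending [U] into [U']. *)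
Definition tmap (T T' : vectType F) (U : {vspace T}) (U' : {vspace T'})
    (theta : T -> T') (t : tens W U) : tens W U' :=
  \sum_k tpure U' (t k) (theta (vbasis U)`_k).

End Tensor.

Section Operations.
Variables (F : fieldType).

(* A family [(phi_n)_n] of operations of arbitrary degrees from a graded space
   [X] to a graded space [Y]: [phi k [:: x1; ...; xn]] is the component of
   degree [k] of [phi_n (x1 (x) ... (x) xn)], the [xi] being homogeneous
   elements tagged with their degree. *)
Definition ops (X Y : nat -> lmodType F) :=
  forall k : nat, seq {d : nat & X d} -> Y k.

(* [0] if the degree of the homogeneous element [x] is not [k]. *)
Definition hcomp (X : nat -> lmodType F) (k : nat) (x : {d : nat & X d}) : X k :=
  untag (0 : X k) (fun y : X k => y) x.

Variables (X Y : nat -> lmodType F) (phi : ops X Y) (A : artAlg F).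

Definition htens := {d : nat & tens (X d) (amax A)}.

Definition hcoef (t : htens) (e : 'I_(\dim (amax A))) : {d : nat & X d} :=
  Tagged (fun d => X d : Type) (tagged t e).

(* [a1 (x) x1, ..., an (x) xn |-> a1 ... an (x) phi_n (x1, ..., xn)]; no sign
   arises here, as [A] sits in degree 0. *)
Definition extA (k : nat) (s : seq htens) : tens (Y k) (amax A) :=
  \sum_(e : (size s).-tuple 'I_(\dim (amax A)))
     tpure (amax A) (phi k [seq hcoef p.1 p.2 | p <- zip s e])
           (\prod_(j <- e) (vbasis (amax A))`_j).

Definition htag (d : nat) (t : tens (X d) (amax A)) : htens :=
  Tagged (fun d => tens (X d) (amax A) : Type) t.

End Operations.

(* The points [pt x] with [pmem x], up to the equivalence relation [prel]. *)
Record presentation := Presentation {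
  pt : Type;
  pmem : pt -> Prop;
  prel : pt -> pt -> Prop }.

Definition quotient_set (P : presentation) :=
  {c : set (pt P) |
     exists2 x, pmem x & c = [set y | pmem y /\ prel x y]%classic}.

(* [f] restricts to a map of the sets of points, and [fbar] sends the class of
   [x] to the class of [f x]. *)
Definition induces (P Q : presentation) (f : pt P -> pt Q)
    (fbar : quotient_set P -> quotient_set Q) : Prop :=
  forall x, pmem x ->
    pmem (f x) /\ (forall c, sval c x -> sval (fbar c) (f x)).

Section MaurerCartan.
Variables (F : fieldType) (X : nat -> lmodType F) (m : ops X X).
Variable (A : artAlg F).

(* The sums over [n >= 1] are sums of finitely supported families: [amax A] is
   nilpotent. *)
Definition MC_eq (xi : tens (X 1) (amax A)) : Prop :=
  \sum_(n \in [set n | (0 < n)%N]%classic)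
     (-1) ^+ (n * n.+1)./2%N *: extA m 2 (nseq n (htag xi)) = 0.

(* The factor [(-1) ^+ (n * n.-1)./2] is the Koszul sign which compares
   [(s^-1)^{(x) n}] with [(s^{(x) n})^-1], [s] being the suspension.  With it,
   and for a dg-algebra, the relation reads
     [beta - beta' = - (d gamma + beta gamma - gamma beta')],
   i.e. [beta'] is the image of [beta] under the gauge action of [- gamma]. *)
Definition gauge_step (gamma : tens (X 0) (amax A))
    (beta beta' : tens (X 1) (amax A)) : Prop :=
  beta - beta' =
  \sum_(n \in [set n | (0 < n)%N]%classic) \sum_(1 <= j < n.+1)
     ((-1) ^+ j * (-1) ^+ (n * n.-1)./2%N) *:
       extA m 1 (nseq j.-1 (htag beta) ++ htag gamma :: nseq (n - j) (htag beta')).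

Definition gauge_equiv : tens (X 1) (amax A) -> tens (X 1) (amax A) -> Prop :=
  clos_refl_sym_trans _ (fun beta beta' =>
    [/\ MC_eq beta, MC_eq beta' & exists gamma, gauge_step gamma beta beta']).

Definition MC := Presentation MC_eq gauge_equiv.

End MaurerCartan.

(* [C^n = Hom (E^{(x) n}, End V)], as [n]-multilinear maps. *)
Section Cochains.
Variables (F : fieldType) (E : algType F) (V : vectType F) (n : nat).

Definition upd (x : {ffun 'I_n -> E}) (j : 'I_n) (u : E) : {ffun 'I_n -> E} :=
  [ffun k => if k == j then u else x k].

Definition multilinear (phi : {ffun 'I_n -> E} -> 'End(V)) : Prop :=
  forall x j a u v,
    phi (upd x j (a *: u + v)) = a *: phi (upd x j u) + phi (upd x j v).

Definition multilinear_pred : {pred {ffun 'I_n -> E} -> 'End(V)} :=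
  fun phi => `[< multilinear phi >].

Fact multilinear_submod : subsemimod_closed multilinear_pred.
Proof.
split; first split.
- by apply/asboolP => x j a u v /=; rewrite scaler0 addr0.
- move=> phi psi /asboolP mphi /asboolP mpsi; apply/asboolP => x j a u v.
  by rewrite [LHS]/GRing.add/= mphi mpsi scalerDr addrACA.
- move=> b phi /asboolP mphi; apply/asboolP => x j a u v.
  by rewrite [LHS]/GRing.scale/= mphi scalerDr !scalerA mulrC.
Qed.
HB.instance Definition _ :=
  GRing.isSubmodClosed.Build F ({ffun 'I_n -> E} -> 'End(V)) multilinear_pred
    multilinear_submod.

Record cochain := Cochain {
  cochain_fun :> {ffun 'I_n -> E} -> 'End(V);
  _ : cochain_fun \in multilinear_pred }.

HB.instance Definition _ := [isSub for cochain_fun].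
HB.instance Definition _ := [Choice of cochain by <:].
HB.instance Definition _ := [SubChoice_isSubLmodule of cochain by <:].

Lemma cochainP (phi : cochain) : multilinear phi.
Proof. by case: phi => phi /= /asboolP. Qed.

Lemma cochain_linE a (phi psi : cochain) x :
  (a *: phi + psi) x = a *: phi x + psi x.
Proof. by []. Qed.

End Cochains.

Record rep (F : fieldType) (E : algType F) (V : vectType F) := Rep {
  rep_fun :> {linear E -> 'End(V)};
  rep1 : rep_fun 1 = \1%VF;
  repM : forall x y : E, rep_fun (x * y) = (rep_fun x \o rep_fun y)%VF }.

(* For every field extension [iota : F -> K], the representation on [V (x) K]
   is irreducible: it is nonzero, and its only stable subspaces (row spaces of
   matrices [U], in coordinates) are zero and the whole space. *)
Definition absolutely_irreducible (F : fieldType) (E : algType F)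
    (V : vectType F) (rho : rep E V) : Prop :=
  forall (K : fieldType) (iota : {rmorphism F -> K}),
    (0 < \dim {:V})%N /\
    forall U : 'M[K]_(\dim {:V}),
      (forall x : E,
        (U *m map_mx iota (mxof (vbasis {:V}) (vbasis {:V}) (rho x)) <= U)%MS) ->
      U = 0 \/ (U :=: 1%:M)%MS.

Section Hochschild.
Variables (F : fieldType) (E : algType F) (V : vectType F).
Local Notation C := (cochain E V).

Lemma upd_lift n (x : {ffun 'I_n.+1 -> E}) (i : 'I_n.+1) j u :
  [ffun k => upd x (lift i j) u (lift i k)] =
  upd [ffun k => x (lift i k)] j u.
Proof. by apply/ffunP => k; rewrite !ffunE (inj_eq lift_inj). Qed.

Lemma upd_lift0 n (x : {ffun 'I_n.+1 -> E}) (i : 'I_n.+1) u :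
  [ffun k => upd x i u (lift i k)] = [ffun k => x (lift i k)].
Proof. by apply/ffunP => k; rewrite !ffunE eq_sym (negPf (neq_lift _ _)). Qed.

(* [(x_1, ..., x_i x_{i+1}, ..., x_{n+1})], counting from 0. *)
Definition merge n (i : 'I_n) (x : {ffun 'I_n.+1 -> E}) : {ffun 'I_n -> E} :=
  [ffun k : 'I_n =>
     if (k < i)%N then x (lift ord_max k)
     else if k == i then x (lift ord_max k) * x (lift ord0 k)
     else x (lift ord0 k)].

Lemma merge_upd n (i : 'I_n) (x : {ffun 'I_n.+1 -> E}) (j : 'I_n.+1) :
  exists (k : 'I_n) (g : {linear E -> E}),
    forall u, merge i (upd x j u) = upd (merge i x) k (g u).
Proof.
have Emax (k : 'I_n) : lift ord_max k = k :> nat by rewrite lift_max.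
have E0 (k : 'I_n) : lift ord0 k = k.+1 :> nat by [].
have i_lt := ltn_ord i; have j_lt := ltn_ord j.
case: (ltngtP j i) => [ji|ij|ji].
- have jn := ltn_trans ji (ltn_ord i).
  exists (Ordinal jn), (idfun : {linear E -> E}) => u; apply/ffunP => k.
  rewrite !ffunE -!val_eqE [val (lift ord_max k)]Emax [val (lift ord0 k)]E0 /=.
  by case: (ltngtP k i) => ki; do ?case: ifP => // *; lia.
- case: (ltngtP j i.+1) => [?|ij'|ij']; first by lia.
  + have jn : (j.-1 < n)%N by lia.
    exists (Ordinal jn), (idfun : {linear E -> E}) => u; apply/ffunP => k.
    rewrite !ffunE -!val_eqE [val (lift ord_max k)]Emax [val (lift ord0 k)]E0 /=.
    by case: (ltngtP k i) => ki; do ?case: ifP => // *; lia.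
  + exists i, (x (lift ord_max i) \*o idfun : {linear E -> E}) => u.
    apply/ffunP => k.
    rewrite !ffunE -!val_eqE [val (lift ord_max k)]Emax [val (lift ord0 k)]E0 /=.
    case: (ltngtP k i) => ki; do ?case: ifP => // *; try lia.
    by rewrite (val_inj ki).
- exists i, (x (lift ord0 i) \o* idfun : {linear E -> E}) => u.
  apply/ffunP => k.
  rewrite !ffunE -!val_eqE [val (lift ord_max k)]Emax [val (lift ord0 k)]E0 /=.
  case: (ltngtP k i) => ki; do ?case: ifP => // *; try lia.
  by rewrite (val_inj ki).
Qed.

Variable rho : rep E V.

(* The bimodule action of [(x, y)] on [phi : End V] is [rho x \o phi \o rho y]. *)
Definition hoch_diff_fun n (phi : C n) (x : {ffun 'I_n.+1 -> E}) : 'End(V) :=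
  (rho (x ord0) \o phi [ffun k => x (lift ord0 k)])%VF
  + (-1) ^+ n.+1 *: (phi [ffun k => x (lift ord_max k)] \o rho (x ord_max))%VF
  + \sum_(i < n) (-1) ^+ i.+1 *: phi (merge i x).

Lemma linear_add3 (W : lmodType F) (a : F) (f1 f2 f3 g1 g2 g3 h1 h2 h3 : W) :
  f1 = a *: f2 + f3 -> g1 = a *: g2 + g3 -> h1 = a *: h2 + h3 ->
  f1 + g1 + h1 = a *: (f2 + g2 + h2) + (f3 + g3 + h3).
Proof.
by move=> -> -> ->; rewrite !scalerDr (addrACA (a *: f2)) [RHS]addrACA.
Qed.

Lemma hoch_diff_multilinear n (phi : C n) :
  hoch_diff_fun phi \in @multilinear_pred F E V n.+1.
Proof.
have mphi := cochainP phi.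
apply/asboolP => x j a u v; rewrite /hoch_diff_fun; apply: linear_add3.
- case: (unliftP ord0 j) => [j' ->|->].
    rewrite !upd_lift mphi !ffunE (negPf (neq_lift _ _)).
    by rewrite comp_lfunDr comp_lfunZr.
  by rewrite !upd_lift0 !ffunE eqxx linearP comp_lfunDl comp_lfunZl.
- rewrite scalerA mulrC -scalerA -scalerDr; congr (_ *: _).
  case: (unliftP ord_max j) => [j' ->|->].
    rewrite !upd_lift mphi !ffunE (negPf (neq_lift _ _)).
    by rewrite comp_lfunDl comp_lfunZl.
  by rewrite !upd_lift0 !ffunE eqxx linearP comp_lfunDr comp_lfunZr.
- rewrite scaler_sumr -big_split; apply: eq_bigr => i _ /=.
  have [k [g Eg]] := merge_upd i x j.
  by rewrite !Eg linearP mphi scalerDr !scalerA mulrC.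
Qed.

Definition hoch_diff n (phi : C n) : C n.+1 :=
  Cochain (hoch_diff_multilinear phi).

Definition cup_fun a b (phi : C a) (psi : C b) (x : {ffun 'I_(a + b) -> E}) :
    'End(V) :=
  (phi [ffun i => x (lshift b i)] \o psi [ffun i => x (rshift a i)])%VF.

Lemma cup_multilinear a b (phi : C a) (psi : C b) :
  cup_fun phi psi \in @multilinear_pred F E V (a + b).
Proof.
have mphi := cochainP phi; have mpsi := cochainP psi.
apply/asboolP => x j c u v; rewrite /cup_fun.
case: (split_ordP j) => k ->.
- have El w : [ffun i => upd x (lshift b k) w (lshift b i)] =
              upd [ffun i => x (lshift b i)] k w.
    by apply/ffunP => i; rewrite !ffunE eq_lshift.
  have Er w : [ffun i => upd x (lshift b k) w (rshift a i)] =
              [ffun i => x (rshift a i)].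
    by apply/ffunP => i; rewrite !ffunE eq_rlshift.
  by rewrite !El !Er mphi comp_lfunDl comp_lfunZl.
- have Er w : [ffun i => upd x (rshift a k) w (rshift a i)] =
              upd [ffun i => x (rshift a i)] k w.
    by apply/ffunP => i; rewrite !ffunE eq_rshift.
  have El w : [ffun i => upd x (rshift a k) w (lshift b i)] =
              [ffun i => x (lshift b i)].
    by apply/ffunP => i; rewrite !ffunE eq_lrshift.
  by rewrite !El !Er mpsi comp_lfunDr comp_lfunZr.
Qed.

Definition cup a b (phi : C a) (psi : C b) : C (a + b) :=
  Cochain (cup_multilinear phi psi).

Fact hoch_diff_linear n : linear (@hoch_diff n).
Proof.
move=> a phi psi; apply: val_inj; apply/funext => x; apply: linear_add3.
- by rewrite cochain_linE comp_lfunDr comp_lfunZr.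
- by rewrite cochain_linE comp_lfunDl -comp_lfunZl scalerDr !scalerA mulrC.
- rewrite scaler_sumr -big_split; apply: eq_bigr => i _.
  by rewrite cochain_linE scalerDr !scalerA mulrC.
Qed.
HB.instance Definition _ n :=
  GRing.isSemilinear.Build F (C n) (C n.+1) _ (@hoch_diff n)
    (GRing.semilinear_linear (@hoch_diff_linear n)).

Definition cocycle_pred n : {pred C n} := fun phi => hoch_diff phi == 0.

Lemma cocycle_predE n (phi : C n) :
  (phi \in @cocycle_pred n) = (hoch_diff phi == 0).
Proof. by []. Qed.

Fact cocycle_submod n : subsemimod_closed (@cocycle_pred n).
Proof.
split; first split=> [|x y]; rewrite ?cocycle_predE.
- by rewrite raddf0.
- by move=> /eqP dx /eqP dy; rewrite raddfD /= dx dy addr0.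
- by move=> a x; rewrite !cocycle_predE linearZ => /eqP /= ->; rewrite scaler0.
Qed.
HB.instance Definition _ n :=
  GRing.isSubmodClosed.Build F (C n) (@cocycle_pred n) (@cocycle_submod n).

Record cocycle n := Cocycle {
  cocycle_val :> C n;
  _ : cocycle_val \in @cocycle_pred n }.

HB.instance Definition _ n := [isSub for @cocycle_val n].
HB.instance Definition _ n := [Choice of cocycle n by <:].
HB.instance Definition _ n := [SubChoice_isSubLmodule of cocycle n by <:].

Definition coboundary n : C n -> Prop :=
  match n with
  | 0 => fun phi => phi = 0
  | n'.+1 => fun phi => exists psi : C n', phi = hoch_diff psi
  end.

Lemma coboundary0 n : @coboundary n 0.
Proof. by case: n => [|n] //=; exists 0; rewrite raddf0. Qed.

Lemma coboundaryP n a (x y : C n) :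
  coboundary x -> coboundary y -> coboundary (a *: x + y).
Proof.
case: n x y => [|n] x y /=; first by move=> -> ->; rewrite scaler0 addr0.
by move=> [x' ->] [y' ->]; exists (a *: x' + y'); rewrite linearP.
Qed.

Definition exact_pred n : {pred cocycle n} :=
  fun z => `[< coboundary (cocycle_val z) >].

Fact exact_zmod n : zmod_closed (@exact_pred n).
Proof.
split=> [|x y]; first exact/asboolP/coboundary0.
move=> /asboolP bx /asboolP b_y; apply/asboolP.
by have := coboundaryP (-1) b_y bx; rewrite scaleN1r addrC.
Qed.
HB.instance Definition _ n :=
  GRing.isZmodClosed.Build (cocycle n) (@exact_pred n) (@exact_zmod n).

Definition cohom n := Quotient.quot (@exact_pred n).

HB.instance Definition _ n := GRing.Zmodule.on (cohom n).

Definition hclass n (z : cocycle n) : cohom n :=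
  (\pi_(Quotient.quot (@exact_pred n)) z)%qT.

Lemma hclass_eq n (z z' : cocycle n) :
  hclass z = hclass z' <-> coboundary (val z - val z').
Proof.
split=> [/eqP|b]; first by rewrite -Quotient.idealrBE => /asboolP.
by apply/eqP; rewrite -Quotient.idealrBE; apply/asboolP.
Qed.

Lemma hclass_repr n (c : cohom n) : hclass (repr c) = c.
Proof. exact: reprK. Qed.

Definition cohom_scale n (a : F) (c : cohom n) : cohom n :=
  hclass (a *: repr c).

Lemma hclassZ n a (z : cocycle n) : hclass (a *: z) = cohom_scale a (hclass z).
Proof.
set w := repr (hclass z); apply/hclass_eq.
have -> : val (a *: z) - val (a *: w) = a *: (val z - val w) + 0.
  by rewrite addr0 scalerBr.
by apply: coboundaryP (coboundary0 _); apply/hclass_eq; rewrite hclass_repr.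
Qed.

Lemma hclassD n (z z' : cocycle n) : hclass (z + z') = hclass z + hclass z'.
Proof. exact: Quotient.pi_add. Qed.

Fact cohom_scaleA n a b (c : cohom n) :
  cohom_scale a (cohom_scale b c) = cohom_scale (a * b) c.
Proof. by rewrite -[c]hclass_repr -!hclassZ scalerA. Qed.

Fact cohom_scale1 n : left_id 1 (@cohom_scale n).
Proof. by move=> c; rewrite -[c in LHS]hclass_repr -hclassZ scale1r hclass_repr. Qed.

Fact cohom_scaleDr n : right_distributive (@cohom_scale n) +%R.
Proof.
move=> a c c'; rewrite -[c]hclass_repr -[c']hclass_repr.
by rewrite -hclassD -!hclassZ scalerDr hclassD.
Qed.

Fact cohom_scaleDl n c : {morph (@cohom_scale n)^~ c : a b / a + b}.
Proof.
by move=> a b; rewrite -[c]hclass_repr -!hclassZ scalerDl hclassD.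
Qed.

HB.instance Definition _ n :=
  GRing.Zmodule_isLmodule.Build F (cohom n) (@cohom_scaleA n) (@cohom_scale1 n)
    (@cohom_scaleDr n) (@cohom_scaleDl n).

End Hochschild.

Notation cochains E V := (fun n => cochain E V n : lmodType _).
Notation cohoms rho := (fun n => cohom rho n : lmodType _).

Definition subspace (F : fieldType) (W : lmodType F) (S : set W) : Prop :=
  S 0 /\ forall a u v, S u -> S v -> S (a *: u + v).

Record retract (F : fieldType) (E : algType F) (V : vectType F)
    (rho : rep E V) := Retract {
  rharm : forall n, set (cochain E V n);
  rcompl : forall n, set (cochain E V n);
  rharm_subspace : forall n, subspace (@rharm n);
  rcompl_subspace : forall n, subspace (@rcompl n);
  retract_decomp : forall n (x : cochain E V n),
    exists! t : cochain E V n * cochain E V n * cochain E V n,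
      [/\ coboundary rho t.1.1, rharm t.1.2, rcompl t.2 & x = t.1.1 + t.1.2 + t.2];
  rharm_cocycle : forall n (x : cochain E V n), rharm x -> hoch_diff rho x = 0;
  rharm_cohom : forall n (c : cohom rho n),
    exists! z : cocycle rho n, rharm (cocycle_val z) /\ hclass z = c;
  rcompl_cocycle : forall n (x : cochain E V n),
    exists! t : cochain E V n * cochain E V n,
      [/\ hoch_diff rho t.1 = 0, rcompl t.2 & x = t.1 + t.2];
  rinc : forall n, {linear cohom rho n -> cochain E V n};
  rincE : forall n (z : cocycle rho n),
    rharm (cocycle_val z) -> rinc n (hclass z) = cocycle_val z;
  rproj : forall n, {linear cochain E V n -> cohom rho n};
  rproj_harm : forall n (z : cocycle rho n),
    rharm (cocycle_val z) -> rproj n (cocycle_val z) = hclass z;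
  rproj_cob : forall n (x : cochain E V n), coboundary rho x -> rproj n x = 0;
  rproj_compl : forall n (x : cochain E V n), rcompl x -> rproj n x = 0;
  rhom : forall n, {linear cochain E V n.+1 -> cochain E V n};
  rhom_diff : forall n (x : cochain E V n), rcompl x -> rhom n (hoch_diff rho x) = x;
  rhom_harm : forall n (x : cochain E V n.+1), rharm x -> rhom n x = 0;
  rhom_compl : forall n (x : cochain E V n.+1), rcompl x -> rhom n x = 0 }.

Section Transfer.
Variables (F : fieldType) (E : algType F) (V : vectType F) (rho : rep E V).
Local Notation C := (cochains E V).
Local Notation H := (cohoms rho).

Definition opC : ops C C := fun k s =>
  match s with
  | [:: x] => hcomp k (Tagged C (hoch_diff rho (tagged x)))
  | [:: x; y] => hcomp k (Tagged C (cup (tagged x) (tagged y)))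
  | _ => 0
  end.

Variable R : retract rho.

(* [h \o mtilde_n], where [h \o mtilde_1 = - id]. *)
Definition hmt_of (mt : ops C C) : ops C C := fun k s =>
  if s is [:: x] then - hcomp k x else rhom R k (mt k.+1 s).

Definition degsum (s : seq {d : nat & C d}) : nat := sumn (map tag s).

(* [\sum_(p + q = n) (-1)^(p + 1) mtilde_2 (h mtilde_p (x) h mtilde_q)], which
   is [mtilde_2] itself, the cup product, for [n = 2].  As [h mtilde_q] has
   degree [1 - q], moving it past the first [p] arguments gives the Koszul sign
   [(-1)^((q + 1) (|x_1| + ... + |x_p|))]. *)
Definition mt_step (mt : ops C C) : ops C C := fun k s =>
  \sum_(1 <= p < size s)
    (-1) ^+ (p.+1 + (size s - p).+1 * degsum (take p s))%N *:
    \sum_(a < k.+1)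
       hcomp k (Tagged C (cup (hmt_of mt a (take p s))
                              (hmt_of mt (k - a)%N (drop p s)))).

Fixpoint mt_rec (fuel : nat) : ops C C :=
  if fuel is fuel'.+1 then mt_step (mt_rec fuel') else fun _ _ => 0.

Definition mt : ops C C := fun k s => mt_rec (size s) k s.

Definition hmt : ops C C := hmt_of mt.

Definition hinc (x : {d : nat & H d}) : {d : nat & C d} :=
  Tagged C (rinc R (tag x) (tagged x)).

(* [m_1 = 0] and [m_n = p mtilde_n i^{(x) n}]. *)
Definition opH : ops H H := fun k s =>
  if (size s <= 1)%N then 0 else rproj R k (mt k (map hinc s)).

(* [f_n = - h mtilde_n i^{(x) n}], so that [f_1 = i]. *)
Definition opf : ops H C := fun k s => - hmt k (map hinc s).

(* The sign is the one for which [fstar] maps Maurer-Cartan elements to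
   Maurer-Cartan elements: the sign of [MC_eq] amounts to inserting [- s xi]
   in the bar construction, whence [- s^-1 (\sum_n g_n ((- s xi)^{(x) n}))],
   with the Koszul sign explained at [gauge_step]. *)
Definition fstar (A : artAlg F) (xi : tens (H 1) (amax A)) :
    tens (C 1) (amax A) :=
  \sum_(n \in [set n | (0 < n)%N]%classic)
     (- (-1) ^+ (n * n.+1)./2%N) *: extA opf 1 (nseq n (htag (X := H) xi)).

End Transfer.

Section Deformations.
Variables (F : fieldType) (E : algType F) (V : vectType F) (rho : rep E V).
Variable A : artAlg F.

Local Notation EndA := (tens 'End(V) {:A}).

Definition tone : EndA := tpure {:A} (\1%VF : 'End(V)) (1 : A).

Definition tmul (u v : EndA) : EndA :=
  \sum_i \sum_j
    tpure {:A} (u i \o v j)%VF ((vbasis {:A})`_i * (vbasis {:A})`_j).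

(* [u] is congruent to [w (x) 1] modulo [End V (x) amax A]. *)
Definition reduces_to (u : EndA) (w : 'End(V)) : Prop :=
  exists t : tens 'End(V) (amax A), u = tpure {:A} w 1 + tmap {:A} id t.

Definition is_lift (sigma : E -> EndA) : Prop :=
  [/\ linear sigma, sigma 1 = tone,
      forall x y, sigma (x * y) = tmul (sigma x) (sigma y)
    & forall x, reduces_to (sigma x) (rho x)].

Definition conjugate (sigma sigma' : E -> EndA) : Prop :=
  exists g g' : EndA,
    [/\ reduces_to g \1%VF, tmul g g' = tone, tmul g' g = tone
      & forall x, sigma' x = tmul (tmul g (sigma x)) g'].

Definition Def := Presentation is_lift conjugate.

Definition ev1 (phi : cochain E V 1) (x : E) : 'End(V) := phi [ffun=> x].

(* [rho (+) xi : x |-> rho x (x) 1 + xi x]. *)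
Definition rho_plus (xi : tens (cochain E V 1) (amax A)) (x : E) : EndA :=
  tpure {:A} (rho x) 1
  + \sum_k tpure {:A} (ev1 (xi k) x) (vbasis (amax A))`_k.

End Deformations.

(* [act] is the action on morphisms of a functor [A |-> quotient_set (P A)]
   given on representatives by [f]. *)
Definition functor_action (F : fieldType) (P : artAlg F -> presentation)
    (f : forall A A' : artAlg F, {lrmorphism A -> A'} -> pt (P A) -> pt (P A'))
    (act : forall A A' : artAlg F, {lrmorphism A -> A'} ->
       quotient_set (P A) -> quotient_set (P A')) : Prop :=
  forall (A A' : artAlg F) (theta : {lrmorphism A -> A'}),
    induces (f A A' theta) (act A A' theta).

Definition natural (F : fieldType) (P Q : artAlg F -> presentation)
    (actP : forall A A' : artAlg F, {lrmorphism A -> A'} ->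
       quotient_set (P A) -> quotient_set (P A'))
    (actQ : forall A A' : artAlg F, {lrmorphism A -> A'} ->
       quotient_set (Q A) -> quotient_set (Q A'))
    (eta : forall A, quotient_set (P A) -> quotient_set (Q A)) : Prop :=
  forall (A A' : artAlg F) (theta : {lrmorphism A -> A'}) c,
    eta A' (actP A A' theta c) = actQ A A' theta (eta A c).

Definition MC_map (F : fieldType) (X : nat -> lmodType F) (m : ops X X)
    (A A' : artAlg F) (theta : {lrmorphism A -> A'}) :
    pt (MC m A) -> pt (MC m A') :=
  tmap (amax A') theta.

Definition Def_map (F : fieldType) (E : algType F) (V : vectType F)
    (rho : rep E V) (A A' : artAlg F) (theta : {lrmorphism A -> A'}) :
    pt (Def rho A) -> pt (Def rho A') :=
  fun sigma x => tmap {:A'} theta (sigma x).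

(* Main.v *)
(* Let [i], [p], [h] be the retract and [eps_n = (-1)^(n(n+1)/2)], so that
   [eps_(s+t) = (-1)^(st) eps_s eps_t].  With these signs the recursion for the
   operations [mtilde_n] says that [x = f_* xi] is the unique solution of
   [x = i xi - h (x x)], and the Maurer-Cartan equation for [xi] becomes
   [p (x x) = 0].  Hence [f_*] is a bijection from [MC (H, A)] onto the slice
   [h x = 0] of [MC (C, A)]: the curvature [c = d x + x x] satisfies
   [c = h (c x - x c)], so it lies in every power of the maximal ideal and is 0.
   Every Maurer-Cartan element can be gauged into the slice, one power of the
   maximal ideal at a time.  By Schur's lemma [H^0] consists of scalars, and
   [h h = h i = p h = 0] makes [m_n] vanish on scalars for [n >= 3], so that the
   gauge relation on [H] is conjugation by [1 + amax A]; a gauge [1 + gamma]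
   between two points of the slice is itself scalar, because the [h d]-component
   [l] of [gamma] satisfies [l = h (l x' - x l)].
   Finally the gauge action of [1 + gamma] on [x] is the conjugation of
   [rho (+) x] in the ring [End V (x) A]. *)

Require Import Defs.
From HB Require Import structures.
From Stdlib Require Import Relation_Operators.
From mathcomp Require Import all_boot all_algebra all_field.
From mathcomp Require Import zify.
From mathcomp Require Import boolp classical_sets functions fsbigop.

Set Implicit Arguments.
Unset Strict Implicit.
Unset Printing Implicit Defensive.

Import GRing.Theory passmx.
Local Open Scope ring_scope.

(** * Identities in abelian groups *)

(** The argument lives in degrees 0 to 3: gauges, Maurer-Cartan elements, curvatures, and
    differentials of curvatures. There cochains are functions of at most three arguments, so the
    Hochschild identities can be checked by evaluation. Schur's lemma matters because multiplication
    by a scalar commutes with [i], [p] and [h], which multiplication by a general 0-cochain need not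
    do. Thus gauges from [H^0] preserve the slice, and the gauge relation of [H] is sent to that of
    [C] without correction terms. Conjugation in [End V (x) A] supplies two facts on the side of
    [C]: gauging by any [gamma] yields again a Maurer-Cartan element, and a chain of gauge steps can
    be replaced by a single one. The latter matters because it is a single gauge that can be
    projected to [H]. Since [f_* xi] is characterized by a fixed-point equation that morphisms of
    [A] preserve, its naturality follows from uniqueness and not from a comparison of sums. *)

Inductive zexpr := ZVar of nat | ZZero | ZAdd of zexpr & zexpr | ZOpp of zexpr.

Fixpoint zeval (V : zmodType) (env : seq V) (e : zexpr) : V :=
  match e with
  | ZVar n => nth 0 env n
  | ZZero => 0
  | ZAdd a b => zeval env a + zeval env b
  | ZOpp a => - zeval env a
  end.

Fixpoint zcoef (e : zexpr) (i : nat) : int :=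
  match e with
  | ZVar n => (n == i)%:Z
  | ZZero => 0
  | ZAdd a b => zcoef a i + zcoef b i
  | ZOpp a => - zcoef a i
  end.

Lemma zevalE (V : zmodType) (env : seq V) (e : zexpr) :
  zeval env e = \sum_(i < size env) env`_i *~ zcoef e i.
Proof.
elim: e => [n||a IHa b IHb|a IHa] /=.
- have [n_lt|n_ge] := ltnP n (size env).
    rewrite (bigD1 (Ordinal n_lt)) //= eqxx mulr1z big1 ?addr0 // => j.
    by rewrite -val_eqE /= eq_sym => /negPf ->; rewrite mulr0z.
  rewrite nth_default // big1 // => j _.
  by rewrite gtn_eqF ?mulr0z // (leq_trans _ n_ge).
- by rewrite big1.
- by rewrite IHa IHb -big_split; apply: eq_bigr => i _; rewrite mulrzDr.
- by rewrite IHa -sumrN; apply: eq_bigr => i _; rewrite mulrNz.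
Qed.

(** Once the terms are reified, the hypothesis is a closed boolean computation, which [abel]
    discharges by [isT]. *)
Lemma zexpr_eq (V : zmodType) (env : seq V) (a b : zexpr) :
  all (fun i => zcoef a i == zcoef b i) (iota 0 (size env)) ->
  zeval env a = zeval env b.
Proof.
move=> /allP ab; rewrite !zevalE; apply: eq_bigr => i _.
by rewrite (eqP (ab i _)) // mem_iota add0n ltn_ord.
Qed.

(* Canonical structures reach an instance along several convertible paths, so
   that atoms are compared up to conversion. *)
Ltac zsame x y := first [constr_eq x y | unify x y].

Ltac zlookup x env :=
  lazymatch env with
  | [::] => constr:(0%N)
  | ?y :: ?env' =>
    match constr:(Set) with
    | _ => let _ := match constr:(Set) with _ => zsame x y end in constr:(0%N)
    | _ => let n := zlookup x env' in constr:(n.+1)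
    end
  end.

Ltac zatoms e env :=
  lazymatch e with
  | (?a + ?b)%R => let env1 := zatoms a env in zatoms b env1
  | (- ?a)%R => zatoms a env
  | @GRing.zero _ => env
  | ?x =>
    let rec mem l := lazymatch l with
      | [::] => constr:(x :: env)
      | ?y :: ?l' => match constr:(Set) with
        | _ => let _ := match constr:(Set) with _ => zsame x y end in env
        | _ => mem l' end
      end in mem env
  end.

Ltac zreify e env :=
  lazymatch e with
  | (?a + ?b)%R => let a' := zreify a env in let b' := zreify b env in constr:(ZAdd a' b')
  | (- ?a)%R => let a' := zreify a env in constr:(ZOpp a')
  | @GRing.zero _ => constr:(ZZero)
  | ?x => let n := zlookup x env in constr:(ZVar n)
  end.

(* Decides equality in the free abelian group on the atoms. *)
Ltac abel :=
  lazymatch goal with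
  | |- @eq ?T ?a ?b =>
    let env := zatoms a (@nil T) in
    let env := zatoms b env in
    let a' := zreify a env in
    let b' := zreify b env in
    apply: (@zexpr_eq _ env a' b' isT)
  end.

(** * Tensors in coordinates *)

Section Tensors.
Variables (F : fieldType).

Lemma vbasis_memv (T : vectType F) (U : {vspace T}) (k : 'I_(\dim U)) :
  (vbasis U)`_k \in U.
Proof. by apply/vbasis_mem/mem_nth; rewrite size_tuple. Qed.

Section Pure.
Variables (W : lmodType F) (T : vectType F) (U : {vspace T}).

Lemma tpure_linl u : linear (fun w : W => tpure U w u).
Proof. by move=> a v w; apply/ffunP=> k; rewrite !ffunE scalerDr !scalerA mulrC. Qed.

Lemma tpure_linr (w : W) : linear (tpure U w).
Proof.
by move=> a u v; apply/ffunP=> k; rewrite !ffunE linearP /= scalerDl scalerA.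
Qed.

Lemma tpure0r (w : W) : tpure U w 0 = 0.
Proof. by apply/ffunP=> k; rewrite !ffunE linear0 scale0r. Qed.

Lemma tpure0l u : tpure U (0 : W) u = 0.
Proof. by apply/ffunP=> k; rewrite !ffunE scaler0. Qed.

Lemma tpure_suml I (r : seq I) (P : pred I) (G : I -> W) u :
  tpure U (\sum_(i <- r | P i) G i) u = \sum_(i <- r | P i) tpure U (G i) u.
Proof.
apply: (big_morph (fun w => tpure U w u)) => [v w|]; last exact: tpure0l.
by have := tpure_linl u 1 v w; rewrite !scale1r.
Qed.

Lemma tpure_sumr I (r : seq I) (P : pred I) (w : W) (G : I -> T) :
  tpure U w (\sum_(i <- r | P i) G i) = \sum_(i <- r | P i) tpure U w (G i).
Proof.
apply: (big_morph (tpure U w)) => [u v|]; last exact: tpure0r.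
by have := tpure_linr w 1 u v; rewrite !scale1r.
Qed.

Lemma tpureZ a (w : W) u : tpure U (a *: w) u = tpure U w (a *: u).
Proof. by apply/ffunP=> k; rewrite !ffunE [coord _ _ (a *: u)]linearZ /= scalerA mulrC. Qed.

Lemma tpureZl a (w : W) u : tpure U (a *: w) u = a *: tpure U w u.
Proof. by apply/ffunP=> k; rewrite !ffunE !scalerA mulrC. Qed.

Lemma tpureE (t : tens W U) : t = \sum_k tpure U (t k) (vbasis U)`_k.
Proof.
apply/ffunP=> k; rewrite sum_ffunE (bigD1 k) //= ffunE.
rewrite coord_free ?(basis_free (vbasisP U)) // eqxx scale1r big1 ?addr0 // => j jk.
by rewrite ffunE coord_free ?(basis_free (vbasisP U)) // (negPf jk) scale0r.
Qed.

(** Serves as an induction principle for tensors. Additivity suffices because [w] ranges over all of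
    [W] and absorbs the scalars. *)
Lemma tens_add_eq (Z : zmodType) (f g : tens W U -> Z) :
  {morph f : x y / x + y} -> {morph g : x y / x + y} ->
  (forall w (k : 'I_(\dim U)), f (tpure U w (vbasis U)`_k) = g (tpure U w (vbasis U)`_k)) -> f =1 g.
Proof.
move=> fD gD fg t; have h0 (h : tens W U -> Z) : {morph h : x y / x + y} -> h 0 = 0.
  by move=> hD; apply: (addrI (h 0)); rewrite -hD !addr0.
rewrite [t]tpureE (big_morph f fD (h0 f fD)) (big_morph g gD (h0 g gD)).
by apply: eq_bigr => k _; exact: fg.
Qed.

End Pure.

Section Map.
Variables (W : lmodType F) (T T' : vectType F).

Lemma tmap_linear (U : {vspace T}) (U' : {vspace T'}) (theta : T -> T') : linear (@tmap F W T T' U U' theta).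
Proof.
move=> a s t; rewrite /tmap scaler_sumr -big_split; apply: eq_bigr => k _ /=.
by rewrite !ffunE tpure_linl.
Qed.
HB.instance Definition _ (U : {vspace T}) (U' : {vspace T'}) theta := GRing.isSemilinear.Build F (tens W U) (tens W U') _
  (@tmap F W T T' U U' theta) (GRing.semilinear_linear (@tmap_linear U U' theta)).

Lemma tmap_pure (U : {vspace T}) (U' : {vspace T'}) (theta : {linear T -> T'}) (w : W) u :
  u \in U -> tmap U' theta (tpure U w u) = tpure U' w (theta u).
Proof.
move=> uU; rewrite [in RHS](coord_vbasis uU) linear_sum tpure_sumr.
by apply: eq_bigr => k _; rewrite ffunE tpureZ linearZ.
Qed.

Lemma tmap_basis (U : {vspace T}) (U' : {vspace T'}) (theta : T -> T') (w : W) (k : 'I_(\dim U)) :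
  tmap U' theta (tpure U w (vbasis U)`_k) = tpure U' w (theta (vbasis U)`_k).
Proof.
rewrite /tmap (bigD1 k) //= big1 => [|j jk]; last first.
  by rewrite ffunE coord_free ?(basis_free (vbasisP U)) // eq_sym (negPf jk) scale0r tpure0l.
by rewrite ffunE coord_free ?(basis_free (vbasisP U)) // eqxx scale1r addr0.
Qed.

End Map.

Lemma tmap_comp (W : lmodType F) (T T' T'' : vectType F) (U : {vspace T}) (U' : {vspace T'})
    (U'' : {vspace T''}) (theta : T -> T') (theta' : {linear T' -> T''}) (t : tens W U) :
  (forall u, u \in U -> theta u \in U') ->
  tmap U'' theta' (tmap U' theta t) = tmap U'' (theta' \o theta) t.
Proof.
move=> UU'; move: t; apply: tens_add_eq => [x y|x y|w k]; rewrite ?linearD //.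
by rewrite !tmap_basis tmap_pure // UU' ?vbasis_memv.
Qed.

Lemma tmap_id (W : lmodType F) (T : vectType F) (U : {vspace T}) (t : tens W U) :
  tmap U id t = t.
Proof. by rewrite [RHS]tpureE. Qed.

Section CoordinateMap.
Variables (W W' : lmodType F) (T : vectType F).
Implicit Types (U : {vspace T}).

(* [f (x) id]. *)
Definition tl U (f : W -> W') (t : tens W U) : tens W' U := [ffun k => f (t k)].

Lemma tl_linear U (f : {linear W -> W'}) : linear (tl (U := U) f).
Proof. by move=> a s t; apply/ffunP=> k; rewrite !ffunE linearP. Qed.
HB.instance Definition _ U (f : {linear W -> W'}) :=
  GRing.isSemilinear.Build F (tens W U) (tens W' U) _ (tl (U := U) f)
    (GRing.semilinear_linear (@tl_linear U f)).

Lemma tl_pure U (f : {linear W -> W'}) w u : tl f (tpure U w u) = tpure U (f w) u.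
Proof. by apply/ffunP=> k; rewrite !ffunE linearZ. Qed.

End CoordinateMap.

Lemma tl_tmap (W W' : lmodType F) (T T' : vectType F) (U : {vspace T}) (U' : {vspace T'})
    (f : {linear W -> W'}) (theta : T -> T') (t : tens W U) :
  tl f (tmap U' theta t) = tmap U' theta (tl f t).
Proof.
rewrite /tmap linear_sum; apply: eq_bigr => k _.
by rewrite /= tl_pure ffunE.
Qed.

Definition bilin (W1 W2 W3 : lmodType F) (mu : W1 -> W2 -> W3) :=
  (forall w, linear (mu^~ w)) /\ (forall w, linear (mu w)).

Section Product.
Variables (A : falgType F) (W1 W2 W3 : lmodType F) (mu : W1 -> W2 -> W3).
Implicit Types (U : {vspace A}).

(* The extension of [mu] which multiplies the coefficients in [A]; it is
   junk unless [U] is closed under multiplication. *)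
Definition tm U (s : tens W1 U) (t : tens W2 U) : tens W3 U :=
  \sum_i \sum_j tpure U (mu (s i) (t j)) ((vbasis U)`_i * (vbasis U)`_j).

Hypothesis mu_bilin : bilin mu.

Lemma bilinZl a v w : mu (a *: v) w = a *: mu v w.
Proof.
have [mu1 _] := mu_bilin; have /= := mu1 w a v 0; rewrite !addr0 => ->.
suff -> : mu 0 w = 0 by rewrite addr0.
by have /= := mu1 w (-1) 0 0; rewrite scaler0 addr0 scaleN1r addNr.
Qed.
Lemma bilinZr a v w : mu v (a *: w) = a *: mu v w.
Proof.
have [_ mu1] := mu_bilin; have /= := mu1 v a w 0; rewrite !addr0 => ->.
suff -> : mu v 0 = 0 by rewrite addr0.
by have /= := mu1 v (-1) 0 0; rewrite scaler0 addr0 scaleN1r addNr.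
Qed.
Lemma bilinDl v v' w : mu (v + v') w = mu v w + mu v' w.
Proof. by have [mu1 _] := mu_bilin; have /= := mu1 w 1 v v'; rewrite !scale1r. Qed.
Lemma bilinDr v w w' : mu v (w + w') = mu v w + mu v w'.
Proof. by have [_ mu1] := mu_bilin; have /= := mu1 v 1 w w'; rewrite !scale1r. Qed.

Lemma tm_linl U t : linear (fun s => tm (U := U) s t).
Proof.
have [mu1 _] := mu_bilin; move=> a s s'; rewrite /tm scaler_sumr -big_split.
apply: eq_bigr => i _ /=; rewrite scaler_sumr -big_split; apply: eq_bigr => j _ /=.
by rewrite !ffunE mu1 tpure_linl.
Qed.

Lemma tm_linr U s : linear (tm (U := U) s).
Proof.
have [_ mu1] := mu_bilin; move=> a t t'; rewrite /tm scaler_sumr -big_split.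
apply: eq_bigr => i _ /=; rewrite scaler_sumr -big_split; apply: eq_bigr => j _ /=.
by rewrite !ffunE mu1 tpure_linl.
Qed.

Lemma tm_bilin U : bilin (tm (U := U)).
Proof. by split=> [t|s]; [exact: tm_linl | exact: tm_linr]. Qed.

Lemma tm_pure U w1 w2 u1 u2 : u1 \in U -> u2 \in U ->
  tm (tpure U w1 u1) (tpure U w2 u2) = tpure U (mu w1 w2) (u1 * u2).
Proof.
move=> u1U u2U; rewrite [in RHS](coord_vbasis u1U) [in RHS](coord_vbasis u2U).
rewrite mulr_suml tpure_sumr; apply: eq_bigr => i _.
rewrite mulr_sumr tpure_sumr; apply: eq_bigr => j _.
rewrite !ffunE bilinZl bilinZr -scalerAl -scalerAr.
by rewrite tpureZ tpureZ scalerA mulrC scalerA.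
Qed.

End Product.
End Tensors.

Section Bilinear.
Variables (F : fieldType) (W1 W2 W3 : lmodType F) (mu : W1 -> W2 -> W3).
Hypothesis mu_bilin : bilin mu.

Lemma bilin0l w : mu 0 w = 0.
Proof. by have := bilinZl mu_bilin 0 0 w; rewrite !scale0r. Qed.
Lemma bilin0r w : mu w 0 = 0.
Proof. by have := bilinZr mu_bilin 0 w 0; rewrite !scale0r. Qed.
Lemma bilinNl v w : mu (- v) w = - mu v w.
Proof. by have := bilinZl mu_bilin (-1) v w; rewrite !scaleN1r. Qed.
Lemma bilinNr v w : mu v (- w) = - mu v w.
Proof. by have := bilinZr mu_bilin (-1) v w; rewrite !scaleN1r. Qed.
Lemma bilinBl v v' w : mu (v - v') w = mu v w - mu v' w.
Proof. by rewrite (bilinDl mu_bilin) bilinNl. Qed.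
Lemma bilinBr v w w' : mu v (w - w') = mu v w - mu v w'.
Proof. by rewrite (bilinDr mu_bilin) bilinNr. Qed.

Lemma bilin_suml I (r : seq I) (P : pred I) G w :
  mu (\sum_(i <- r | P i) G i) w = \sum_(i <- r | P i) mu (G i) w.
Proof. exact: (big_morph (mu^~ w) (fun x y => bilinDl mu_bilin x y w) (bilin0l w)). Qed.
Lemma bilin_sumr I (r : seq I) (P : pred I) G w :
  mu w (\sum_(i <- r | P i) G i) = \sum_(i <- r | P i) mu w (G i).
Proof. exact: (big_morph (mu w) (bilinDr mu_bilin w) (bilin0r w)). Qed.

Lemma bilin_comp (V1 V2 V3 : lmodType F) (f : {linear V1 -> W1}) (g : {linear V2 -> W2})
  (h : {linear W3 -> V3}) : bilin (fun v1 v2 => h (mu (f v1) (g v2))).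
Proof.
by split=> w a u v /=; rewrite linearP /= ?(bilinDl mu_bilin) ?(bilinDr mu_bilin)
  ?(bilinZl mu_bilin) ?(bilinZr mu_bilin) linearP.
Qed.

End Bilinear.

Section ProductTheory.
Variables (F : fieldType) (A : falgType F) (U : {vspace A}).

Lemma eq_tm (W1 W2 W3 : lmodType F) (mu nu : W1 -> W2 -> W3) (s : tens W1 U) t :
  (forall a b, mu a b = nu a b) -> tm mu s t = tm nu s t.
Proof. by move=> munu; apply: eq_bigr => i _; apply: eq_bigr => j _; rewrite munu. Qed.

Lemma tl_tm (W1 W2 W3 W4 : lmodType F) (mu : W1 -> W2 -> W3) (f : {linear W3 -> W4})
    (s : tens W1 U) t :
  tl f (tm mu s t) = tm (fun a b => f (mu a b)) s t.
Proof.
rewrite linear_sum; apply: eq_bigr => i _; rewrite linear_sum; apply: eq_bigr => j _.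
by rewrite /= tl_pure.
Qed.

Lemma tm_tl (V1 V2 W1 W2 W3 : lmodType F) (mu : W1 -> W2 -> W3) (f : V1 -> W1)
    (g : V2 -> W2) (s : tens V1 U) t :
  tm mu (tl f s) (tl g t) = tm (fun a b => mu (f a) (g b)) s t.
Proof. by apply: eq_bigr => i _; apply: eq_bigr => j _; rewrite !ffunE. Qed.

Hypothesis Umul : {in U &, forall u v, u * v \in U}.

(** Four products appear because the factors may lie in different degrees. Closure of [U] keeps the
    intermediate coefficients where [tm] is meaningful. *)
Lemma tmA (W1 W2 W3 X Y Z : lmodType F) (m12 : W1 -> W2 -> X) (m12_3 : X -> W3 -> Y)
    (m23 : W2 -> W3 -> Z) (m1_23 : W1 -> Z -> Y) (s : tens W1 U) (t : tens W2 U)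
    (r : tens W3 U) :
  bilin m12 -> bilin m12_3 -> bilin m23 -> bilin m1_23 ->
  (forall a b c, m12_3 (m12 a b) c = m1_23 a (m23 b c)) ->
  tm m12_3 (tm m12 s t) r = tm m1_23 s (tm m23 t r).
Proof.
move=> h1 h2 h3 h4 mA; have b1 := tm_bilin h1 U; have b2 := tm_bilin h2 U.
have b3 := tm_bilin h3 U; have b4 := tm_bilin h4 U.
move: s; apply: tens_add_eq => [x y|x y|w i]; rewrite ?(bilinDl b1) ?(bilinDl b2) ?(bilinDl b4) //.
move: t; apply: tens_add_eq => [x y|x y|w' j];
  rewrite ?(bilinDr b1) ?(bilinDl b2) ?(bilinDl b3) ?(bilinDr b4) //.
move: r; apply: tens_add_eq => [x y|x y|w'' k]; rewrite ?(bilinDr b2) ?(bilinDr b3) ?(bilinDr b4) //.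
have bU := vbasis_memv.
by rewrite !tm_pure ?Umul ?bU // mA mulrA.
Qed.

End ProductTheory.

(** Covers both the maps induced by morphisms of algebras and the inclusion of [amax A] into [A],
    for which [theta] is the identity. *)
Lemma tmap_tm (F : fieldType) (A A' : falgType F) (U : {vspace A}) (U' : {vspace A'})
    (theta : {linear A -> A'}) (W1 W2 W3 : lmodType F) (mu : W1 -> W2 -> W3)
    (s : tens W1 U) (t : tens W2 U) :
  {in U &, forall u v, u * v \in U} ->
  {in U &, forall u v, theta (u * v) = theta u * theta v} ->
  (forall u, u \in U -> theta u \in U') -> bilin mu ->
  tmap U' theta (tm mu s t) = tm mu (tmap U' theta s) (tmap U' theta t).
Proof.
move=> Umul thM thU hmu; have bm := tm_bilin hmu; have bU := vbasis_memv.
move: s; apply: tens_add_eq => [x y|x y|w i]; rewrite ?(bilinDl (bm _ _)) ?linearD ?(bilinDl (bm _ _)) //.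
move: t; apply: tens_add_eq => [x y|x y|w' j]; rewrite ?(bilinDr (bm _ _)) ?linearD ?(bilinDr (bm _ _)) //.
by rewrite !tm_pure ?bU // !tmap_pure ?Umul ?bU // tm_pure ?thU ?bU // thM ?bU.
Qed.

Section Filtration.
Variables (F : fieldType) (A : falgType F) (U : {vspace A}).

(* [t] lies in the image of [W (x) U']. *)
Definition tens_in (W : lmodType F) (U' : {vspace A}) (t : tens W U) :=
  exists t' : tens W U', t = tmap U id t'.

Lemma tens_in_lin (W : lmodType F) U' a (s t : tens W U) :
  tens_in U' s -> tens_in U' t -> tens_in U' (a *: s + t).
Proof. by move=> [s' ->] [t' ->]; exists (a *: s' + t'); rewrite linearP. Qed.

Lemma tens_in0 (W : lmodType F) U' : tens_in U' (0 : tens W U).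
Proof. by exists 0; rewrite linear0. Qed.

Lemma tens_inD (W : lmodType F) U' (s t : tens W U) :
  tens_in U' s -> tens_in U' t -> tens_in U' (s + t).
Proof. by move=> hs ht; rewrite -[s]scale1r; exact: tens_in_lin. Qed.

Lemma tens_inN (W : lmodType F) U' (s : tens W U) : tens_in U' s -> tens_in U' (- s).
Proof.
by move=> hs; rewrite -scaleN1r -[_ *: _]addr0; apply: tens_in_lin hs (tens_in0 _ _).
Qed.

Lemma tens_in_sum (W : lmodType F) U' I (r : seq I) (P : pred I) (G : I -> tens W U) :
  (forall i, P i -> tens_in U' (G i)) -> tens_in U' (\sum_(i <- r | P i) G i).
Proof. by move=> h; apply: big_ind => //; [exact: tens_in0 | exact: tens_inD]. Qed.

Lemma tens_in_pure (W : lmodType F) (U' : {vspace A}) (w : W) u :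
  u \in U' -> tens_in U' (tpure U w u).
Proof. by move=> uU'; exists (tpure U' w u); rewrite (tmap_pure U idfun). Qed.

Lemma tens_in_tl (W W' : lmodType F) (f : {linear W -> W'}) U' (t : tens W U) :
  tens_in U' t -> tens_in U' (tl f t).
Proof. by move=> [t' ->]; exists (tl f t'); rewrite tl_tmap. Qed.

Lemma tens_in_self (W : lmodType F) (t : tens W U) : tens_in U t.
Proof. by exists t; rewrite tmap_id. Qed.

Lemma tens_in_eq0 (W : lmodType F) (t : tens W U) : tens_in 0%VS t -> t = 0.
Proof.
case=> t' ->; rewrite /tmap big1 // => k; suff : False by [].
by case: k => k; rewrite dimv0.
Qed.

Lemma tens_in_tm (W1 W2 W3 : lmodType F) (mu : W1 -> W2 -> W3) (U1 U2 : {vspace A})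
    (s : tens W1 U) (t : tens W2 U) :
  bilin mu -> (U1 <= U)%VS -> (U2 <= U)%VS ->
  tens_in U1 s -> tens_in U2 t -> tens_in (U1 * U2)%VS (tm mu s t).
Proof.
move=> hmu /subvP U1U /subvP U2U [s' ->] [t' ->]; have bm := tm_bilin hmu U.
rewrite (bilin_suml bm); apply: tens_in_sum => i _.
rewrite (bilin_sumr bm); apply: tens_in_sum => j _.
rewrite tm_pure ?(U1U _ (vbasis_memv _)) ?(U2U _ (vbasis_memv _)) //; apply: tens_in_pure.
by rewrite memv_mul ?vbasis_memv.
Qed.

End Filtration.

(** * Nilpotency of the maximal ideal *)

Section Artinian.
Variables (F : fieldType) (A : artAlg F).
Local Notation m := (amax A).

(** Finite dimension makes one-sided inverses two-sided: left multiplication by [b] is injective,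
    hence onto, so [b] has a right inverse, which must be [a]. *)
Lemma falg_mulr1_unit (a b : A) : a * b = 1 -> a \is a GRing.unit.
Proof.
move=> ab1; have inj : lker (amull b) == 0%VS.
  apply/lker0P => x y; rewrite !lfunE /= => bxy.
  by rewrite -[x]mul1r -ab1 -mulrA bxy mulrA ab1 mul1r.
have := lker0_limgf inj; move/vspaceP=> /(_ 1); rewrite memvf => /memv_imgP[c _].
rewrite lfunE /= => bc1; apply/unitrP; exists b; split=> //.
by rewrite bc1; congr (_ * _); rewrite -[c]mul1r -ab1 -mulrA -bc1 mulr1.
Qed.

(** [amax] is given as a subspace; it is an ideal because a factor of a unit is a unit. *)
Lemma amax_mulr (a b : A) : a \in m -> a * b \in m.
Proof.
rewrite !amaxE; apply: contra => /unitrP[c [_ abc]].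
by apply: (@falg_mulr1_unit _ (b * c)); rewrite mulrA.
Qed.

Lemma falg_mull1_unit (a b : A) : a * b = 1 -> b \is a GRing.unit.
Proof.
move=> ab1; have ua := falg_mulr1_unit ab1.
suff -> : b = a^-1 by rewrite unitrV.
by apply: (mulrI ua); rewrite ab1 mulrV.
Qed.

Lemma amax_mull (a b : A) : b \in m -> a * b \in m.
Proof.
rewrite !amaxE; apply: contra => /unitrP[c [cab _]].
by apply: (@falg_mull1_unit (c * a)); rewrite -mulrA.
Qed.

Lemma amax_mul : {in m &, forall u v, u * v \in m}.
Proof. by move=> u v um _; exact: amax_mulr. Qed.

Lemma amax_sqr : (m * m <= m)%VS.
Proof. by apply/prodvP => u v um vm; exact: amax_mul. Qed.

Lemma expv_amax_sub n : (m ^+ n.+1 <= m)%VS.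
Proof.
elim: n => [|n IH]; first by rewrite expv1.
by rewrite expvSl; apply: subv_trans amax_sqr; exact: prodvSr.
Qed.

Lemma unit_1B (a : A) : a \in m -> 1 - a \is a GRing.unit.
Proof.
move=> am; apply/negPn/negP; rewrite -amaxE => am1.
by have := memvD am1 am; rewrite subrK amaxE unitr1.
Qed.

(* Nakayama's lemma: a maximal proper left submodule [N] of [M] satisfies
   [M = N + A x], so that [m M = M] puts [(1 - a) x] in [N] for some [a] in [m]. *)
Lemma amax_nakayama (M : {vspace A}) :
  (fullv * M <= M)%VS -> (m * M)%VS = M -> M = 0%VS.
Proof.
move=> AM mM; apply/eqP/negPn/negP => M0.
pose ok (d : nat) := `[< exists N : {vspace A},
  [/\ (fullv * N <= N)%VS, (N <= M)%VS, N != M & \dim N = d] >].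
have ok0 : exists d, ok d.
  by exists 0%N; apply/asboolP; exists 0%VS; rewrite prodv0 subvv sub0v eq_sym M0 dimv0.
have okM d : ok d -> (d <= \dim M)%N by move=> /asboolP[N [_ NM _ <-]]; exact: dimvS.
case: (ex_maxnP ok0 okM) => d /asboolP[N [AN NM NneM dN]] dmax.
have /subvPn[x xM xN] : ~~ (M <= N)%VS by apply: contra NneM => MN; rewrite eqEsubv NM.
have AX (a y : A) X : (fullv * X <= X)%VS -> y \in X -> a * y \in X.
  by move=> AXX yX; apply: (subvP AXX); rewrite memv_mul ?memvf.
have NxM : (N + fullv * <[x]>)%VS = M.
  apply/eqP/negPn/negP => ne; set N' := (N + _)%VS in ne.
  have : ok (\dim N').
    apply/asboolP; exists N'; split=> //.
      rewrite prodvDr addvS // prodvA prodvSl // prodv_sub ?subvf //.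
    rewrite subv_add NM /=; apply: subv_trans AM; apply: prodvSr.
    by rewrite -memvE.
  move=> /dmax; rewrite -dN leqNgt => /negP; apply.
  rewrite ltn_neqAle dimvS ?addvSl // andbT; apply/negP => /eqP ed.
  have /eqP eN : N == N' by rewrite eqEdim addvSl /= ed.
  move: xN; rewrite eN; case/negP; apply: (subvP (addvSr _ _)).
  by rewrite -{1}[x]mul1r memv_mul ?memvf ?memv_line.
(* From [M = m M = m N + m A x], where [m N] lies in [N] and [m A] in [m]. *)
have : x \in (N + m * <[x]>)%VS.
  apply: (subvP (_ : M <= _)%VS) => //; rewrite -{1}mM -{1}NxM prodvDr prodvA addvS //.
    by apply/prodvP => a y _ yN; exact: AX.
  by apply: prodvSl; apply/prodvP => a b am _; exact: amax_mulr.
case/memv_addP => y yN [z zm exyz].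
have [a am ez] : exists2 a, a \in m & z = a * x.
  have : (m * <[x]> <= amulr x @: m)%VS.
    apply/prodvP => a _ am /vlineP[c ->].
    by rewrite -scalerAr scalerAl -[_ * x](_ : amulr x (c *: a) = _) ?memv_img ?memvZ // lfunE.
  by move/subvP/(_ z zm)/memv_imgP => [a am ->]; exists a => //; rewrite lfunE.
case/negP: xN; rewrite -[x](mulKr (unit_1B am)); apply: AX => //.
by rewrite mulrBl mul1r {1}exyz ez addrK.
Qed.

(** The powers decrease, so one of minimal dimension is fixed by multiplication by [m], and
    Nakayama's lemma applies to it. *)
Lemma amax_nilp : exists N, (m ^+ N.+1)%VS = 0%VS.
Proof.
pose ok (d : nat) := `[< exists n, \dim (m ^+ n.+1) = d >].
have ok0 : exists d, ok d by exists (\dim m); apply/asboolP; exists 0%N; rewrite expv1.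
case: (ex_minnP ok0) => d /asboolP[n dn] dmin; exists n.
have sub : (m ^+ n.+2 <= m ^+ n.+1)%VS.
  rewrite (expvD m 2 n) (expvSl m n); apply: prodvSl; exact: amax_sqr.
apply: amax_nakayama.
  by rewrite expvSl prodvA; apply: prodvSl; apply/prodvP => a b _; exact: amax_mull.
rewrite -expvSl; apply/eqP; rewrite eqEdim sub /= dn; apply: dmin.
by apply/asboolP; exists n.+1.
Qed.

Lemma amax_expr (a : A) n : a \in m -> a ^+ n \in (m ^+ n)%VS.
Proof.
by move=> am; elim: n => [|n IH]; [exact: memv_line | rewrite exprS expvSl memv_mul].
Qed.

End Artinian.

(** Morphisms are local automatically: elements of [amax A] are nilpotent, and a nilpotent element
    cannot be sent to a unit. *)
Lemma amax_morph (F : fieldType) (A A' : artAlg F) (theta : {lrmorphism A -> A'}) (a : A) :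
  a \in amax A -> theta a \in amax A'.
Proof.
move=> am; have [N mN] := amax_nilp A; rewrite amaxE; apply/negP => /(unitrX N.+1).
by rewrite -rmorphXn; have := amax_expr N.+1 am; rewrite mN memv0 => /eqP ->; rewrite rmorph0 unitr0.
Qed.

(** * Hochschild cochains of low degree *)

Section LowDegree.
Variables (F : fieldType) (E : algType F) (V : vectType F) (rho : rep E V).
Local Notation C := (cochain E V).
Local Notation d := (hoch_diff rho).
Local Notation "f ∘ g" := (comp_lfun f g) (at level 40, left associativity).

Lemma cochain_ext n (phi psi : C n) : (forall x, phi x = psi x) -> phi = psi.
Proof. by move=> e; apply: val_inj; apply/funext. Qed.

Lemma cochainDE n (phi psi : C n) x : (phi + psi) x = phi x + psi x. Proof. by []. Qed.
Lemma cochainNE n (phi : C n) x : (- phi) x = - phi x. Proof. by []. Qed.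

(** With explicit tuples of arguments, a cochain of degree at most 3 becomes an ordinary function,
    and identities between cochains become identities in [End V]. *)
Definition arg0 : {ffun 'I_0 -> E} := [ffun=> 0].
Definition arg1 (a : E) : {ffun 'I_1 -> E} := [ffun=> a].
Definition arg2 (a b : E) : {ffun 'I_2 -> E} := [ffun i => if i == ord0 then a else b].
Definition arg3 (a b c : E) : {ffun 'I_3 -> E} :=
  [ffun i => if i == ord0 then a else if i == ord_max then c else b].

Lemma arg0E (x : {ffun 'I_0 -> E}) : x = arg0.
Proof. by apply/ffunP => -[]. Qed.
Lemma arg1E (x : {ffun 'I_1 -> E}) : x = arg1 (x ord0).
Proof. by apply/ffunP => i; rewrite ffunE ord1. Qed.
Lemma arg2E (x : {ffun 'I_2 -> E}) : x = arg2 (x ord0) (x ord_max).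
Proof.
by apply/ffunP => -[[|[|//]] ?]; rewrite ffunE; congr (x _); apply: val_inj.
Qed.
Lemma arg3E (x : {ffun 'I_3 -> E}) : x = arg3 (x ord0) (x (lift ord0 ord0)) (x ord_max).
Proof.
by apply/ffunP => -[[|[|[|//]]] ?]; rewrite ffunE; congr (x _); apply: val_inj.
Qed.

Definition ev0 (phi : C 0) : 'End(V) := phi arg0.
Definition ev2 (phi : C 2) a b : 'End(V) := phi (arg2 a b).
Definition ev3 (phi : C 3) a b c : 'End(V) := phi (arg3 a b c).

Lemma ev0E (phi : C 0) x : phi x = ev0 phi. Proof. by rewrite [x in LHS]arg0E. Qed.
Lemma ev1E (phi : C 1) x : phi x = ev1 phi (x ord0). Proof. by rewrite [x in LHS]arg1E. Qed.
Lemma ev2E (phi : C 2) x : phi x = ev2 phi (x ord0) (x ord_max).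
Proof. by rewrite [x in LHS]arg2E. Qed.
Lemma ev3E (phi : C 3) x : phi x = ev3 phi (x ord0) (x (lift ord0 ord0)) (x ord_max).
Proof. by rewrite [x in LHS]arg3E. Qed.

Lemma cochain_ext0 (phi psi : C 0) : ev0 phi = ev0 psi -> phi = psi.
Proof. by move=> e; apply: cochain_ext => x; rewrite !ev0E. Qed.
Lemma cochain_ext1 (phi psi : C 1) : (forall a, ev1 phi a = ev1 psi a) -> phi = psi.
Proof. by move=> e; apply: cochain_ext => x; rewrite !ev1E. Qed.
Lemma cochain_ext2 (phi psi : C 2) : (forall a b, ev2 phi a b = ev2 psi a b) -> phi = psi.
Proof. by move=> e; apply: cochain_ext => x; rewrite !ev2E. Qed.
Lemma cochain_ext3 (phi psi : C 3) :
  (forall a b c, ev3 phi a b c = ev3 psi a b c) -> phi = psi.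
Proof. by move=> e; apply: cochain_ext => x; rewrite !ev3E. Qed.

Lemma d0E (phi : C 0) a : ev1 (d phi) a = rho a ∘ ev0 phi - ev0 phi ∘ rho a.
Proof.
rewrite /ev1 /= /hoch_diff_fun big_ord0 addr0 expr1 scaleN1r.
by rewrite !ev0E !ffunE.
Qed.

Lemma d1E (phi : C 1) a b :
  ev2 (d phi) a b = rho a ∘ ev1 phi b + ev1 phi a ∘ rho b - ev1 phi (a * b).
Proof.
rewrite /ev2 /= /hoch_diff_fun big_ord1 sqrrN expr1n scale1r expr1 scaleN1r.
by rewrite !ev1E !ffunE.
Qed.

Lemma d2E (phi : C 2) a b c :
  ev3 (d phi) a b c = rho a ∘ ev2 phi b c - ev2 phi a b ∘ rho c
    - ev2 phi (a * b) c + ev2 phi a (b * c).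
Proof.
rewrite /ev3 /= /hoch_diff_fun !big_ord_recl big_ord0 addr0 /bump /= /bump /= ?add1n.
rewrite sqrrN expr1n scale1r expr1 scaleN1r exprS sqrrN expr1n mulr1 scaleN1r addrA.
by rewrite !ev2E !ffunE.
Qed.

(** Fixing the degrees lets the sum [a + b] compute, so that [cup] takes values in [C 1], [C 2],
    [C 3] without transport. *)
Definition cup00 : C 0 -> C 0 -> C 0 := @cup F E V 0 0.
Definition cup01 : C 0 -> C 1 -> C 1 := @cup F E V 0 1.
Definition cup10 : C 1 -> C 0 -> C 1 := @cup F E V 1 0.
Definition cup11 : C 1 -> C 1 -> C 2 := @cup F E V 1 1.
Definition cup02 : C 0 -> C 2 -> C 2 := @cup F E V 0 2.
Definition cup20 : C 2 -> C 0 -> C 2 := @cup F E V 2 0.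
Definition cup12 : C 1 -> C 2 -> C 3 := @cup F E V 1 2.
Definition cup21 : C 2 -> C 1 -> C 3 := @cup F E V 2 1.

Lemma cup_bilin a b : bilin (@cup F E V a b).
Proof.
split=> [psi c phi phi'|phi c psi psi']; apply: cochain_ext => x /=; rewrite /cup_fun.
  by rewrite cochain_linE comp_lfunDl -comp_lfunZl.
by rewrite cochain_linE comp_lfunDr -comp_lfunZr.
Qed.

Lemma cup00_bilin : bilin cup00. Proof. exact: cup_bilin. Qed.
Lemma cup01_bilin : bilin cup01. Proof. exact: cup_bilin. Qed.
Lemma cup10_bilin : bilin cup10. Proof. exact: cup_bilin. Qed.
Lemma cup11_bilin : bilin cup11. Proof. exact: cup_bilin. Qed.
Lemma cup02_bilin : bilin cup02. Proof. exact: cup_bilin. Qed.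
Lemma cup20_bilin : bilin cup20. Proof. exact: cup_bilin. Qed.
Lemma cup12_bilin : bilin cup12. Proof. exact: cup_bilin. Qed.
Lemma cup21_bilin : bilin cup21. Proof. exact: cup_bilin. Qed.

Lemma cup00E phi psi : ev0 (cup00 phi psi) = ev0 phi ∘ ev0 psi.
Proof. by rewrite [LHS]/= /cup_fun !ev0E. Qed.
Lemma cup01E phi psi a : ev1 (cup01 phi psi) a = ev0 phi ∘ ev1 psi a.
Proof. by rewrite [LHS]/= /cup_fun ev0E ev1E !ffunE. Qed.
Lemma cup10E phi psi a : ev1 (cup10 phi psi) a = ev1 phi a ∘ ev0 psi.
Proof. by rewrite [LHS]/= /cup_fun ev0E ev1E !ffunE. Qed.
Lemma cup11E phi psi a b : ev2 (cup11 phi psi) a b = ev1 phi a ∘ ev1 psi b.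
Proof. by rewrite [LHS]/= /cup_fun !ev1E !ffunE. Qed.
Lemma cup12E phi psi a b c : ev3 (cup12 phi psi) a b c = ev1 phi a ∘ ev2 psi b c.
Proof. by rewrite [LHS]/= /cup_fun ev1E ev2E !ffunE. Qed.
Lemma cup21E phi psi a b c : ev3 (cup21 phi psi) a b c = ev2 phi a b ∘ ev1 psi c.
Proof. by rewrite [LHS]/= /cup_fun ev1E ev2E !ffunE. Qed.
Lemma cup02E phi psi a b : ev2 (cup02 phi psi) a b = ev0 phi ∘ ev2 psi a b.
Proof. by rewrite [LHS]/= /cup_fun ev0E ev2E !ffunE. Qed.
Lemma cup20E phi psi a b : ev2 (cup20 phi psi) a b = ev2 phi a b ∘ ev0 psi.
Proof. by rewrite [LHS]/= /cup_fun ev0E ev2E !ffunE. Qed.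

Let lfunE := (@comp_lfunDl F V V V, @comp_lfunDr F V V V, @comp_lfunNl F V V V,
  @comp_lfunNr F V V V, @comp_lfunA F V V V V).

Lemma dd0 (phi : C 0) : d (d phi) = 0.
Proof.
apply: cochain_ext2 => a b; rewrite d1E !d0E repM !lfunE.
(* The value of the zero cochain is only convertible to 0; this exposes the zero to [abel]. *)
transitivity (0 : 'End(V)) => //; abel.
Qed.

Lemma dd1 (phi : C 1) : d (d phi) = 0.
Proof.
apply: cochain_ext3 => a b c; rewrite d2E !d1E !repM !lfunE !mulrA.
transitivity (0 : 'End(V)) => //; abel.
Qed.

Lemma d_cup11 (phi psi : C 1) :
  d (cup11 phi psi) = cup21 (d phi) psi - cup12 phi (d psi).
Proof.
apply: cochain_ext3 => a b c; rewrite d2E [RHS]/ev3 cochainDE cochainNE -!/(ev3 _ _ _ _).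
rewrite cup21E cup12E !d1E !cup11E !lfunE.
abel.
Qed.

Lemma cupA111 a b c : cup21 (cup11 a b) c = cup12 a (cup11 b c).
Proof. by apply: cochain_ext3 => x y z; rewrite cup21E cup12E !cup11E comp_lfunA. Qed.
Lemma cupA011 a b c : cup11 (cup01 a b) c = cup02 a (cup11 b c).
Proof. by apply: cochain_ext2 => x y; rewrite cup02E !cup11E cup01E comp_lfunA. Qed.
Lemma cupA101 a b c : cup11 (cup10 a b) c = cup11 a (cup01 b c).
Proof. by apply: cochain_ext2 => x y; rewrite !cup11E cup01E cup10E comp_lfunA. Qed.
Lemma cupA110 a b c : cup20 (cup11 a b) c = cup11 a (cup10 b c).
Proof. by apply: cochain_ext2 => x y; rewrite cup20E !cup11E cup10E comp_lfunA. Qed.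

End LowDegree.

(** * The homotopy retract *)

Section RetractFacts.
Variables (F : fieldType) (E : algType F) (V : vectType F) (rho : rep E V).
Variable R : retract rho.
Local Notation C := (cochain E V).
Local Notation d := (hoch_diff rho).

(** The bounds on [n] here and below come from [dd0] and [dd1], which give [d d = 0] on degrees 0
    and 1. *)
Lemma coboundary_cocycle n (x : C n) : (n <= 2)%N -> coboundary rho x -> d x = 0.
Proof.
case: n x => [|[|[|//]]] x _ /=; first by move=> ->; rewrite linear0.
  by move=> [y ->]; exact: dd0.
by move=> [y ->]; exact: dd1.
Qed.

Lemma inc_harm n (c : cohom rho n) : rharm R (rinc R n c).
Proof. by have [z [[hz <-] _]] := rharm_cohom R c; rewrite rincE. Qed.

Lemma proj_inc n (c : cohom rho n) : rproj R n (rinc R n c) = c.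
Proof. by have [z [[hz <-] _]] := rharm_cohom R c; rewrite rincE // rproj_harm. Qed.

Lemma inc_proj n (x : C n) : rharm R x -> rinc R n (rproj R n x) = x.
Proof.
move=> hx; have dx : x \in @cocycle_pred F E V rho n.
  by rewrite cocycle_predE (rharm_cocycle hx).
by rewrite -[x]/(cocycle_val (Cocycle dx)) rproj_harm // rincE.
Qed.

Lemma diff_inc n (c : cohom rho n) : d (rinc R n c) = 0.
Proof. exact/(rharm_cocycle (inc_harm c)). Qed.

Lemma hom_inc n (c : cohom rho n.+1) : rhom R n (rinc R n.+1 c) = 0.
Proof. exact/rhom_harm/inc_harm. Qed.

Lemma proj_diff n (x : C n) : rproj R n.+1 (d x) = 0.
Proof. by apply: rproj_cob; exists x. Qed.

(** The coboundary and the harmonic components of [x] are cocycles, so [d] sees only the third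
    component. *)
Lemma hom_diff_compl n (x : C n) : (n <= 2)%N ->
  exists2 l, rcompl R l & d x = d l.
Proof.
move=> n2; have [[[b z] l] [[/= hb hz hl ->] _]] := retract_decomp R x.
exists l => //; rewrite !linearD /= (coboundary_cocycle n2 hb) (rharm_cocycle hz).
by rewrite !add0r.
Qed.

Lemma hom_compl n (x : C n.+1) : (n <= 2)%N -> rcompl R (rhom R n x).
Proof.
move=> n2; have [[[b z] l] [[/= [y ->] hz hl ->] _]] := retract_decomp R x.
have [l' hl' ->] := hom_diff_compl y n2.
by rewrite !linearD /= (rhom_diff hl') (rhom_harm hz) (rhom_compl hl) !addr0.
Qed.

Lemma proj_hom n (x : C n.+1) : (n <= 2)%N -> rproj R n (rhom R n x) = 0.
Proof. by move=> n2; exact/rproj_compl/hom_compl. Qed.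

Lemma hom_hom n (x : C n.+2) : (n <= 1)%N -> rhom R n (rhom R n.+1 x) = 0.
Proof. by move=> n1; exact/rhom_compl/hom_compl. Qed.

Lemma hom_diff_hom n (x : C n.+1) : (n <= 2)%N ->
  rhom R n (d (rhom R n x)) = rhom R n x.
Proof. by move=> n2; exact/rhom_diff/hom_compl. Qed.

(** The three terms recover the three components of [x]: [d h] is the identity on coboundaries,
    [i p] on the harmonic part and [h d] on the complement, and each kills the other two. *)
Lemma retract_homotopy n (x : C n.+1) : (n <= 1)%N ->
  x = d (rhom R n x) + rinc R n.+1 (rproj R n.+1 x) + rhom R n.+1 (d x).
Proof.
move=> n1; have n2 : (n <= 2)%N by lia.
have [[[b z] l] [[/= hb hz hl ex] _]] := retract_decomp R x; rewrite {1}ex.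
congr (_ + _ + _).
- have [y eb] := hb; have [l' hl' eyl] := hom_diff_compl y n2.
  rewrite ex eb eyl !linearD /= (rhom_diff hl') (rhom_harm hz) (rhom_compl hl).
  by rewrite !linear0 !addr0.
- rewrite ex !linearD /= (rproj_cob R (hb : coboundary rho b)) (rproj_compl hl) !linear0 addr0 add0r.
  by rewrite inc_proj.
- by rewrite ex !linearD /= coboundary_cocycle ?(rharm_cocycle hz) // !linear0 !add0r rhom_diff.
Qed.

Lemma retract_homotopy0 (x : C 0) : x = rinc R 0 (rproj R 0 x) + rhom R 0 (d x).
Proof.
have [[[b z] l] [[/= hb hz hl ex] _]] := retract_decomp R x.
rewrite ex hb add0r !linearD /= (rproj_compl hl) (rharm_cocycle hz) !linear0 addr0 add0r.
by rewrite inc_proj // rhom_diff.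
Qed.

End RetractFacts.

(** * Schur's lemma over a field that need not be algebraically closed *)

Section Schur.

(** A nonconstant divisor of least size is irreducible. *)
Lemma exists_irreducible_dvdp (F : fieldType) (p : {poly F}) :
  (1 < size p)%N -> exists2 q, irreducible_poly q & q %| p.
Proof.
move=> p_gt1; pose ok n := `[< exists q : {poly F}, [/\ (1 < size q)%N, q %| p & size q = n] >].
have ok0 : exists n, ok n by exists (size p); apply/asboolP; exists p.
case: (ex_minnP ok0) => n /asboolP[q [q_gt1 qp sq]] nmin; exists q => //; split=> // r r1 rq.
have q0 : q != 0 by rewrite -size_poly_gt0 ltnW.
rewrite -dvdp_size_eqp // eqn_leq dvdp_leq //= sq.
apply: nmin; apply/asboolP; exists r; split=> //; last exact: dvdp_trans rq qp.
have r0 : r != 0 by apply: contraTneq rq => ->; rewrite dvd0p.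
by rewrite ltn_neqAle eq_sym r1 size_poly_gt0.
Qed.

Variables (F : fieldType) (E : algType F) (V : vectType F) (rho : rep E V).
Hypothesis rho_irr : absolutely_irreducible rho.

(** Irreducibility is applied over the extension [L] generated by a root [z] of an irreducible
    factor of the characteristic polynomial. The eigenspace of [phi] for [z] is nonzero and stable,
    hence everything. *)
Lemma schur (phi : 'End(V)) : (forall x, (rho x \o phi = phi \o rho x)%VF) ->
  exists a : F, phi = a *: \1%VF.
Proof.
move=> phiC; pose b := vbasis {:V}; pose mx := mxof b b.
have bb : basis_of fullv b := vbasisP _; have fb : free b := basis_free bb.
have [V_gt0 _] := rho_irr idfun.
pose p := char_poly (mx phi).
have [|q qirr qp] := @exists_irreducible_dvdp F p; first by rewrite size_char_poly.
have [L _ [z qz _]] := irredp_FAdjoin qirr.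
pose M := map_mx (in_alg L) (mx phi).
have [_ /(_ (eigenspace M z))] := rho_irr (in_alg L).
case=> [x||/eqmxP e1].
- apply: comm_mx_stable_eigenspace; rewrite /comm_mx /M -!map_mxM; congr map_mx.
  have mxM f g : mx (f \o g)%VF = mx g *m mx f by exact: mxof_comp.
  by rewrite -/(mx (rho x)) -!mxM phiC.
- move=> /eqP e0; have : root (char_poly M) z.
    have /dvdpP[r ep] := qp; rewrite /M -map_char_poly -/p ep rmorphM /= rootM.
    by rewrite qz orbT.
  by rewrite -eigenvalue_root_char /eigenvalue e0.
have {}e1 : (1%:M <= eigenspace M z)%MS by case/andP: e1.
have /eigenspaceP := e1; rewrite mul1mx => MzM.
(* Over [L] the matrix of [phi] is the scalar [z]; its diagonal entries come from [F], hence so does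
   [z]. *)
pose i0 := Ordinal V_gt0; exists (mx phi i0 i0).
have Mij k l : in_alg L (mx phi k l) = z *+ (k == l).
  by move/matrixP/(_ k l): MzM; rewrite [LHS]mxE [RHS]mxE => ->; rewrite mxE mulr_natr.
have mphi : mx phi = mx phi i0 i0 *: 1%:M.
  apply/matrixP => i j; rewrite [RHS]mxE [1%:M _ _]mxE; apply: (fmorph_inj (in_alg L)).
  rewrite rmorphM -[LHS]/(in_alg L (mx phi i j)) -[X in _ = X * _]/(in_alg L (mx phi i0 i0)).
  rewrite !Mij eqxx mulr1n.
  by rewrite rmorph_nat mulr_natr.
by apply: (can_inj (mxofK bb bb)); rewrite linearZ /= mxof1.
Qed.

(* In degree 0 there are no coboundaries, so that every class is represented by
   an endomorphism commuting with [rho]. *)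
Lemma inc0_scalar (R : retract rho) (c : cohom rho 0) :
  exists a : F, ev0 (rinc R 0 c) = a *: \1%VF.
Proof.
apply: schur => x; have := d0E rho (rinc R 0 c) x.
by rewrite diff_inc => /esym/eqP; rewrite subr_eq0 => /eqP.
Qed.

End Schur.

(** * The Kuranishi slice *)

Section Kuranishi.
Variables (F : fieldType) (E : algType F) (V : vectType F) (rho : rep E V).
Hypothesis rho_irr : absolutely_irreducible rho.
Variables (R : retract rho) (A : artAlg F).
Local Notation m := (amax A).
Local Notation C n := (tens (cochain E V n) m).
Local Notation H n := (tens (cohom rho n) m).

(** Typical use: [t = u t] for a map [u] that raises the filtration by one, which forces [t = 0]. *)
Lemma tens_nilp (W : lmodType F) (t : tens W m) :
  (forall k, tens_in (m ^+ k.+1)%VS t -> tens_in (m ^+ k.+2)%VS t) -> t = 0.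
Proof.
move=> step; have [N mN] := amax_nilp A.
have all_k k : tens_in (m ^+ k.+1)%VS t.
  by elim: k => [|k IH]; [rewrite expv1; exact: tens_in_self | exact: step].
by have := all_k N; rewrite mN; exact: tens_in_eq0.
Qed.

Lemma tens_in_tm_r (W1 W2 W3 : lmodType F) (mu : W1 -> W2 -> W3) k (s : tens W1 m) t :
  bilin mu -> tens_in (m ^+ k.+1)%VS t -> tens_in (m ^+ k.+2)%VS (tm mu s t).
Proof.
move=> hmu ht; rewrite expvSl; apply: tens_in_tm => //; first exact: expv_amax_sub.
exact: tens_in_self.
Qed.

Lemma tens_in_tm_l (W1 W2 W3 : lmodType F) (mu : W1 -> W2 -> W3) k (s : tens W1 m) t :
  bilin mu -> tens_in (m ^+ k.+1)%VS s -> tens_in (m ^+ k.+2)%VS (tm mu s t).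
Proof.
move=> hmu hs; rewrite expvSr; apply: tens_in_tm => //; first exact: expv_amax_sub.
exact: tens_in_self.
Qed.

Lemma tm_tll (V1 W1 W2 W3 : lmodType F) (mu : W1 -> W2 -> W3) (f : V1 -> W1)
    (s : tens V1 m) (t : tens W2 m) :
  tm mu (tl f s) t = tm (fun a b => mu (f a) b) s t.
Proof. by apply: eq_bigr => i _; apply: eq_bigr => j _; rewrite !ffunE. Qed.

Lemma tm_tlr (V2 W1 W2 W3 : lmodType F) (mu : W1 -> W2 -> W3) (f : V2 -> W2)
    (s : tens W1 m) (t : tens V2 m) :
  tm mu s (tl f t) = tm (fun a b => mu a (f b)) s t.
Proof. by apply: eq_bigr => i _; apply: eq_bigr => j _; rewrite !ffunE. Qed.

Definition tdiff n : C n -> C n.+1 := tl (@hoch_diff F E V rho n).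
Definition thom n : C n.+1 -> C n := tl (rhom R n).
Definition tinc n : H n -> C n := tl (rinc R n).
Definition tproj n : C n -> H n := tl (rproj R n).
HB.instance Definition _ n := GRing.Linear.on (@tdiff n).
HB.instance Definition _ n := GRing.Linear.on (@thom n).
HB.instance Definition _ n := GRing.Linear.on (@tinc n).
HB.instance Definition _ n := GRing.Linear.on (@tproj n).

Definition t01 : C 0 -> C 1 -> C 1 := tm (@cup01 F E V) (U := m).
Definition t10 : C 1 -> C 0 -> C 1 := tm (@cup10 F E V) (U := m).
Definition t11 : C 1 -> C 1 -> C 2 := tm (@cup11 F E V) (U := m).
Definition t02 : C 0 -> C 2 -> C 2 := tm (@cup02 F E V) (U := m).
Definition t20 : C 2 -> C 0 -> C 2 := tm (@cup20 F E V) (U := m).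
Definition t12 : C 1 -> C 2 -> C 3 := tm (@cup12 F E V) (U := m).
Definition t21 : C 2 -> C 1 -> C 3 := tm (@cup21 F E V) (U := m).

Lemma t01_bilin : bilin t01. Proof. exact/tm_bilin/cup01_bilin. Qed.
Lemma t10_bilin : bilin t10. Proof. exact/tm_bilin/cup10_bilin. Qed.
Lemma t11_bilin : bilin t11. Proof. exact/tm_bilin/cup11_bilin. Qed.
Lemma t12_bilin : bilin t12. Proof. exact/tm_bilin/cup12_bilin. Qed.
Lemma t21_bilin : bilin t21. Proof. exact/tm_bilin/cup21_bilin. Qed.

Lemma tA111 x y z : t21 (t11 x y) z = t12 x (t11 y z).
Proof.
apply: (tmA (@amax_mul _ _)); [exact: cup11_bilin|exact: cup21_bilin|exact: cup11_bilin
  |exact: cup12_bilin|exact: cupA111].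
Qed.
Lemma tA011 x y z : t11 (t01 x y) z = t02 x (t11 y z).
Proof.
apply: (tmA (@amax_mul _ _)); [exact: cup01_bilin|exact: cup11_bilin|exact: cup11_bilin
  |exact: cup02_bilin|exact: cupA011].
Qed.
Lemma tA101 x y z : t11 (t10 x y) z = t11 x (t01 y z).
Proof.
apply: (tmA (@amax_mul _ _)); [exact: cup10_bilin|exact: cup11_bilin|exact: cup01_bilin
  |exact: cup11_bilin|exact: cupA101].
Qed.
Lemma tA110 x y z : t20 (t11 x y) z = t11 x (t10 y z).
Proof.
apply: (tmA (@amax_mul _ _)); [exact: cup11_bilin|exact: cup20_bilin|exact: cup10_bilin
  |exact: cup11_bilin|exact: cupA110].
Qed.

Lemma tdiff_t11 x y : tdiff (t11 x y) = t21 (tdiff x) y - t12 x (tdiff y).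
Proof.
rewrite /tdiff /t11 /t21 /t12 tl_tm tm_tll tm_tlr.
apply: (@addIr _ (tm (fun a b => cup12 a (@hoch_diff F E V rho 1 b)) x y)); rewrite subrK.
rewrite /tm -big_split; apply: eq_bigr => i _; rewrite -big_split; apply: eq_bigr => j _ /=.
by rewrite d_cup11; apply/ffunP => k; rewrite !ffunE -scalerDr subrK.
Qed.

Lemma tdiff_tdiff (x : C 1) : tdiff (tdiff x) = 0.
Proof. by apply/ffunP => k; rewrite !ffunE dd1. Qed.
Lemma tdiff_tinc n (c : H n) : tdiff (tinc c) = 0.
Proof. by apply/ffunP => k; rewrite !ffunE diff_inc. Qed.
Lemma tproj_tinc n (c : H n) : tproj (tinc c) = c.
Proof. by apply/ffunP => k; rewrite !ffunE proj_inc. Qed.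
Lemma tproj_tdiff n (x : C n) : tproj (tdiff x) = 0.
Proof. by apply/ffunP => k; rewrite !ffunE proj_diff. Qed.
Lemma thom_tinc n (c : H n.+1) : thom (tinc c) = 0.
Proof. by apply/ffunP => k; rewrite !ffunE hom_inc. Qed.
Lemma tproj_thom n (x : C n.+1) : (n <= 2)%N -> tproj (thom x) = 0.
Proof. by move=> n2; apply/ffunP => k; rewrite !ffunE proj_hom. Qed.
Lemma thom_thom n (x : C n.+2) : (n <= 1)%N -> thom (thom x) = 0.
Proof. by move=> n2; apply/ffunP => k; rewrite !ffunE hom_hom. Qed.
Lemma thom_tdiff_thom n (x : C n.+1) : (n <= 2)%N -> thom (tdiff (thom x)) = thom x.
Proof. by move=> n2; apply/ffunP => k; rewrite !ffunE hom_diff_hom. Qed.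
Lemma tens_homotopy n (x : C n.+1) : (n <= 1)%N ->
  x = tdiff (thom x) + tinc (tproj x) + thom (tdiff x).
Proof. by move=> n1; apply/ffunP => k; rewrite !ffunE -retract_homotopy. Qed.
Lemma tens_homotopy0 (x : C 0) : x = tinc (tproj x) + thom (tdiff x).
Proof. by apply/ffunP => k; rewrite !ffunE -retract_homotopy0. Qed.

(** A class of degree 0 acts on both sides, and in degrees 1 and 2, by one and the same scalar.
    Hence the linear maps [i], [p] and [h] commute with these actions, which is the content of the
    lemmas below. *)
Lemma cup02_inc (c : cohom rho 0) : exists a : F, [/\ ev0 (rinc R 0 c) = a *: \1%VF,
  (forall y, cup01 (rinc R 0 c) y = a *: y), (forall y, cup10 y (rinc R 0 c) = a *: y),
  (forall z, cup02 (rinc R 0 c) z = a *: z) & (forall z, cup20 z (rinc R 0 c) = a *: z)].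
Proof.
have [a ea] := inc0_scalar rho_irr R c; exists a.
split=> // y; [apply: cochain_ext1 => e|apply: cochain_ext1 => e|
  apply: cochain_ext2 => e e'|apply: cochain_ext2 => e e'];
  rewrite ?(cup01E, cup10E, cup02E, cup20E) ea.
- by rewrite -comp_lfunZl comp_lfun1l.
- by rewrite -comp_lfunZr comp_lfun1r.
- by rewrite -comp_lfunZl comp_lfun1l.
- by rewrite -comp_lfunZr comp_lfun1r.
Qed.

(** [mH01] and [mH10] are the components of the transferred [m_2] which enter the gauge relation on
    [H]. *)
Definition mH01 (a : cohom rho 0) (b : cohom rho 1) : cohom rho 1 :=
  rproj R 1 (cup01 (rinc R 0 a) (rinc R 1 b)).
Definition mH10 (b : cohom rho 1) (a : cohom rho 0) : cohom rho 1 :=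
  rproj R 1 (cup10 (rinc R 1 b) (rinc R 0 a)).

Lemma tinc_mH01 g xi : tinc (tm mH01 g xi) = t01 (tinc g) (tinc xi).
Proof.
rewrite /tinc /t01 tl_tm tm_tl; apply: eq_tm => a b; rewrite /mH01.
by have [c [_ -> _ _ _]] := cup02_inc a; rewrite !linearZ /= proj_inc.
Qed.
Lemma tinc_mH10 g xi : tinc (tm mH10 xi g) = t10 (tinc xi) (tinc g).
Proof.
rewrite /tinc /t10 tl_tm tm_tl; apply: eq_tm => b a; rewrite /mH10.
by have [c [_ _ -> _ _]] := cup02_inc a; rewrite !linearZ /= proj_inc.
Qed.
Lemma tproj_t01 g x : tproj (t01 (tinc g) x) = tm mH01 g (tproj x).
Proof.
rewrite /tproj /t01 tl_tm tm_tll tm_tlr; apply: eq_tm => a b; rewrite /mH01.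
by have [c [_ e _ _ _]] := cup02_inc a; rewrite !e !linearZ /= proj_inc.
Qed.
Lemma tproj_t10 g x : tproj (t10 x (tinc g)) = tm mH10 (tproj x) g.
Proof.
rewrite /tproj /t10 tl_tm tm_tll tm_tlr; apply: eq_tm => b a; rewrite /mH10.
by have [c [_ _ e _ _]] := cup02_inc a; rewrite !e !linearZ /= proj_inc.
Qed.
Lemma thom_t02 g x : thom (t02 (tinc g) x) = t01 (tinc g) (thom x).
Proof.
rewrite /thom /t02 /t01 tl_tm !tm_tll tm_tlr; apply: eq_tm => a b.
by have [c [_ e _ e' _]] := cup02_inc a; rewrite e e' linearZ.
Qed.
Lemma thom_t20 g x : thom (t20 x (tinc g)) = t10 (thom x) (tinc g).
Proof.
rewrite /thom /t20 /t10 tl_tm !tm_tlr tm_tll; apply: eq_tm => b a.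
by have [c [_ _ e _ e']] := cup02_inc a; rewrite e e' linearZ.
Qed.
(** Used when [h x = 0], where the right-hand side vanishes. *)
Lemma thom_t01 g x : thom (t01 (tinc g) x) = tm (fun a => cup00 (rinc R 0 a)) g (thom x).
Proof.
rewrite /thom /t01 tl_tm tm_tll tm_tlr; apply: eq_tm => a b.
have [c [e0 e _ _ _]] := cup02_inc a; rewrite e linearZ /=.
by apply: cochain_ext0; rewrite cup00E e0 -comp_lfunZl comp_lfun1l.
Qed.
Lemma thom_t10 g x : thom (t10 x (tinc g)) = tm (fun b a => cup00 b (rinc R 0 a)) (thom x) g.
Proof.
rewrite /thom /t10 tl_tm tm_tll tm_tlr; apply: eq_tm => b a.
have [c [e0 _ e _ _]] := cup02_inc a; rewrite e linearZ /=.
by apply: cochain_ext0; rewrite cup00E e0 -comp_lfunZr comp_lfun1r.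
Qed.

Definition MC_dg (x : C 1) := tdiff x + t11 x x = 0.
(** Rearranged: [(1 + g) x' = x (1 + g) + d g]. *)
Definition gauge_dg (g : C 0) (x x' : C 1) := x - x' = - tdiff g + t01 g x' - t10 x g.
(** The gauge relation on [H] once [m_1] and the operations of arity at least 3 have dropped out. *)
Definition gauge_coh (g : H 0) (xi xi' : H 1) := xi - xi' = tm mH01 g xi' - tm mH10 xi g.
(* By nilpotency this equation has at most one solution [x] for each [xi]; it is
   the image of [xi] under [fstar]. *)
Definition kuranishi (xi : H 1) (x : C 1) := x = tinc xi - thom (t11 x x).

Lemma t11_sub x x' : t11 x x - t11 x' x' = t11 x (x - x') + t11 (x - x') x'.
Proof. rewrite (bilinBr t11_bilin) (bilinBl t11_bilin); abel. Qed.

(** The difference [D] of two solutions satisfies [D = - h (x D + D x')], whose right-hand side lies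
    one power of [amax A] deeper. *)
Lemma kuranishi_uniq xi x x' : kuranishi xi x -> kuranishi xi x' -> x = x'.
Proof.
move=> ex ex'; apply/eqP; rewrite -subr_eq0; apply/eqP; set D := x - x'.
have eD : D = - thom (t11 x D + t11 D x').
  rewrite -t11_sub linearB /= {1}/D {1}ex {1}ex'; abel.
apply: tens_nilp => k Dk; rewrite eD; apply/tens_inN/tens_in_tl/tens_inD.
  exact: tens_in_tm_r _ (@cup11_bilin F E V) Dk.
exact: tens_in_tm_l _ (@cup11_bilin F E V) Dk.
Qed.

Lemma kuranishi_tproj xi x : kuranishi xi x -> tproj x = xi.
Proof. by move=> ->; rewrite linearB /= tproj_tinc tproj_thom ?subr0. Qed.

Lemma kuranishi_thom xi x : kuranishi xi x -> thom x = 0.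
Proof. by move=> ->; rewrite linearB /= thom_tinc thom_thom ?subr0. Qed.

Lemma kuranishi_MC xi x : kuranishi xi x -> tproj (t11 x x) = 0 -> MC_dg x.
Proof.
move=> ex px0; rewrite /MC_dg; set c := tdiff x + t11 x x.
(* Here [d x = - d h (x x)], and in the homotopy identity for [x x] the term [i p] vanishes by
   hypothesis. *)
have ec : c = thom (tdiff (t11 x x)).
  rewrite /c {1}ex linearB /= tdiff_tinc {2}[t11 x x]tens_homotopy // px0 linear0.
  abel.
(* The Bianchi identity. *)
have dc : tdiff c = t21 c x - t12 x c.
  rewrite /c linearD /= tdiff_tdiff tdiff_t11 (bilinDl t21_bilin) (bilinDr t12_bilin) tA111.
  abel.
(* As [c] is in the image of [h] and [h d h = h], the map [h d] fixes [c]. *)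
have ec' : c = thom (t21 c x - t12 x c).
  by rewrite -dc [in RHS]ec [RHS](@thom_tdiff_thom 2).
apply: tens_nilp => k ck; rewrite ec'; apply/tens_in_tl/tens_inD/tens_inN.
  exact: tens_in_tm_l _ (@cup21_bilin F E V) ck.
exact: tens_in_tm_r _ (@cup12_bilin F E V) ck.
Qed.

(** The Maurer-Cartan equation turns [x x] into [- d x]; with [h x = 0] the homotopy identity reads
    [x = i p x + h d x], which is the Kuranishi equation. *)
Lemma MC_kuranishi x : MC_dg x -> thom x = 0 ->
  kuranishi (tproj x) x /\ tproj (t11 x x) = 0.
Proof.
move=> mcx hx; have dx : t11 x x = - tdiff x by apply/eqP; rewrite -addr_eq0 addrC; apply/eqP.
split; last by rewrite dx linearN /= tproj_tdiff oppr0.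
by rewrite /kuranishi dx linearN opprK {1}[x]tens_homotopy // hx linear0 add0r.
Qed.

(** [D] measures the failure of the gauge relation, since [d G = 0]. It satisfies a linear equation
    of the same kind as in [kuranishi_uniq], because [i] and [h] commute with multiplication by
    [G]. *)
Lemma kuranishi_gauge xi xi' x x' g : kuranishi xi x -> kuranishi xi' x' ->
  gauge_coh g xi xi' -> gauge_dg (tinc g) x x'.
Proof.
move=> ex ex' gxi; set G := tinc g; pose D := x - x' - t01 G x' + t10 x G.
have eI : tinc xi - tinc xi' = t01 G (tinc xi') - t10 (tinc xi) G.
  by rewrite -linearB gxi linearB /= tinc_mH01 tinc_mH10.
have eD : D = - thom (t11 x D + t11 D x').
  (* The mixed terms [x x'] and [x G x'] cancel. *)
  have -> : t11 x D + t11 D x' = t11 x x - t11 x' x' - t02 G (t11 x' x') + t20 (t11 x x) G.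
    rewrite /D !(bilinDr t11_bilin) !(bilinDl t11_bilin) !(bilinNr t11_bilin).
    rewrite !(bilinNl t11_bilin) tA011 tA110 tA101; abel.
  rewrite linearD !linearB /= thom_t02 thom_t20 -/G.
  have e1 : t01 G x' = t01 G (tinc xi') - t01 G (thom (t11 x' x')).
    by rewrite {1}ex' (bilinBr t01_bilin).
  have e2 : t10 x G = t10 (tinc xi) G - t10 (thom (t11 x x)) G.
    by rewrite {1}ex (bilinBl t10_bilin).
  rewrite /D e1 e2 {1}ex {1}ex'.
  have -> : t01 G (tinc xi') = tinc xi - tinc xi' + t10 (tinc xi) G by rewrite eI subrK.
  abel.
have D0 : D = 0.
  apply: tens_nilp => k Dk; rewrite eD; apply/tens_inN/tens_in_tl/tens_inD.
    exact: tens_in_tm_r _ (@cup11_bilin F E V) Dk.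
  exact: tens_in_tm_l _ (@cup11_bilin F E V) Dk.
rewrite /gauge_dg tdiff_tinc; apply/eqP; rewrite -subr_eq0 -/G; apply/eqP.
transitivity D => //; rewrite /D; abel.
Qed.

(** Apply [h] to the gauge relation: [h x] and [h x'] are zero, and the harmonic part of [g]
    contributes nothing because [h] commutes with its action. What remains is an equation for
    [l = h d g] alone. *)
Lemma kuranishi_gauge_inv xi xi' x x' g : kuranishi xi x -> kuranishi xi' x' ->
  gauge_dg g x x' -> gauge_coh (tproj g) xi xi'.
Proof.
move=> ex ex' gx; pose l := thom (tdiff g).
have hx := kuranishi_thom ex; have hx' := kuranishi_thom ex'.
have eg : g = tinc (tproj g) + l := tens_homotopy0 g.
have el : l = thom (t01 l x' - t10 x l).
  have ed : tdiff g = x' - x + t01 g x' - t10 x g.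
    have -> : x' - x = - (x - x') by rewrite opprB.
    rewrite gx; abel.
  rewrite {1}/l ed {1 2}eg (bilinDl t01_bilin) (bilinDr t10_bilin).
  have z01 : thom (t01 (tinc (tproj g)) x') = 0.
    rewrite thom_t01 hx'; apply/bilin0r/tm_bilin.
    split=> w a u v /=; first by rewrite linearP (bilinDl (@cup00_bilin F E V)) (bilinZl (@cup00_bilin F E V)).
    by rewrite (bilinDr (@cup00_bilin F E V)) (bilinZr (@cup00_bilin F E V)).
  have z10 : thom (t10 x (tinc (tproj g))) = 0.
    rewrite thom_t10 hx; apply/bilin0l/tm_bilin.
    split=> w a u v /=; last by rewrite linearP (bilinDr (@cup00_bilin F E V)) (bilinZr (@cup00_bilin F E V)).
    by rewrite (bilinDl (@cup00_bilin F E V)) (bilinZl (@cup00_bilin F E V)).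
  rewrite !(linearB, linearD) /= z01 z10 hx hx'; abel.
have l0 : l = 0.
  apply: tens_nilp => k lk; rewrite el; apply/tens_in_tl/tens_inD/tens_inN.
    exact: tens_in_tm_l _ (@cup01_bilin F E V) lk.
  exact: tens_in_tm_r _ (@cup10_bilin F E V) lk.
have {}eg : g = tinc (tproj g) by rewrite {1}eg l0 addr0.
rewrite /gauge_coh -(kuranishi_tproj ex) -(kuranishi_tproj ex') -tproj_t01 -tproj_t10 -eg.
by rewrite -!linearB /= gx -addrA linearD linearN /= tproj_tdiff oppr0 add0r.
Qed.

(** For [g = - h x] one has [h d g = - h x], so the linear terms of [h x'] cancel and only the
    products of [g] with [x] and [x'] remain. *)
Lemma gauge_raise k x x' : tens_in (m ^+ k.+1)%VS (thom x) ->
  gauge_dg (- thom x) x x' -> tens_in (m ^+ k.+2)%VS (thom x').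
Proof.
move=> hk gx; set g := - thom x in gx.
have -> : thom x' = thom (t10 x g - t01 g x').
  have ex : x' = x + tdiff g - t01 g x' + t10 x g.
    apply: (addrI (- x')); have -> : - x' + x' = 0 by rewrite addNr.
    transitivity (x - x' - (- tdiff g + t01 g x' - t10 x g)); last by abel.
    by rewrite gx subrr.
  have hg : thom (tdiff g) = - thom x by rewrite /g !linearN /= thom_tdiff_thom.
  by rewrite {1}ex !(linearB, linearD) /= hg; abel.
have gk : tens_in (m ^+ k.+1)%VS g := tens_inN hk.
apply/tens_in_tl/tens_inD/tens_inN.
  exact: tens_in_tm_r _ (@cup10_bilin F E V) gk.
exact: tens_in_tm_l _ (@cup01_bilin F E V) gk.
Qed.

End Kuranishi.

(** * Deformations as Maurer-Cartan elements *)

(** A separate name for this space of tensors, to which the ring structure given by [tmul] is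
    attached. *)
Definition endA (F : fieldType) (V : vectType F) (A : artAlg F) : Type := tens 'End(V) {:A}.

Section EndRing.
Variables (F : fieldType) (V : vectType F) (A : artAlg F).
Local Notation comp := (fun f g : 'End(V) => (f \o g)%VF).

Lemma comp_bilin : bilin comp.
Proof.
by split=> [w a u v|w a u v] /=;
  rewrite ?comp_lfunDl ?comp_lfunDr -?comp_lfunZl -?comp_lfunZr.
Qed.

Lemma tmulE (u v : tens 'End(V) {:A}) : tmul u v = tm comp u v.
Proof. by []. Qed.

Lemma memvf_mul : {in (fullv : {vspace A}) &, forall u v, u * v \in (fullv : {vspace A})}.
Proof. by move=> u v _ _; exact: memvf. Qed.

Lemma tmul_assoc : associative (@tmul F V A).
Proof.
move=> u v w; rewrite !tmulE; apply/esym.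
by apply: (tmA memvf_mul); try exact: comp_bilin; move=> a b c; rewrite comp_lfunA.
Qed.

Lemma tmul_1l : left_id (tone V A) (@tmul F V A).
Proof.
have bt := tm_bilin comp_bilin {:A}.
move=> u; rewrite tmulE; move: u; apply: tens_add_eq => [x y|//|w k].
  by rewrite (bilinDr bt).
by rewrite (tm_pure comp_bilin) ?memvf // comp_lfun1l mul1r.
Qed.

Lemma tmul_1r : right_id (tone V A) (@tmul F V A).
Proof.
have bt := tm_bilin comp_bilin {:A}.
move=> u; rewrite tmulE; move: u; apply: tens_add_eq => [x y|//|w k].
  by rewrite (bilinDl bt).
by rewrite (tm_pure comp_bilin) ?memvf // comp_lfun1r mulr1.
Qed.

Lemma tmul_Dl : left_distributive (@tmul F V A) +%R.
Proof. by move=> u v w; rewrite !tmulE (bilinDl (tm_bilin comp_bilin _)). Qed.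

Lemma tmul_Dr : right_distributive (@tmul F V A) +%R.
Proof. by move=> u v w; rewrite !tmulE (bilinDr (tm_bilin comp_bilin _)). Qed.

HB.instance Definition _ := GRing.Zmodule.copy (endA V A) (tens 'End(V) {:A}).
HB.instance Definition _ := GRing.Zmodule_isPzRing.Build (endA V A)
  tmul_assoc tmul_1l tmul_1r tmul_Dl tmul_Dr.

Lemma endA_mulE (u v : endA V A) : u * v = tmul u v. Proof. by []. Qed.
Lemma endA_1E : 1 = tone V A :> endA V A. Proof. by []. Qed.

Local Notation m := (amax A).
(* The inclusion of [W (x) amax A] into [W (x) A]. *)
Definition tin (W : lmodType F) (t : tens W m) : tens W {:A} := tmap {:A} id t.
Definition ein (t : tens 'End(V) m) : endA V A := tin t.

Lemma tin_inj (W : lmodType F) : injective (@tin W).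
Proof.
apply: (can_inj (g := tmap m id)) => t.
by rewrite /tin (@tmap_comp _ _ _ _ _ _ _ m id idfun) ?tmap_id // => u _; exact: memvf.
Qed.

Lemma tin_tm (W1 W2 W3 : lmodType F) (mu : W1 -> W2 -> W3) s t : bilin mu ->
  tin (tm mu s t) = tm mu (tin s) (tin t).
Proof.
move=> hmu; apply: (@tmap_tm F A A m {:A} idfun) => //; first exact: amax_mul.
by move=> u _; exact: memvf.
Qed.

Lemma ein_add s t : ein (s + t) = ein s + ein t.
Proof. exact: (linearD (@tmap F _ _ _ m {:A} id)). Qed.
Lemma ein_opp s : ein (- s) = - ein s.
Proof. exact: (linearN (@tmap F _ _ _ m {:A} id)). Qed.
Lemma ein0 : ein 0 = 0.
Proof. exact: (linear0 (@tmap F _ _ _ m {:A} id)). Qed.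
Lemma ein_mul s t : ein (tm comp s t) = ein s * ein t.
Proof. exact/tin_tm/comp_bilin. Qed.

Definition epure (f : 'End(V)) : endA V A := tpure {:A} f 1.

Lemma epureM f g : epure f * epure g = epure (f \o g)%VF.
Proof. by rewrite endA_mulE tmulE (tm_pure comp_bilin) ?memvf // mulr1. Qed.

Lemma epure_ein f t : epure f * ein t = ein (tl (comp f) t).
Proof.
have bt := tm_bilin comp_bilin {:A}.
rewrite endA_mulE tmulE; move: t; apply: tens_add_eq => [x y|x y|w k].
- by rewrite ein_add (bilinDr bt).
- by rewrite -ein_add; congr ein; apply/ffunP => i; rewrite !ffunE comp_lfunDr.
rewrite /ein /tin (tmap_basis _ id) (tm_pure comp_bilin) ?memvf // mul1r.
have -> : tl (comp f) (tpure m w (vbasis m)`_k) = tpure m (comp f w) (vbasis m)`_k.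
  by apply/ffunP => i; rewrite !ffunE comp_lfunZr.
by rewrite (tmap_basis _ id).
Qed.

Lemma ein_epure f t : ein t * epure f = ein (tl (comp^~ f) t).
Proof.
have bt := tm_bilin comp_bilin {:A}.
rewrite endA_mulE tmulE; move: t; apply: tens_add_eq => [x y|x y|w k].
- by rewrite ein_add (bilinDl bt).
- by rewrite -ein_add; congr ein; apply/ffunP => i; rewrite !ffunE comp_lfunDl.
rewrite /ein /tin (tmap_basis _ id) (tm_pure comp_bilin) ?memvf // mulr1.
have -> : tl (comp^~ f) (tpure m w (vbasis m)`_k) = tpure m (comp w f) (vbasis m)`_k.
  by apply/ffunP => i; rewrite !ffunE comp_lfunZl.
by rewrite (tmap_basis _ id).
Qed.

Lemma reduces_toP (u : endA V A) f : reduces_to u f <-> exists t, u = epure f + ein t.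
Proof. by []. Qed.

Lemma reduces_toM (u v : endA V A) f g :
  reduces_to u f -> reduces_to v g -> reduces_to (u * v : endA V A) (f \o g)%VF.
Proof.
move=> /reduces_toP[s ->] /reduces_toP[t ->]; apply/reduces_toP.
exists (tl (comp f) t + (tl (comp^~ g) s + tm comp s t)).
by rewrite !ein_add -epure_ein -ein_epure ein_mul mulrDl !mulrDr epureM; abel.
Qed.

Lemma epure1 : epure \1%VF = 1. Proof. by []. Qed.

Lemma ein_expr t : exists N, ein t ^+ N.+1 = 0.
Proof.
have [N mN] := amax_nilp A; exists N.
suff pw k : exists2 s : tens 'End(V) m, tens_in (m ^+ k.+1)%VS s & ein t ^+ k.+1 = ein s.
  have [s hs ->] := pw N; rewrite mN in hs.
  by rewrite (tens_in_eq0 hs) ein0.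
elim: k => [|k [s hs es]]; first by exists t; [rewrite expv1; exact: tens_in_self | rewrite expr1].
exists (tm comp t s); last by rewrite exprS es ein_mul.
rewrite expvSl; apply: tens_in_tm => //; first exact: comp_bilin.
  exact: expv_amax_sub.
exact: tens_in_self.
Qed.

(** The geometric series for [1 - y], with [y] nilpotent; its terms of positive order lie in
    [End V (x) amax A]. *)
Lemma reduces_to1_inv (u : endA V A) : reduces_to u \1%VF ->
  exists v : endA V A, [/\ reduces_to v \1%VF, u * v = 1 & v * u = 1].
Proof.
move=> /reduces_toP[t ->]; rewrite epure1; have [N tN] := ein_expr (- t).
set y := ein (- t) in tN; have -> : ein t = - y by rewrite /y ein_opp opprK.
exists (\sum_(i < N.+1) y ^+ i); split.
- apply/reduces_toP; rewrite big_ord_recl expr0 epure1.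
  suff pw k : exists s : tens 'End(V) m, y ^+ k.+1 = ein s.
    suff [s ->] : exists s, \sum_(i < N) y ^+ (bump 0 i) = ein s by exists s.
    apply: (big_ind (fun z => exists s, z = ein s)) => [|z z' [s ->] [s' ->]|i _].
    - by exists 0; rewrite ein0.
    - by exists (s + s'); rewrite ein_add.
    - exact: pw.
  elim: k => [|k [s es]]; first by exists (- t); rewrite expr1.
  by exists (tm comp (- t) s); rewrite exprS es ein_mul.
- have := subrX1 y N.+1; rewrite tN sub0r => e.
  by rewrite -opprB mulNr -e opprK.
- have cy : GRing.comm (1 - y) (\sum_(i < N.+1) y ^+ i).
    apply/commr_sym/commrB; first exact: commr1.
    by apply/commr_sym; apply: commr_sum => i _; apply: commrX.
  rewrite -cy; have := subrX1 y N.+1; rewrite tN sub0r => e.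
  by rewrite -opprB mulNr -e opprK.
Qed.

End EndRing.

Section Lifts.
Variables (F : fieldType) (E : algType F) (V : vectType F) (rho : rep E V).
Variable A : artAlg F.
Local Notation m := (amax A).
Local Notation C n := (tens (cochain E V n) m).
Local Notation comp := (fun f g : 'End(V) => (f \o g)%VF).
Local Notation S := (endA V A).

Definition lev0 (phi : cochain E V 0) : 'End(V) := ev0 phi.
Definition lev1 a (phi : cochain E V 1) : 'End(V) := ev1 phi a.
Definition lev2 a b (phi : cochain E V 2) : 'End(V) := ev2 phi a b.
Lemma lev0_linear : linear lev0. Proof. by []. Qed.
Lemma lev1_linear a : linear (lev1 a). Proof. by []. Qed.
Lemma lev2_linear a b : linear (lev2 a b). Proof. by []. Qed.
HB.instance Definition _ := GRing.isSemilinear.Build F (cochain E V 0) 'End(V) _ lev0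
  (GRing.semilinear_linear lev0_linear).
HB.instance Definition _ a := GRing.isSemilinear.Build F (cochain E V 1) 'End(V) _ (lev1 a)
  (GRing.semilinear_linear (lev1_linear a)).
HB.instance Definition _ a b := GRing.isSemilinear.Build F (cochain E V 2) 'End(V) _ (lev2 a b)
  (GRing.semilinear_linear (lev2_linear a b)).

(** Evaluation turns cup products into products in the ring [endA V A], and the differential of a
    0-cochain into a commutator with [rho1]. *)
Definition tev0 (g : C 0) : S := ein (tl lev0 g).
Definition tev1 (x : C 1) (a : E) : S := ein (tl (lev1 a) x).
Definition tev2 (z : C 2) (a b : E) : S := ein (tl (lev2 a b) z).
Definition rho1 (a : E) : S := epure A (rho a).

Lemma rho_plusE x a : rho_plus rho x a = rho1 a + tev1 x a.
Proof.
rewrite /rho_plus /rho1 /tev1 /ein /tin /tmap; congr (_ + _).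
by apply: eq_bigr => k _; rewrite ffunE.
Qed.

Lemma tev1_ext x y : (forall a, tev1 x a = tev1 y a) -> x = y.
Proof.
move=> e; apply/ffunP => k; apply: cochain_ext1 => a.
by have /tin_inj/ffunP/(_ k) := e a; rewrite !ffunE.
Qed.

Lemma tev2_eq0 z : (forall a b, tev2 z a b = 0) -> z = 0.
Proof.
move=> e; apply/ffunP => k; apply: cochain_ext2 => a b.
by have := e a b; rewrite -(ein0 V A) => /tin_inj/ffunP/(_ k); rewrite !ffunE.
Qed.

Lemma tev1B x y a : tev1 (x - y) a = tev1 x a - tev1 y a.
Proof. by rewrite /tev1 linearB ein_add ein_opp. Qed.
Lemma tev1D x y a : tev1 (x + y) a = tev1 x a + tev1 y a.
Proof. by rewrite /tev1 linearD ein_add. Qed.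
Lemma tev1N x a : tev1 (- x) a = - tev1 x a.
Proof. by rewrite /tev1 linearN ein_opp. Qed.
Lemma tev2D x y a b : tev2 (x + y) a b = tev2 x a b + tev2 y a b.
Proof. by rewrite /tev2 linearD ein_add. Qed.

Lemma tev1_d g a : tev1 (tdiff rho g) a = rho1 a * tev0 g - tev0 g * rho1 a.
Proof.
rewrite epure_ein ein_epure -ein_opp -ein_add; congr ein; apply/ffunP => k.
by rewrite !ffunE /lev1 d0E.
Qed.
Lemma tev2_d x a b :
  tev2 (tdiff rho x) a b = rho1 a * tev1 x b + tev1 x a * rho1 b - tev1 x (a * b).
Proof.
rewrite epure_ein ein_epure -ein_opp -!ein_add; congr ein; apply/ffunP => k.
by rewrite !ffunE /lev2 d1E.
Qed.
Lemma tev1_t01 g x a : tev1 (t01 g x) a = tev0 g * tev1 x a.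
Proof.
rewrite -ein_mul; congr ein; rewrite tl_tm tm_tl; apply: eq_tm => f h.
exact: cup01E.
Qed.
Lemma tev1_t10 g x a : tev1 (t10 x g) a = tev1 x a * tev0 g.
Proof.
rewrite -ein_mul; congr ein; rewrite tl_tm tm_tl; apply: eq_tm => f h.
exact: cup10E.
Qed.
Lemma tev2_t11 x y a b : tev2 (t11 x y) a b = tev1 x a * tev1 y b.
Proof.
rewrite -ein_mul; congr ein; rewrite tl_tm tm_tl; apply: eq_tm => f h.
exact: cup11E.
Qed.

Lemma tev1_linear x : linear (tev1 x : E -> tens 'End(V) {:A}).
Proof.
move=> c a b; rewrite /tev1 /ein /tin -linearP; congr tmap; apply/ffunP => k.
rewrite !ffunE /lev1 /ev1.
have eu (e : E) : [ffun=> e] = upd [ffun=> 0] ord0 e :> {ffun 'I_1 -> E}.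
  by apply/ffunP => i; rewrite !ffunE ord1 eqxx.
by rewrite (eu (c *: a + b)) (eu a) (eu b) (cochainP (x k)).
Qed.

Lemma rho1M a b : rho1 (a * b) = rho1 a * rho1 b.
Proof. by rewrite /rho1 epureM repM. Qed.

(** The failure of [rho + x] to be multiplicative at [(a, b)] is the value of the curvature
    [d x + x x] there. *)
Lemma MC_mult (x : C 1) : MC_dg rho x <->
  forall a b, rho_plus rho x (a * b) = tmul (rho_plus rho x a) (rho_plus rho x b).
Proof.
have e a b : (rho_plus rho x a : S) * rho_plus rho x b - rho_plus rho x (a * b) =
    tev2 (tdiff rho x + t11 x x) a b.
  rewrite !rho_plusE tev2D tev2_d tev2_t11 rho1M mulrDl !mulrDr; abel.
split=> [mc a b|mul].
  by apply/esym/eqP; rewrite -subr_eq0 [_ - _]e mc /tev2 linear0 ein0.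
by apply: tev2_eq0 => a b; rewrite -e; apply/eqP; rewrite subr_eq0 mul.
Qed.

Lemma rho_plus_reduces (x : C 1) a : reduces_to (rho_plus rho x a) (rho a).
Proof. by exists (tl (lev1 a) x); rewrite rho_plusE. Qed.

Lemma MC_lift (x : C 1) : MC_dg rho x <-> is_lift rho (rho_plus rho x).
Proof.
split=> [mc|[_ _ mul _]]; last exact/MC_mult.
have mul := (MC_mult x).1 mc.
split=> //; last exact: rho_plus_reduces.
  move=> c a b; rewrite !rho_plusE tev1_linear /rho1 /epure linearP tpure_linl.
  rewrite scalerDr; abel.
(* The value at 1 reduces to the identity, so it is invertible; being idempotent, it is 1. *)
have [v [_ _ vs]] : exists v : S, [/\ reduces_to v \1%VF,
    (rho_plus rho x 1 : S) * v = 1 & v * (rho_plus rho x 1 : S) = 1].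
  by apply: reduces_to1_inv; rewrite -(rep1 rho); exact: rho_plus_reduces.
have := mul 1 1; rewrite mul1r -[tmul _ _]/((rho_plus rho x 1 : S) * _) => e.
by rewrite -endA_1E -vs {2}e mulrA vs mul1r.
Qed.

Definition const_cochain (f : 'End(V)) : cochain E V 0.
Proof.
exists (fun=> f); apply/asboolP => x [].
by [].
Defined.

Lemma tev0_surj (t : tens 'End(V) m) : exists g : C 0, tev0 g = ein t.
Proof.
by exists (tl const_cochain t); congr ein; apply/ffunP => k; rewrite !ffunE.
Qed.

(** [(rho + x)(1 + g) - (1 + g)(rho + x')] expands to [x - x' + d g + x g - g x'], as [d g] is the
    commutator of [rho] and [g]. *)
Lemma gauge_conj g x x' : gauge_dg rho g x x' <->
  forall a, (rho_plus rho x a : S) * (1 + tev0 g) = (1 + tev0 g) * rho_plus rho x' a.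
Proof.
have e a : (rho_plus rho x a : S) * (1 + tev0 g) - (1 + tev0 g) * rho_plus rho x' a =
    tev1 (x - x' - (- tdiff rho g + t01 g x' - t10 x g)) a.
  rewrite !rho_plusE !(tev1B, tev1D, tev1N) tev1_d tev1_t01 tev1_t10.
  rewrite !mulrDl !mulrDr !mul1r !mulr1; abel.
split=> [gx a|conj].
  apply/eqP; rewrite -subr_eq0 e gx subrr /tev1 linear0 ein0 //.
apply/eqP; rewrite -subr_eq0; apply/eqP/tev1_ext => a.
by rewrite -e conj subrr /tev1 linear0 ein0.
Qed.

Lemma gauge_conjugate (x x' : C 1) :
  (exists g, gauge_dg rho g x x') <-> conjugate (rho_plus rho x) (rho_plus rho x').
Proof.
split=> [[g /gauge_conj conj]|[u0 [v0 [ru _ vu0 conj]]]].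
  have [v [rv uv vu]] : exists v : S, [/\ reduces_to v \1%VF, (1 + tev0 g) * v = 1 & v * (1 + tev0 g) = 1].
    by apply: reduces_to1_inv; exists (tl lev0 g).
  exists v, (1 + tev0 g); split=> // a.
  by rewrite -[RHS]/((v * _ : S) * _) -mulrA conj mulrA vu mul1r.
pose u : S := u0; pose v : S := v0; have vu : v * u = 1 := vu0.
have {}conj a : rho_plus rho x' a = (u * rho_plus rho x a * v : S) := conj a.
(* The inverse that comes with the conjugation is not known to reduce to the identity; the geometric
   series is, and the two agree. *)
have [v' [rv' uv' _]] : exists v' : S, [/\ reduces_to v' \1%VF, u * v' = 1 & v' * u = 1].
  exact: reduces_to1_inv.
have ev : v' = v by rewrite -[v']mul1r -vu -mulrA uv' mulr1.
move: rv'; rewrite ev => /reduces_toP[t ev1]; have [g eg] := tev0_surj t.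
exists g; apply/gauge_conj => a; rewrite eg -[1]epure1 -ev1 conj.
by rewrite !mulrA vu mul1r.
Qed.

(** [sigma - rho (x) 1] takes values in [End V (x) amax A]; it inherits linearity by injectivity of
    [tin], so its coordinates are 1-cochains. *)
Lemma lift_rho_plus (sigma : E -> tens 'End(V) {:A}) : is_lift rho sigma ->
  exists x : C 1, sigma = rho_plus rho x.
Proof.
move=> [lin _ _ red].
have /cid[t et] : exists t : E -> tens 'End(V) m, forall a, sigma a = epure A (rho a) + ein (t a).
  by have /choice[t et] := red; exists t.
have tlin : linear t.
  move=> c a b; apply: tin_inj.
  transitivity (c *: tin (t a) + tin (t b)); last by rewrite /tin linearP.
  have e d : tin (t d) = sigma d - tpure {:A} (rho d) 1 by rewrite et addrC addKr.
  by rewrite !e lin linearP tpure_linl scalerBr; abel.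
have mt k : (fun x : {ffun 'I_1 -> E} => t (x ord0) k) \in @multilinear_pred F E V 1.
  apply/asboolP => x j a u v; by rewrite (ord1 j) !ffunE eqxx tlin !ffunE.
exists [ffun k => Cochain (mt k)]; apply/funext => a; rewrite et rho_plusE; congr (_ + _).
by congr ein; apply/ffunP => k; rewrite !ffunE /lev1 /ev1 /= ffunE.
Qed.

Lemma is_lift_conj (sigma : E -> tens 'End(V) {:A}) (u v : S) : is_lift rho sigma ->
  reduces_to u \1%VF -> reduces_to v \1%VF -> u * v = 1 -> v * u = 1 ->
  is_lift rho (fun a => (v * sigma a * u : S)).
Proof.
move=> [lin one mul red] ru rv uv vu; split.
- have bt := tm_bilin (comp_bilin V) {:A}.
  move=> c a b; rewrite lin !endA_mulE !tmulE.
  by rewrite (bilinDr bt) (bilinZr bt) (bilinDl bt) (bilinZl bt).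
- by rewrite one mulr1 vu.
- move=> a b; rewrite mul -[RHS]/((v * sigma a * u) * (v * sigma b * u) : S).
  by rewrite !mulrA -[_ * u * v]mulrA uv mulr1 -!mulrA.
- move=> a; have := reduces_toM (reduces_toM rv (red a)) ru.
  by rewrite comp_lfun1l comp_lfun1r.
Qed.

(** The conjugate of the lift [rho + x] by [(1 + g)^-1] is again a lift, hence equals [rho + x']
    with [x'] Maurer-Cartan. *)
Lemma gauge_orbit (x : C 1) g : MC_dg rho x -> exists2 x', MC_dg rho x' & gauge_dg rho g x x'.
Proof.
move=> /MC_lift lx.
have [v [rv uv vu]] : exists v : S, [/\ reduces_to v \1%VF, (1 + tev0 g) * v = 1 & v * (1 + tev0 g) = 1].
  by apply: reduces_to1_inv; exists (tl lev0 g).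
have ru : reduces_to (1 + tev0 g) \1%VF by exists (tl lev0 g).
have lx' := is_lift_conj lx ru rv uv vu; have [x' ex'] := lift_rho_plus lx'.
exists x'; first by apply/MC_lift; rewrite -ex'.
apply/gauge_conj => a; rewrite -ex'.
by rewrite !mulrA uv mul1r.
Qed.

End Lifts.

(** * The transferred structure *)

Section ExtensionOfScalars.
Variables (F : fieldType) (X : nat -> lmodType F) (A : artAlg F).
Local Notation m := (amax A).
Local Notation elt := {d : nat & X d}.

(* [extA] with the sum over tuples of basis elements unfolded one argument at a
   time. *)
Fixpoint extR (Z : zmodType) (s : seq (htens X A)) (G : seq elt -> A -> Z) : Z :=
  if s is t :: s' then \sum_i extR s' (fun l a => G (hcoef t i :: l) ((vbasis m)`_i * a))
  else G [::] 1.

Lemma extRE (Z : zmodType) (s : seq (htens X A)) (G : seq elt -> A -> Z) :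
  \sum_(e : (size s).-tuple 'I_(\dim m))
     G [seq hcoef p.1 p.2 | p <- zip s e] (\prod_(j <- e) (vbasis m)`_j) = extR s G.
Proof.
elim: s G => [|t s IH] G /=.
  rewrite (big_pred1 [tuple]) => [|e]; first by rewrite big_nil.
  by apply/esym/eqP; exact: tuple0.
under [RHS]eq_bigr do rewrite -IH.
rewrite pair_big /= (reindex (fun p : 'I_(\dim m) * (size s).-tuple 'I_(\dim m) =>
  cons_tuple p.1 p.2)) /=.
  by apply: eq_bigr => -[i e] _ /=; rewrite big_cons.
exists (fun e => (thead e, behead_tuple e)) => [[i e] _|e _] /=.
  by congr pair; rewrite ?theadE //; apply: val_inj.
by rewrite [RHS]tuple_eta; apply: val_inj.
Qed.

Lemma extAE (Y : nat -> lmodType F) (phi : ops X Y) k s :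
  extA phi k s = extR s (fun l a => tpure m (phi k l) a).
Proof. exact: extRE. Qed.

(** The integrands need to agree only on lists with the degrees of [s], and on coefficients in the
    relevant power of [m]. *)
Lemma eq_extR (Z : zmodType) (s : seq (htens X A)) (G G' : seq elt -> A -> Z) :
  (forall l a, map tag l = map tag s -> a \in (m ^+ size s)%VS -> G l a = G' l a) ->
  extR s G = extR s G'.
Proof.
elim: s G G' => [|t s IH] G G' GG' /=; first by apply: GG' => //; exact: memv_line.
apply: eq_bigr => i _; apply: IH => l a tl am; apply: GG'; first by rewrite /= tl.
by rewrite expvSl memv_mul // vbasis_memv.
Qed.

Lemma extR_sum (Z : zmodType) I (r : seq I) (P : pred I) (s : seq (htens X A))
    (G : I -> seq elt -> A -> Z) :
  extR s (fun l a => \sum_(i <- r | P i) G i l a) = \sum_(i <- r | P i) extR s (G i).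
Proof.
elim: s G => [|t s IH] G //=; rewrite exchange_big; apply: eq_bigr => j _.
exact: (IH (fun i l a => G i (hcoef t j :: l) ((vbasis m)`_j * a))).
Qed.

Lemma extR_morph (Z Z' : zmodType) (f : Z -> Z') (s : seq (htens X A)) (G : seq elt -> A -> Z) :
  f 0 = 0 -> {morph f : x y / x + y} -> f (extR s G) = extR s (fun l a => f (G l a)).
Proof.
move=> f0 fD; elim: s G => [|t s IH] G //=.
by rewrite (big_morph f fD f0); apply: eq_bigr => i _; rewrite IH.
Qed.

Lemma extR_cat (Z : zmodType) (s1 s2 : seq (htens X A)) (G : seq elt -> A -> Z) :
  extR (s1 ++ s2) G = extR s1 (fun l1 a1 => extR s2 (fun l2 a2 => G (l1 ++ l2) (a1 * a2))).
Proof.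
elim: s1 G => [|t s1 IH] G /=.
  by apply: eq_extR => l a _ _; rewrite mul1r.
apply: eq_bigr => i _; rewrite IH; apply: eq_extR => l a _ _.
by apply: eq_extR => l' a' _ _; rewrite mulrA.
Qed.

Lemma expv_amax_memv n a : (0 < n)%N -> a \in (m ^+ n)%VS -> a \in m.
Proof. by case: n => // n _; apply/subvP/expv_amax_sub. Qed.

(** Both blocks must be nonempty: the coefficient of an empty block is 1, which is not in [m]. *)
Lemma extR_tm (W1 W2 W3 : lmodType F) (mu : W1 -> W2 -> W3) (s1 s2 : seq (htens X A))
    (phi : seq elt -> W1) (psi : seq elt -> W2) :
  bilin mu -> (0 < size s1)%N -> (0 < size s2)%N ->
  extR (s1 ++ s2) (fun l a => tpure m (mu (phi (take (size s1) l)) (psi (drop (size s1) l))) a) =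
  tm mu (extR s1 (fun l a => tpure m (phi l) a)) (extR s2 (fun l a => tpure m (psi l) a)).
Proof.
move=> hmu s1_gt0 s2_gt0; have bt := tm_bilin hmu m.
rewrite (@extR_morph _ _ (fun x => tm mu x _)) ?(bilin0l bt) //; last by move=> x y; rewrite (bilinDl bt).
rewrite extR_cat; apply: eq_extR => l a tl al.
rewrite (@extR_morph _ _ (tm mu _)) ?(bilin0r bt) //; last by move=> x y; rewrite (bilinDr bt).
apply: eq_extR => l' a' _ al'; have sl : size l = size s1 by rewrite -(size_map tag) tl size_map.
rewrite (tm_pure hmu) ?(expv_amax_memv s1_gt0 al) ?(expv_amax_memv s2_gt0 al') //.
by rewrite -sl take_size_cat // drop_size_cat.
Qed.

Lemma extR_tens_in (W : lmodType F) (s : seq (htens X A)) (phi : seq elt -> W) :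
  tens_in (m ^+ size s)%VS (extR s (fun l a => tpure m (phi l) a)).
Proof.
suff h (s' : seq (htens X A)) (G : seq elt -> A -> tens W m) (U' : {vspace A}) :
    (forall l a, a \in (m ^+ size s')%VS -> tens_in U' (G l a)) -> tens_in U' (extR s' G).
  by apply: h => l a am; exact: tens_in_pure.
elim: s' G => [|t s' IH] G hG /=; first by apply: hG; exact: memv_line.
apply: tens_in_sum => i _; apply: IH => l a am; apply: hG.
by rewrite expvSl memv_mul // vbasis_memv.
Qed.

Lemma extR1 (W : lmodType F) d (t : tens (X d) m) (phi : seq elt -> W) :
  extR [:: htag t] (fun l a => tpure m (phi l) a) =
  \sum_i tpure m (phi [:: Tagged (fun d => X d : Type) (t i)]) (vbasis m)`_i.
Proof. by apply: eq_bigr => i _; rewrite mulr1. Qed.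

End ExtensionOfScalars.

Lemma fsum_pos (Z : zmodType) (G : nat -> Z) N : (forall n, (N <= n)%N -> G n = 0) ->
  \sum_(n \in [set n | (0 < n)%N]%classic) G n = \sum_(1 <= n < N) G n.
Proof.
move=> G0; rewrite [RHS]fsbig_seq ?iota_uniq //; apply: esym; apply: fsbig_widen.
  by move=> n /=; rewrite mem_index_iota => /andP[].
move=> n [/= n_gt0 /negP]; rewrite mem_index_iota n_gt0 -leqNgt.
exact: G0.
Qed.

(** Reindexing [n = p + q] of a Cauchy product; the square exceeds the triangle by terms with
    [p + q >= N]. *)
Lemma sum_triangle (Z : zmodType) (f : nat -> nat -> Z) N :
  (forall p q, (N <= p + q)%N -> f p q = 0) ->
  \sum_(1 <= n < N) \sum_(1 <= p < n) f p (n - p)%N =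
  \sum_(1 <= p < N) \sum_(1 <= q < N) f p q.
Proof.
move=> f0; transitivity (\sum_(1 <= n < N) \sum_(1 <= p < N | (p < n)%N) f p (n - p)%N).
  by apply: eq_big_nat => n /andP[_ /ltnW nN]; rewrite (big_nat_widen _ _ N).
rewrite (exchange_big_dep_nat xpredT) //=; apply: eq_big_nat => p /andP[p1 pN].
transitivity (\sum_(p.+1 <= n < N) f p (n - p)%N).
  by rewrite [RHS](big_nat_widenl _ 1).
rewrite -[p.+1]add1n big_addn.
rewrite [RHS](big_cat_nat _ (n := N - p)) ?leq_subr ?subn_gt0 //=.
rewrite [X in _ = _ + X]big_nat_cond [X in _ = _ + X]big1 ?addr0; last first.
  by move=> q /andP[/andP[q1 q2] _]; apply: f0; lia.
by apply: eq_bigr => q _; rewrite addnK.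
Qed.

Section HomogeneousComponents.
Variables (F : fieldType) (X : nat -> lmodType F).

Lemma hcompE k (x : X k) : hcomp k (Tagged (fun d => X d : Type) x) = x.
Proof. by rewrite /hcomp /untag; case: eqP => // p; rewrite (eq_irrelevance p (erefl k)). Qed.

Lemma hcomp_neq k (x : {d : nat & X d}) : tag x != k -> hcomp k x = 0.
Proof. exact: untag_dflt. Qed.

Lemma hcomp0 k d : hcomp k (Tagged (fun d => X d : Type) (0 : X d)) = 0.
Proof.
have [<-|dk] := eqVneq d k; first exact: hcompE.
exact: hcomp_neq.
Qed.

Lemma tags_split (l : seq {d : nat & X d}) i j :
  map tag l = nseq i 1%N ++ 0%N :: nseq j 1%N ->
  exists l1 (u : X 0) l2, [/\ l = l1 ++ Tagged (fun d => X d : Type) u :: l2,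
    map tag l1 = nseq i 1%N & map tag l2 = nseq j 1%N].
Proof.
elim: i l => [|i IH] [|x l] //= [ex el].
  by case: x ex => d x /= ed; subst d; exists [::], x, l.
by have [l1 [u [l2 [-> e1 e2]]]] := IH l el; exists (x :: l1), u, l2; split=> //=; rewrite ex e1.
Qed.

End HomogeneousComponents.

Section Transferred.
Variables (F : fieldType) (E : algType F) (V : vectType F) (rho : rep E V).
Variable R : retract rho.
Local Notation C := (cochains E V).
Local Notation elt := {d : nat & C d}.

Lemma eq_hmt_of (mt1 mt2 : ops C C) k (s : seq elt) :
  mt1 k.+1 s = mt2 k.+1 s -> hmt_of R mt1 k s = hmt_of R mt2 k s.
Proof. by move=> e; case: s e => [|x [|y s]] //= ->. Qed.

Lemma eq_mt_step (mt1 mt2 : ops C C) k (s : seq elt) :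
  (forall k t, (size t < size s)%N -> mt1 k t = mt2 k t) ->
  mt_step R mt1 k s = mt_step R mt2 k s.
Proof.
move=> e; apply: eq_big_nat => p /andP[p1 ps]; congr (_ *: _); apply: eq_bigr => a _.
have -> : hmt_of R mt1 a (take p s) = hmt_of R mt2 a (take p s).
  by apply/eq_hmt_of/e; rewrite size_take ps.
suff -> : hmt_of R mt1 (k - a)%N (drop p s) = hmt_of R mt2 (k - a)%N (drop p s) by [].
by apply/eq_hmt_of/e; rewrite size_drop ltn_subrL p1 (leq_ltn_trans (leq0n p) ps).
Qed.

(** The recursion consults strictly shorter lists only, so fuel beyond the length of the list
    changes nothing. *)
Lemma mt_rec_stable n k (s : seq elt) : (size s <= n)%N ->
  mt_rec R n k s = mt_rec R (size s) k s.
Proof.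
elim/ltn_ind: n k s => -[|n] IH k s sn; first by have -> : size s = 0%N by lia.
case es : (size s) => [|r] /=; first by rewrite /mt_step es big_geq.
apply: eq_mt_step => k' t; rewrite es => tr.
rewrite es ltnS in sn; rewrite ltnS in tr.
by rewrite (IH n _ k' t) ?(IH r _ k' t) // (leq_trans tr sn).
Qed.

Lemma mtE k (s : seq elt) : mt R k s = mt_step R (mt R) k s.
Proof.
rewrite /mt; case es : (size s) => [|r] /=; first by rewrite /mt_step es big_geq.
by apply: eq_mt_step => k' t; rewrite es => tr; exact: mt_rec_stable.
Qed.

Lemma mt_small k (s : seq elt) : (size s <= 1)%N -> mt R k s = 0.
Proof. by move=> s1; rewrite mtE /mt_step big_geq. Qed.

Lemma hmt1 k (x : elt) : hmt R k [:: x] = - hcomp k x. Proof. by []. Qed.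

Lemma hmt_big k (s : seq elt) : (1 < size s)%N -> hmt R k s = rhom R k (mt R k.+1 s).
Proof. by case: s => [|x [|y s]]. Qed.

Lemma cup0l a b (y : C b) : cup (0 : C a) y = 0.
Proof. exact: bilin0l (@cup_bilin F E V a b) y. Qed.
Lemma cup0r a b (y : C a) : cup y (0 : C b) = 0.
Proof. exact: bilin0r (@cup_bilin F E V a b) y. Qed.

(** Degree count: [mtilde_n] has degree [2 - n], so on [n] arguments of degree 1 it lands in degree
    2, and after [h] in degree 1. The induction is joint because [mtilde] is built from shorter
    [h mtilde]. *)
Lemma mt_hmt_deg1 n k (s : seq elt) : map tag s = nseq n 1%N ->
  (k <> 2 -> mt R k s = 0) /\ ((0 < n)%N -> k <> 1%N -> hmt R k s = 0).
Proof.
elim/ltn_ind: n k s => n IH k s ts.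
have ss : size s = n by rewrite -(size_map tag) ts size_nseq.
have mt0 k' : k' <> 2 -> mt R k' s = 0.
  move=> k2; rewrite mtE /mt_step big_nat_cond big1 // => p /andP[/andP[p1 ps] _].
  rewrite big1 ?scaler0 // => a _.
  rewrite ss in ps; have np : (n - p < n)%N by lia.
  have ht : a <> 1%N :> nat -> hmt R a (take p s) = 0.
    apply: (IH p _ a _ _).2 => //.
    by rewrite map_take ts take_nseq // ltnW.
  have hd : (k' - a)%N <> 1%N -> hmt R (k' - a)%N (drop p s) = 0.
    apply: (IH (n - p)%N _ _ _ _).2; [by [] | by rewrite map_drop ts drop_nseq | by rewrite subn_gt0].
  have [a1|/eqP/ht] := eqVneq (a : nat) 1%N; last by move=> e; rewrite -/(hmt R _ _) e cup0l hcomp0.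
  have := ltn_ord a; rewrite -/(hmt R _ (drop p s)) hd ?cup0r ?hcomp0 //; lia.
split=> [|n0 k1]; first exact: mt0.
have [n1|n1] := leqP n 1.
  case: s ss ts {mt0} => [|x [|y s]] /=; try lia.
  by case: n n0 n1 IH => [|[|n]] //= _ _ _ _ [tx]; rewrite hcomp_neq ?oppr0 // tx; apply/eqP => k1'; case: k1.
by rewrite hmt_big ?ss // mt0 ?linear0 //; lia.
Qed.

Lemma hmt_deg1_0 n k (s : seq elt) : map tag s = nseq n 1%N -> (0 < n)%N ->
  k <> 1%N -> hmt R k s = 0.
Proof. by move=> ts; have [_] := mt_hmt_deg1 k ts. Qed.

Lemma mt2_deg1 n (s : seq elt) : map tag s = nseq n 1%N ->
  mt R 2 s = \sum_(1 <= p < n) (-1) ^+ (p * (n - p)).+1 *: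
    cup11 (hmt R 1 (take p s)) (hmt R 1 (drop p s)).
Proof.
move=> ts; have ss : size s = n by rewrite -(size_map tag) ts size_nseq.
rewrite mtE /mt_step ss; apply: eq_big_nat => p /andP[p1 pn].
have tt : map tag (take p s) = nseq p 1%N by rewrite map_take ts take_nseq //; lia.
have td : map tag (drop p s) = nseq (n - p) 1%N by rewrite map_drop ts drop_nseq.
congr (_ *: _).
  (* All degrees being 1, the exponent [p + 1 + (n - p + 1) p] has the parity of [p (n - p) + 1]. *)
  rewrite /degsum tt sumn_nseq mul1n -signr_odd -[RHS]signr_odd; congr (_ ^+ _).
  by rewrite /= !oddD /= !oddM /=; case: (odd p) => //=; rewrite ?addbF ?andbT ?andbF //= ?negbK.
(* Among the splittings 0 + 2, 1 + 1 and 2 + 0 of the degree, only 1 + 1 survives. *)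
rewrite !big_ord_recl big_ord0 addr0 /= /bump /= -/(hmt R) (hmt_deg1_0 tt) //.
rewrite (hmt_deg1_0 (k := 2) tt) // !cup0l !hcomp0 add0r addr0.
exact: hcompE.
Qed.

Lemma mt1_pair (x y : elt) : mt R 1 [:: x; y] =
  hcomp 1 (Tagged (fun d => C d : Type) (cup (hmt R 0 [:: x]) (hmt R 1 [:: y]) : C 1)) +
  hcomp 1 (Tagged (fun d => C d : Type) (cup (hmt R 1 [:: x]) (hmt R 0 [:: y]) : C 1)).
Proof.
rewrite mtE /mt_step big_nat1 !big_ord_recl big_ord0 addr0.
have -> : (-1) ^+ (2 + (size [:: x; y] - 1).+1 * degsum (take 1 [:: x; y]))%N = 1 :> F.
  by rewrite -signr_odd oddD oddM.
by rewrite scale1r.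
Qed.

Lemma mt_unitl (c : C 0) (y : elt) : tag y = 1%N ->
  mt R 1 [:: Tagged (fun d => C d : Type) c; y] = cup01 c (hcomp 1 y).
Proof.
move=> ty; rewrite mt1_pair !hmt1 (hcomp_neq (k := 0) (x := y)) ?ty // oppr0 cup0r hcomp0 addr0 !hcompE.
rewrite -/(cup01 _ _) (bilinNl (@cup01_bilin F E V)) (bilinNr (@cup01_bilin F E V)).
exact: opprK.
Qed.

Lemma mt_unitr (c : C 0) (x : elt) : tag x = 1%N ->
  mt R 1 [:: x; Tagged (fun d => C d : Type) c] = cup10 (hcomp 1 x) c.
Proof.
move=> tx; rewrite mt1_pair !hmt1 (hcomp_neq (k := 0) (x := x)) ?tx // oppr0 cup0l hcomp0 add0r !hcompE.
rewrite -/(cup10 _ _) (bilinNl (@cup10_bilin F E V)) (bilinNr (@cup10_bilin F E V)).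
exact: opprK.
Qed.

Lemma mt1E (s : seq elt) : mt R 1 s =
  \sum_(1 <= p < size s) (-1) ^+ (p.+1 + (size s - p).+1 * degsum (take p s))%N *:
    (cup01 (hmt R 0 (take p s)) (hmt R 1 (drop p s)) +
     cup10 (hmt R 1 (take p s)) (hmt R 0 (drop p s))).
Proof.
rewrite mtE /mt_step; apply: eq_bigr => p _; congr (_ *: _).
by rewrite !big_ord_recl big_ord0 addr0; congr (_ + _); exact: hcompE.
Qed.

(** The consequence of harmonicity that the vanishing argument uses: [h] kills each argument of
    degree 1. *)
Definition hom_free (l : seq elt) := all (fun x => rhom R 0 (hcomp 1 x) == 0) l.

(** With several arguments the value lies in the image of [h], and [h h = p h = 0]. A single
    argument is returned up to sign, so [p] need not kill it. *)
Lemma hmt1_deg1 n (s : seq elt) : map tag s = nseq n 1%N -> hom_free s -> (0 < n)%N ->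
  rhom R 0 (hmt R 1 s) = 0 /\ ((1 < n)%N -> rproj R 1 (hmt R 1 s) = 0).
Proof.
move=> ts hs n0; have ss : size s = n by rewrite -(size_map tag) ts size_nseq.
have [n1|n1] := leqP n 1; last first.
  by rewrite hmt_big ?ss // hom_hom // proj_hom.
case: s ss ts hs => [|x [|y s]] /=; [by move=> e; rewrite -e in n0| |by move=> e; rewrite -e in n1].
by move=> _ _ /andP[/eqP hx _]; split=> //; rewrite linearN /= hx oppr0.
Qed.

(* Strict unitality: a transferred operation of arity at least 3 vanishes if
   one of its arguments is a scalar and the others are harmonic of degree 1. *)
Lemma mt_scalar (a : F) (c : C 0) i j (l1 l2 : seq elt) :
  ev0 c = a *: \1%VF -> map tag l1 = nseq i 1%N -> map tag l2 = nseq j 1%N ->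
  hom_free l1 -> hom_free l2 -> (0 < i + j)%N ->
  hmt R 0 (l1 ++ Tagged (fun d => C d : Type) c :: l2) = 0 /\
  ((1 < i + j)%N -> rproj R 1 (mt R 1 (l1 ++ Tagged (fun d => C d : Type) c :: l2)) = 0).
Proof.
move=> ec; move en : (i + j)%N => n.
elim/ltn_ind: n i j en l1 l2 => n IH i j en l1 l2 t1 t2 h1 h2 n0; set u := Tagged (fun d => C d : Type) c.
have s1 : size l1 = i by rewrite -(size_map tag) t1 size_nseq.
have s2 : size l2 = j by rewrite -(size_map tag) t2 size_nseq.
have c01 y : cup01 c y = a *: y.
  by apply: cochain_ext1 => e; rewrite cup01E ec -comp_lfunZl comp_lfun1l.
have c10 y : cup10 y c = a *: y.
  by apply: cochain_ext1 => e; rewrite cup10E ec -comp_lfunZr comp_lfun1r.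
have hc : hmt R 0 [:: u] = - c by rewrite hmt1 hcompE.
have ss : size (l1 ++ u :: l2) = n.+1 by rewrite size_cat /= s1 s2 addnS en.
rewrite hmt_big ?ss //.
(* The goal is [Q] of [mtilde], and [Q] is stable under linear combinations, so each splitting can
   be treated separately. *)
pose Q (y : C 1) := rhom R 0 y = 0 /\ ((1 < n)%N -> rproj R 1 y = 0).
rewrite -/(Q _).
have Q0 : Q 0 by split; rewrite ?linear0.
have QD x y : Q x -> Q y -> Q (x + y).
  by move=> [x1 x2] [y1 y2]; split=> [|n1]; rewrite linearD /= ?x1 ?y1 ?x2 ?y2 ?addr0.
have QZ b x : Q x -> Q (b *: x).
  by move=> [x1 x2]; split=> [|n1]; rewrite linearZ /= ?x1 ?x2 ?scaler0.
have QN x : Q x -> Q (- x) by move=> /(QZ (-1)); rewrite scaleN1r.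
have hf_cat l l' : hom_free (l ++ l') = hom_free l && hom_free l' by exact: all_cat.
have b01 := @cup01_bilin F E V; have b10 := @cup10_bilin F E V.
rewrite mt1E ss big_nat_cond; apply: (big_ind Q) => // p /andP[/andP[p1 pn] _].
apply/QZ; have [pi|ip] := leqP p i.
(* The scalar lies in the right block. The left block has only degree 1 arguments, hence no
   component of degree 0; a right block with further arguments vanishes in degree 0 by induction. *)
- have tt : map tag (take p l1) = nseq p 1%N by rewrite map_take t1 take_nseq.
  have td : map tag (drop p l1) = nseq (i - p) 1%N by rewrite map_drop t1 drop_nseq.
  have st : size (take p l1) = p by rewrite -(size_map tag) tt size_nseq.
  have hd : hom_free (drop p l1) by move: h1; rewrite -{1}(cat_take_drop p l1) hf_cat => /andP[].
  rewrite -(cat_take_drop p l1) -catA.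
  rewrite (take_size_cat (n := p)) // (drop_size_cat (n := p)) //.
  rewrite (hmt_deg1_0 (k := 0) tt) // (bilin0l b01) add0r.
  have [k0|k0] := posnP (i - p + j); last first.
    have kn : (i - p + j < n)%N by lia.
    by have [-> _] := IH _ kn _ _ erefl _ _ td t2 hd h2 k0; rewrite (bilin0r b10).
  (* The right block is the scalar alone, so the term is a multiple of [h mtilde] of [l1]. *)
  have [ip j0] : i = p /\ j = 0%N by lia.
  have d0 : drop p l1 = [::] by apply: drop_oversize; rewrite s1 ip.
  have l20 : l2 = [::] by apply: size0nil; rewrite s2.
  have l1t : take p l1 = l1 by apply: take_oversize; rewrite s1 ip.
  rewrite d0 l20 cat0s hc (bilinNr b10) c10 l1t; apply/QN/QZ.
  have [|q1 q2] := hmt1_deg1 t1 h1; first by lia.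
  by split=> // n1; apply: q2; lia.
(* The mirror case: the scalar lies in the left block, followed there by the first [q] elements of
   [l2]. *)
- pose q := (p - i.+1)%N.
  have tt : map tag (take q l2) = nseq q 1%N by rewrite map_take t2 take_nseq //; lia.
  have td : map tag (drop q l2) = nseq (j - q) 1%N by rewrite map_drop t2 drop_nseq.
  have ht : hom_free (take q l2) by move: h2; rewrite -{1}(cat_take_drop q l2) hf_cat => /andP[].
  have st : size (l1 ++ u :: take q l2) = p.
    by rewrite size_cat /= s1 -(size_map tag) tt size_nseq; lia.
  have es : l1 ++ u :: l2 = (l1 ++ u :: take q l2) ++ drop q l2.
    by rewrite -catA /= cat_take_drop.
  have jq : (0 < j - q)%N by lia.
  rewrite es (take_size_cat (n := p)) // (drop_size_cat (n := p)) //.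
  rewrite (hmt_deg1_0 (k := 0) td) // (bilin0r b10) addr0.
  have [k0|k0] := posnP (i + q); last first.
    have kn : (i + q < n)%N by lia.
    by have [-> _] := IH _ kn _ _ erefl _ _ t1 tt h1 ht k0; rewrite (bilin0l b01).
  have [i0 q0] : i = 0%N /\ q = 0%N by lia.
  have l10 : l1 = [::] by apply: size0nil; rewrite s1.
  rewrite l10 q0 take0 drop0 cat0s hc (bilinNl b01) c01; apply/QN/QZ.
  have [|q1 q2] := hmt1_deg1 t2 h2; first by lia.
  by split=> // n1; apply: q2; lia.
Qed.

End Transferred.

Lemma extR0 (F : fieldType) (X : nat -> lmodType F) (A : artAlg F) (Z : zmodType)
    (s : seq (htens X A)) : extR s (fun _ _ => 0 : Z) = 0.
Proof. by elim: s => [|t s IH] //=; rewrite big1. Qed.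

(** * The Maurer-Cartan and gauge equations without infinite sums *)

Section Translation.
Variables (F : fieldType) (E : algType F) (V : vectType F) (rho : rep E V).
Variables (R : retract rho) (A : artAlg F).
Local Notation m := (amax A).
Local Notation Cc := (cochains E V).
Local Notation Hh := (cohoms rho).
Local Notation C n := (tens (cochain E V n) m).
Local Notation H n := (tens (cohom rho n) m).

Lemma extR_nilp (X : nat -> lmodType F) (W : lmodType F) N (s : seq (htens X A))
    (phi : seq {d : nat & X d} -> W) : (m ^+ N)%VS = 0%VS -> (N <= size s)%N ->
  extR s (fun l a => tpure m (phi l) a) = 0.
Proof.
move=> mN sN; have := extR_tens_in s phi; rewrite -(subnKC sN) expvD mN prod0v.
exact: tens_in_eq0.
Qed.

Definition sgn_MC n : F := (-1) ^+ (n * n.+1)./2%N.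

Lemma sgn_MC_add p q : sgn_MC (p + q) = sgn_MC p * sgn_MC q * (-1) ^+ (p * q)%N.
Proof.
rewrite /sgn_MC -!exprD; congr (_ ^+ _).
have e n : ((n * n.+1)./2 * 2 = n * n.+1)%N.
  by rewrite muln2 even_halfK // oddM /= andbN.
have := (e p, e q, e (p + q)%N); move=> [[]].
move: (_./2) (_./2) (_./2) => a b c; nia.
Qed.

Lemma MC_eq_dg (x : C 1) : MC_eq (opC rho) x <-> MC_dg rho x.
Proof.
rewrite /MC_eq (fsum_pos (N := 3)); last first.
  move=> n n3; rewrite extAE (@eq_extR _ _ _ _ _ _ (fun _ _ => 0)) ?extR0 ?scaler0 //.
  move=> l a tl _; have : size l = n by rewrite -(size_map tag) tl size_map size_nseq.
  by case: l {tl} => [|u [|v [|w l]]] /= ln; rewrite ?tpure0l //; move: n3; rewrite -ln.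
rewrite big_nat_recr //= big_nat1 !extAE /MC_dg.
have -> : extR (nseq 1 (htag x)) (fun l a => tpure m (opC rho 2 l) a) = tdiff rho x.
  rewrite extR1 [RHS]tpureE; apply: eq_bigr => i _.
  by rewrite ffunE; congr tpure; exact: hcompE.
have -> : extR (nseq 2 (htag x)) (fun l a => tpure m (opC rho 2 l) a) = t11 x x.
  apply: eq_bigr => i _; apply: eq_bigr => j _; rewrite mulr1; congr tpure.
  exact: hcompE.
(* Both signs [eps_1] and [eps_2] are -1, so the equation is the usual one up to a global sign. *)
have -> : (-1) ^+ (1 * 2)./2 = -1 :> F by [].
have -> : (-1) ^+ (2 * 3)./2 = -1 :> F by rewrite -signr_odd.
rewrite !scaleN1r -opprD; split=> [/eqP|->]; last by rewrite oppr0.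
by rewrite oppr_eq0 => /eqP.
Qed.

Lemma gauge_step_dg (g : C 0) (x x' : C 1) : gauge_step (opC rho) g x x' <-> gauge_dg rho g x x'.
Proof.
rewrite /gauge_step (fsum_pos (N := 3)); last first.
  move=> n n3; rewrite big_nat_cond big1 // => j /andP[/andP[j1 jn] _].
  rewrite extAE (@eq_extR _ _ _ _ _ _ (fun _ _ => 0)) ?extR0 ?scaler0 //.
  move=> l a tl _; have : size l = n.
    by rewrite -(size_map tag) tl size_map size_cat /= !size_nseq; lia.
  by case: l {tl} => [|u [|v [|w l]]] /= ln; rewrite ?tpure0l //; move: n3; rewrite -ln.
rewrite big_nat_recr //= big_nat1 big_nat1 (big_nat_recr 2) //= big_nat1 !extAE /gauge_dg.
have -> : extR [:: htag g] (fun l a => tpure m (opC rho 1 l) a) = tdiff rho g.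
  rewrite extR1 [RHS]tpureE; apply: eq_bigr => i _.
  by rewrite ffunE; congr tpure; exact: hcompE.
have -> : extR [:: htag g; htag x'] (fun l a => tpure m (opC rho 1 l) a) = t01 g x'.
  apply: eq_bigr => i _; apply: eq_bigr => j _; rewrite mulr1; congr tpure.
  exact: hcompE.
have -> : extR [:: htag x; htag g] (fun l a => tpure m (opC rho 1 l) a) = t10 x g.
  apply: eq_bigr => i _; apply: eq_bigr => j _; rewrite mulr1; congr tpure.
  exact: hcompE.
have -> : (-1) ^+ 1 * (-1) ^+ (1 * 0)./2 = -1 :> F by rewrite mulr1.
have -> : (-1) ^+ 1 * (-1) ^+ (2 * 1)./2 = 1 :> F by rewrite mulrNN mulr1.
have -> : (-1) ^+ 2 * (-1) ^+ (2 * 1)./2 = -1 :> F by rewrite sqrrN expr1n mul1r.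
by rewrite scale1r !scaleN1r addrA.
Qed.

Section Expansion.
Variable xi : H 1.
Let s n := nseq n (htag (X := Hh) xi).
Let hterm n : C 1 := extR (s n) (fun l a => tpure m (hmt R 1 (map (hinc R) l)) a).
Let mterm n : C 2 := extR (s n) (fun l a => tpure m (mt R 2 (map (hinc R) l)) a).
(** The term of arity [n] of [fstar]: the minus signs in [fstar] and [opf] cancel. *)
Let y n : C 1 := sgn_MC n *: hterm n.

Lemma tag_hinc (l : seq {d : nat & Hh d}) : map tag (map (hinc R) l) = map tag l.
Proof. by rewrite -map_comp; apply: eq_map. Qed.

Lemma size_s n : size (s n) = n. Proof. exact: size_nseq. Qed.

Lemma tag_s n (l : seq {d : nat & Hh d}) : map tag l = map tag (s n) ->
  map tag (map (hinc R) l) = nseq n 1%N.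
Proof. by rewrite tag_hinc => ->; rewrite map_nseq. Qed.

Lemma mterm_rec n : mterm n =
  \sum_(1 <= p < n) (-1) ^+ (p * (n - p)).+1 *: t11 (hterm p) (hterm (n - p)%N).
Proof.
rewrite /mterm;
rewrite (eq_extR (G' := fun l a => \sum_(1 <= p < n) (-1) ^+ (p * (n - p)).+1 *:
  tpure m (cup11 (hmt R 1 (take p (map (hinc R) l))) (hmt R 1 (drop p (map (hinc R) l)))) a)); last first.
  move=> l a tl _; rewrite (mt2_deg1 R (tag_s tl)) tpure_suml.
  by apply: eq_bigr => p _; rewrite tpureZl.
rewrite extR_sum; apply: eq_big_nat => p /andP[p1 pn].
rewrite -(@extR_morph _ _ _ _ _ ( *:%R ((-1) ^+ (p * (n - p)).+1))) ?scaler0 //; last first.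
  by move=> u v; rewrite scalerDr.
congr (_ *: _).
have -> : s n = s p ++ s (n - p)%N by rewrite /s -nseqD subnKC // ltnW.
rewrite /t11 /hterm -(extR_tm _ _ (@cup11_bilin F E V)) ?size_s //; last by rewrite subn_gt0.
by apply: eq_extR => l a _ _; rewrite map_take map_drop.
Qed.

Lemma hterm0 : hterm 0 = 0.
Proof. by rewrite /hterm /= mt_small // linear0 tpure0l. Qed.

Lemma hterm1 : hterm 1 = - tinc R xi.
Proof.
rewrite /hterm extR1 [RHS]tpureE; apply: eq_bigr => i _; rewrite !ffunE; congr tpure.
by rewrite /= ; congr (- _); exact: hcompE.
Qed.

Lemma hterm_big n : (1 < n)%N -> hterm n = thom R (mterm n).
Proof.
move=> n1; rewrite /mterm (@extR_morph _ _ _ _ _ (thom R (n := 1))); [|exact: linear0|exact: linearD].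
apply: eq_extR => l a tl _; rewrite /thom tl_pure hmt_big // size_map.
by rewrite -(size_map tag) tl size_map size_s.
Qed.

Variable N : nat.
Hypotheses (N_gt1 : (1 < N)%N) (mN : (m ^+ N)%VS = 0%VS).

Lemma hterm_nilp n : (N <= n)%N -> hterm n = 0.
Proof. by move=> Nn; apply: (extR_nilp (N := N)); rewrite ?size_s. Qed.
Lemma mterm_nilp n : (N <= n)%N -> mterm n = 0.
Proof. by move=> Nn; apply: (extR_nilp (N := N)); rewrite ?size_s. Qed.

Lemma fstar_sum : fstar R xi = \sum_(1 <= n < N) y n.
Proof.
have e n : (- (-1) ^+ (n * n.+1)./2%N) *: extA (opf R) 1 (s n) = y n.
  rewrite /y /sgn_MC scaleNr -scalerN extAE; congr (_ *: _).
  rewrite (@extR_morph _ _ _ _ _ -%R) ?oppr0 //; last by move=> u v; rewrite opprD.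
  by apply: eq_extR => l a _ _; rewrite /opf -scaleN1r tpureZl scaleN1r opprK.
rewrite /fstar (fsum_pos (N := N)); last by move=> n Nn; rewrite e /y hterm_nilp ?scaler0.
by apply: eq_bigr => n _; rewrite e.
Qed.

(** The square of [fstar] expands as a Cauchy product, and [eps_n (-1)^(p (n - p) + 1) = - eps_p
    eps_(n - p)] matches it with the recursion for [mtilde]. *)
Lemma mterm_sum : \sum_(1 <= n < N) sgn_MC n *: mterm n = - t11 (fstar R xi) (fstar R xi).
Proof.
have bt := @t11_bilin F E V A.
rewrite fstar_sum (bilin_suml bt).
transitivity (- \sum_(1 <= p < N) \sum_(1 <= q < N) t11 (y p) (y q)); last first.
  by congr (- _); apply: eq_bigr => p _; rewrite (bilin_sumr bt).
rewrite -(sum_triangle (f := fun p q => t11 (y p) (y q))); last first.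
  move=> p q Npq; rewrite /y (bilinZl bt) (bilinZr bt).
  have [->|p0] := posnP p; first by rewrite hterm0 (bilin0l bt) !scaler0.
  have [->|q0] := posnP q; first by rewrite hterm0 (bilin0r bt) !scaler0.
  suff -> : t11 (hterm p) (hterm q) = 0 by rewrite !scaler0.
  apply: tens_in_eq0; rewrite -(prod0v (m ^+ (p + q - N))%VS) -mN -expvD subnKC // expvD.
  apply: tens_in_tm; first exact: cup11_bilin.
  - by rewrite -(prednK p0); exact: expv_amax_sub.
  - by rewrite -(prednK q0); exact: expv_amax_sub.
  - by rewrite -[p in (m ^+ p)%VS]size_s; exact: extR_tens_in.
  - by rewrite -[q in (m ^+ q)%VS]size_s; exact: extR_tens_in.
rewrite -sumrN; apply: eq_big_nat => n /andP[n1 nN].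
rewrite mterm_rec scaler_sumr -sumrN; apply: eq_big_nat => p /andP[p1 pn].
rewrite /y (bilinZl bt) (bilinZr bt) !scalerA -scaleNr; congr (_ *: _).
rewrite -{1}(subnKC (ltnW pn)) sgn_MC_add exprS mulN1r mulrN; congr (- _).
set e := (-1) ^+ _; have ee : e * e = 1.
  by rewrite -exprD addnn -mul2n exprM sqrrN !expr1n.
by rewrite -[LHS]mulrA ee mulr1.
Qed.

(** Arity 1 contributes [i xi], as [h mtilde_1 = - id] and [eps_1 = -1]; the higher arities are [h]
    applied to [mterm_sum]. *)
Lemma fstar_kuranishi_aux : kuranishi R xi (fstar R xi).
Proof.
have e1 : \sum_(1 <= n < N) sgn_MC n *: mterm n = \sum_(2 <= n < N) sgn_MC n *: mterm n.
  have m1 : mterm 1 = 0 by rewrite mterm_rec big_geq.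
  by rewrite (big_ltn N_gt1) m1 scaler0 add0r.
have hN (z : C 2) : thom R (- z) = - thom R z by exact: linearN.
rewrite /kuranishi -hN -mterm_sum e1 {1}fstar_sum (big_ltn N_gt1).
congr (_ + _).
  by rewrite /y hterm1 /sgn_MC expr1 scaleN1r opprK.
rewrite linear_sum; apply: eq_big_nat => n /andP[n1 nN].
by rewrite /y hterm_big // linearZ.
Qed.

Lemma MC_eq_coh_aux :
  MC_eq (opH R) xi <-> tproj R (t11 (fstar R xi) (fstar R xi)) = 0.
Proof.
have e n : extA (opH R) 2 (s n) = tproj R (mterm n).
  rewrite extAE /mterm (@extR_morph _ _ _ _ _ (tproj R (n := 2))); [|exact: linear0|exact: linearD].
  apply: eq_extR => l a tl _; rewrite /tproj tl_pure /opH; case: ifP => // l1.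
  by rewrite mt_small ?size_map // linear0.
rewrite /MC_eq (fsum_pos (N := N)); last by move=> n Nn; rewrite e mterm_nilp // linear0 scaler0.
have -> : \sum_(1 <= n < N) (-1) ^+ (n * n.+1)./2%N *: extA (opH R) 2 (nseq n (htag xi)) =
    - tproj R (t11 (fstar R xi) (fstar R xi)).
  have pN (z : C 2) : tproj R (- z) = - tproj R z by exact: linearN.
  rewrite -pN -mterm_sum linear_sum; apply: eq_bigr => n _.
  by rewrite -/(s n) e linearZ.
by split=> [/eqP|->]; rewrite ?oppr0 // oppr_eq0 => /eqP.
Qed.

End Expansion.

Lemma amax_nilp_gt1 : exists2 N, (1 < N)%N & (m ^+ N)%VS = 0%VS.
Proof.
by have [N mN] := amax_nilp A; exists N.+2 => //; rewrite expvSl mN prodv0.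
Qed.

Lemma fstar_kuranishi (xi : H 1) : kuranishi R xi (fstar R xi).
Proof. by have [N N1 mN] := amax_nilp_gt1; exact: fstar_kuranishi_aux N1 mN. Qed.

Lemma MC_eq_coh (xi : H 1) :
  MC_eq (opH R) xi <-> tproj R (t11 (fstar R xi) (fstar R xi)) = 0.
Proof. by have [N N1 mN] := amax_nilp_gt1; exact: MC_eq_coh_aux mN. Qed.

Lemma hom_free_hinc n (l : seq {d : nat & Hh d}) : map tag l = nseq n 1%N ->
  hom_free R (map (hinc R) l).
Proof.
elim: l n => [|[d x] l IH] [|n] //= [d1 tl]; subst d.
by rewrite (IH n) // andbT; apply/eqP; rewrite hcompE hom_inc.
Qed.

(** Arity 1 drops out as [m_1 = 0]. In arity at least 3 the gauge parameter is a scalar among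
    harmonic arguments of degree 1, so [mt_scalar] applies; only [m_2] is left. *)
Lemma gauge_step_coh (rho_irr : absolutely_irreducible rho) (g : H 0) (xi xi' : H 1) :
  gauge_step (opH R) g xi xi' <-> gauge_coh R g xi xi'.
Proof.
rewrite /gauge_step (fsum_pos (N := 3)); last first.
  move=> n n3; rewrite big_nat_cond big1 // => j /andP[/andP[j1 jn] _].
  rewrite extAE (@eq_extR _ _ _ _ _ _ (fun _ _ => 0)) ?extR0 ?scaler0 //.
  move=> l a; rewrite map_cat /= !map_nseq => /tags_split[l1 [u [l2 [-> t1 t2]]]] _.
  rewrite /opH; case: ifP => _; first exact: tpure0l.
  have [c ec] := inc0_scalar rho_irr R u.
  rewrite map_cat /=.
  have ij0 : (0 < j.-1 + (n - j))%N by lia.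
  have ij1 : (1 < j.-1 + (n - j))%N by lia.
  have [_ e] := mt_scalar ec (etrans (tag_hinc l1) t1) (etrans (tag_hinc l2) t2)
    (hom_free_hinc t1) (hom_free_hinc t2) ij0.
  by rewrite [rproj R 1 _](e ij1) tpure0l.
rewrite big_nat_recr //= big_nat1 big_nat1 (big_nat_recr 2) //= big_nat1 !extAE /gauge_coh.
have -> : extR [:: htag g] (fun l a => tpure m (opH R 1 l) a) = 0.
  by rewrite extR1 big1 // => i _; rewrite tpure0l.
have -> : extR [:: htag (X := Hh) g; htag xi'] (fun l a => tpure m (opH R 1 l) a) =
    tm (mH01 R) g xi'.
  apply: eq_bigr => i _; apply: eq_bigr => j _; rewrite mulr1; congr tpure.
  by rewrite /opH /= mt_unitl // hcompE.
have -> : extR [:: htag (X := Hh) xi; htag g] (fun l a => tpure m (opH R 1 l) a) =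
    tm (mH10 R) xi g.
  apply: eq_bigr => i _; apply: eq_bigr => j _; rewrite mulr1; congr tpure.
  by rewrite /opH /= mt_unitr // hcompE.
have -> : (-1) ^+ 1 * (-1) ^+ (1 * 0)./2 = -1 :> F by rewrite mulr1.
have -> : (-1) ^+ 1 * (-1) ^+ (2 * 1)./2 = 1 :> F by rewrite mulrNN mulr1.
have -> : (-1) ^+ 2 * (-1) ^+ (2 * 1)./2 = -1 :> F by rewrite sqrrN expr1n mul1r.
by rewrite scaler0 add0r scale1r scaleN1r.
Qed.

End Translation.

(** * Quotient sets and functoriality *)

Section Presentations.
Implicit Types P Q : presentation.

Definition equivalence P :=
  [/\ forall x : pt P, prel x x, forall x y : pt P, prel x y -> prel y x
    & forall x y z : pt P, prel x y -> prel y z -> prel x z].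

Definition class_of P (x : pt P) (px : pmem x) : quotient_set P :=
  exist _ [set y | pmem y /\ prel x y]%classic (ex_intro2 _ _ x px erefl).

Lemma class_point P (c : quotient_set P) : equivalence P ->
  exists2 x, pmem x & sval c x.
Proof. by case=> rP _ _; have [x px e] := svalP c; exists x => //; rewrite e /=. Qed.

Lemma class_rel P (c : quotient_set P) x y : equivalence P ->
  sval c x -> sval c y -> prel x y.
Proof.
by have [z pz ->] := svalP c; move=> [_ sP tP] [_ zx] [_ zy]; exact: tP (sP _ _ zx) zy.
Qed.

Lemma class_eq P (c c' : quotient_set P) x y : equivalence P ->
  sval c x -> sval c' y -> prel x y -> c = c'.
Proof.
move=> [_ sP tP] cx c'y xy.
suff e : sval c = sval c'.
  case: c c' e {cx c'y} => [S hS] [S' hS'] /= e; subst S'; congr exist.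
  exact: Prop_irrelevance.
move: cx c'y; have [z pz ->] := svalP c; have [z' pz' ->] := svalP c'.
move=> [px zx] [py z'y]; apply/seteqP; split=> w /= [pw zw]; split=> //.
  exact: tP _ _ _ z'y (tP _ _ _ (sP _ _ xy) (tP _ _ _ (sP _ _ zx) zw)).
exact: tP _ _ _ zx (tP _ _ _ xy (tP _ _ _ (sP _ _ z'y) zw)).
Qed.

(** A representative of each class is chosen; compatibility with [prel] makes the choice
    immaterial. *)
Lemma induced P Q (f : pt P -> pt Q) :
  (forall x, pmem x -> pmem (f x)) ->
  (forall x y, pmem x -> pmem y -> prel x y -> prel (f x) (f y)) ->
  {fbar : quotient_set P -> quotient_set Q | induces f fbar}.
Proof.
move=> fm fr.
have rep (c : quotient_set P) :
    {x | pmem x & sval c = [set y | pmem y /\ prel x y]%classic}.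
  by apply: cid2; case: (svalP c) => x px e; exists x.
exists (fun c => class_of (fm _ (s2valP (rep c)))) => x px; split=> [|c]; first exact: fm.
case: (rep c) => x0 px0 /= -> [_ x0x]; split; first exact: fm.
exact: fr.
Qed.

Lemma induces_bij P Q (f : pt P -> pt Q) (fbar : quotient_set P -> quotient_set Q) :
  equivalence P -> equivalence Q -> induces f fbar ->
  (forall x y, pmem x -> pmem y -> prel (f x) (f y) -> prel x y) ->
  (forall y, pmem y -> exists2 x, pmem x & prel (f x) y) -> bijective fbar.
Proof.
move=> eP eQ ff finj fsurj.
have inj : injective fbar.
  move=> c c' ecc'; have [x px cx] := class_point c eP; have [y py c'y] := class_point c' eP.
  apply: (class_eq eP cx c'y); apply: finj => //.
  apply: (class_rel (c := fbar c)) => //; first exact: (ff x px).2.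
  by rewrite ecc'; exact: (ff y py).2.
have surj d : exists c, fbar c = d.
  have [y py dy] := class_point d eQ; have [x px xy] := fsurj y py.
  exists (class_of px); have [rP _ _] := eP.
  by apply: (class_eq eQ _ dy xy); apply: (ff x px).2; split.
pose g d := sval (cid (surj d)).
have gK : cancel g fbar by move=> d; rewrite /g; case: cid.
by exists g => // c; apply: inj; rewrite gK.
Qed.

Lemma induces_natural (P P' Q Q' : presentation) (f : pt P -> pt Q) (f' : pt P' -> pt Q')
    (u : pt P -> pt P') (v : pt Q -> pt Q') fbar fbar' ubar vbar (c : quotient_set P) :
  equivalence P -> equivalence Q' ->
  induces f fbar -> induces f' fbar' -> induces u ubar -> induces v vbar ->
  (forall x, f' (u x) = v (f x)) ->
  fbar' (ubar c) = vbar (fbar c).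
Proof.
move=> eP eQ' hf hf' hu hv e; have [x px cx] := class_point c eP.
have [pux ux] := hu x px; have [pfx fx] := hf x px.
have h1 := (hf' _ pux).2 _ (ux _ cx); have h2 := (hv _ pfx).2 _ (fx _ cx).
by have [rQ _ _] := eQ'; apply: (class_eq eQ' h1 h2); rewrite e.
Qed.

End Presentations.

Lemma gauge_equivalence (F : fieldType) (X : nat -> lmodType F) (m : ops X X) (A : artAlg F) :
  equivalence (MC m A).
Proof.
split=> [x|x y|x y z]; [exact: rst_refl | exact: rst_sym | exact: rst_trans].
Qed.

Section ConjugationEquivalence.
Variables (F : fieldType) (E : algType F) (V : vectType F) (rho : rep E V) (A : artAlg F).
Local Notation S := (endA V A).

Lemma conjugateP (sigma sigma' : E -> tens 'End(V) {:A}) : conjugate sigma sigma' <->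
  exists g g' : S, [/\ reduces_to g \1%VF, g * g' = 1, g' * g = 1
    & forall x, sigma' x = (g * sigma x * g' : S)].
Proof. by []. Qed.

Lemma reduces_to1_sym (g g' : S) : reduces_to g \1%VF -> g * g' = 1 -> g' * g = 1 ->
  reduces_to g' \1%VF.
Proof.
move=> rg gg' g'g; have [v [rv gv vg]] := reduces_to1_inv rg.
suff -> : g' = v by [].
by rewrite -[g']mul1r -vg -mulrA gg' mulr1.
Qed.

Lemma conjugate_equivalence : equivalence (Def rho A).
Proof.
split=> [s|s s' /conjugateP[g [g' [rg gg' g'g e]]]|
  s s' s'' /conjugateP[g [g' [rg gg' g'g e]]] /conjugateP[k [k' [rk kk' k'k e']]]].
- apply/conjugateP; exists 1, 1; split; rewrite ?mul1r //.
    by apply/reduces_toP; exists 0; rewrite ein0 addr0.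
  by move=> x; rewrite mul1r mulr1.
- apply/conjugateP; exists g', g; split=> // [|x]; first exact: reduces_to1_sym rg gg' g'g.
  by rewrite e !mulrA g'g mul1r -mulrA g'g mulr1.
- apply/conjugateP; exists (k * g), (g' * k'); split=> [|||x].
  + by have := reduces_toM rk rg; rewrite comp_lfun1l.
  + by rewrite mulrA -(mulrA k) gg' mulr1.
  + by rewrite mulrA -(mulrA g') k'k mulr1.
  + by rewrite e' e !mulrA.
Qed.

End ConjugationEquivalence.

(** * Injectivity and surjectivity on classes *)

Section Bijections.
Variables (F : fieldType) (E : algType F) (V : vectType F) (rho : rep E V).
Hypothesis rho_irr : absolutely_irreducible rho.
Variables (R : retract rho) (A : artAlg F).
Local Notation m := (amax A).
Local Notation C n := (tens (cochain E V n) m).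
Local Notation H n := (tens (cohom rho n) m).

Lemma gauge_equiv_conj (x x' : C 1) : gauge_equiv (opC rho) x x' ->
  conjugate (rho_plus rho x) (rho_plus rho x').
Proof.
have [rD sD tD] := conjugate_equivalence rho A.
elim=> {x x'} [x x' [_ _ [g /gauge_step_dg gx]]|x|x x' _ IH|x x' x'' _ IH _ IH'].
- by apply/gauge_conjugate; exists g.
- exact: rD.
- exact: sD.
- exact: tD IH IH'.
Qed.

Lemma conj_gauge_equiv (x x' : C 1) : MC_eq (opC rho) x -> MC_eq (opC rho) x' ->
  conjugate (rho_plus rho x) (rho_plus rho x') -> gauge_equiv (opC rho) x x'.
Proof.
move=> mx mx' /gauge_conjugate[g gx]; apply: rst_step; split=> //.
by exists g; apply/gauge_step_dg.
Qed.

Lemma fstar_MC (xi : H 1) : MC_eq (opH R) xi -> MC_eq (opC rho) (fstar R xi).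
Proof.
move=> /MC_eq_coh px0; apply/MC_eq_dg.
exact: kuranishi_MC (fstar_kuranishi R xi) px0.
Qed.

Lemma fstar_gauge_equiv (xi xi' : H 1) : gauge_equiv (opH R) xi xi' ->
  gauge_equiv (opC rho) (fstar R xi) (fstar R xi').
Proof.
elim=> {xi xi'} [xi xi' [mxi mxi' [g gxi]]|xi|xi xi' _ IH|x x' x'' _ IH _ IH'].
- apply: rst_step; split; try exact: fstar_MC.
  exists (tinc R g); apply/gauge_step_dg.
  apply: (kuranishi_gauge rho_irr (fstar_kuranishi R xi) (fstar_kuranishi R xi')).
  exact/gauge_step_coh.
- exact: rst_refl.
- exact: rst_sym.
- exact: rst_trans IH IH'.
Qed.

(** A chain of gauge steps in [C] may leave the slice between its ends. Conjugacy replaces it by one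
    gauge between the two endpoints, which are in the slice. *)
Lemma fstar_gauge_inj (xi xi' : H 1) : MC_eq (opH R) xi -> MC_eq (opH R) xi' ->
  gauge_equiv (opC rho) (fstar R xi) (fstar R xi') -> gauge_equiv (opH R) xi xi'.
Proof.
move=> mxi mxi' /gauge_equiv_conj/gauge_conjugate[g gx]; apply: rst_step; split=> //.
exists (tproj R g); apply/gauge_step_coh => //.
exact: (kuranishi_gauge_inv rho_irr (fstar_kuranishi R xi) (fstar_kuranishi R xi') gx).
Qed.

(* Gauging by [- h x] pushes the coexact part [h x] one step down the
   [amax]-adic filtration. *)
Lemma gauge_slice (x : C 1) : MC_eq (opC rho) x ->
  exists x' : C 1, [/\ MC_eq (opC rho) x', gauge_equiv (opC rho) x' x & thom R x' = 0].
Proof.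
move=> mx; have [N mN] := amax_nilp A.
suff step k : exists x' : C 1, [/\ MC_eq (opC rho) x', gauge_equiv (opC rho) x' x
    & tens_in (m ^+ k.+1)%VS (thom R x')].
  have [x' [mx' xx' hx']] := step N; exists x'; split=> //.
  by apply: tens_in_eq0; rewrite -mN.
elim: k => [|k [y [my yx hy]]].
  by exists x; split=> //; [exact: rst_refl | rewrite expv1; exact: tens_in_self].
have [z mz yz] := gauge_orbit (- thom R y) ((MC_eq_dg rho y).1 my).
exists z; split; first exact/MC_eq_dg.
  apply: rst_trans yx; apply: rst_sym; apply: rst_step; split=> //; first exact/MC_eq_dg.
  by exists (- thom R y); apply/gauge_step_dg.
exact: gauge_raise yz.
Qed.

Lemma fstar_surj (x : C 1) : MC_eq (opC rho) x ->
  exists2 xi : H 1, MC_eq (opH R) xi & gauge_equiv (opC rho) (fstar R xi) x.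
Proof.
move=> /gauge_slice[y [/MC_eq_dg my yx hy]].
have [ky py] := MC_kuranishi my hy.
(* Both sides solve the Kuranishi equation for [tproj R y]. *)
have ey : fstar R (tproj R y) = y := kuranishi_uniq (fstar_kuranishi R _) ky.
by exists (tproj R y); rewrite ?ey //; apply/MC_eq_coh; rewrite ey.
Qed.

End Bijections.

(** * Naturality in the Artinian algebra *)

Section Functoriality.
Variables (F : fieldType) (E : algType F) (V : vectType F) (rho : rep E V).
Variables (R : retract rho) (A A' : artAlg F) (theta : {lrmorphism A -> A'}).
Local Notation m := (amax A).
Local Notation C n := (tens (cochain E V n) m).
Local Notation H n := (tens (cohom rho n) m).
Local Notation th := (tmap (amax A') theta).

Lemma th_tm (W1 W2 W3 : lmodType F) (mu : W1 -> W2 -> W3) (s : tens W1 m) (t : tens W2 m) :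
  bilin mu -> th (tm mu s t) = tm mu (th s) (th t).
Proof.
apply: (@tmap_tm F A A' m (amax A') theta); first exact: amax_mul.
  by move=> u v _ _; rewrite rmorphM.
by move=> u; exact: amax_morph.
Qed.

Lemma th_MC_dg (x : C 1) : MC_dg rho x -> MC_dg rho (th x).
Proof.
rewrite /MC_dg => e; rewrite /t11 -(th_tm _ _ (@cup11_bilin F E V)) /tdiff tl_tmap.
by rewrite -linearD /= -/(t11 x x) -/(tdiff rho x) e linear0.
Qed.

Lemma th_gauge_dg (g : C 0) (x x' : C 1) : gauge_dg rho g x x' ->
  gauge_dg rho (th g) (th x) (th x').
Proof.
rewrite /gauge_dg => e.
rewrite /t01 /t10 -(th_tm _ _ (@cup01_bilin F E V)) -(th_tm _ _ (@cup10_bilin F E V)).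
rewrite /tdiff tl_tmap -!linearB /= e linearB linearD linearN //.
Qed.

Lemma th_kuranishi xi (x : C 1) : kuranishi R xi x -> kuranishi R (th xi) (th x).
Proof.
rewrite /kuranishi => e; rewrite {1}e linearB /= /t11 -(th_tm _ _ (@cup11_bilin F E V)).
by rewrite /tinc /thom !tl_tmap.
Qed.

(** Both sides solve the Kuranishi equation for [th xi], whose solution is unique. *)
Lemma th_fstar xi : fstar R (th xi) = th (fstar R xi).
Proof.
exact: kuranishi_uniq (fstar_kuranishi R _) (th_kuranishi (fstar_kuranishi R xi)).
Qed.

Lemma MC_map_C (x : C 1) : MC_eq (opC rho) x -> MC_eq (opC rho) (th x).
Proof. by move=> /MC_eq_dg mx; apply/MC_eq_dg/th_MC_dg. Qed.

Lemma gauge_map_C (x x' : C 1) : gauge_equiv (opC rho) x x' ->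
  gauge_equiv (opC rho) (th x) (th x').
Proof.
elim=> {x x'} [x x' [mx mx' [g /gauge_step_dg gx]]|x|x x' _ IH|x x' x'' _ IH _ IH'].
- apply: rst_step; split; try exact: MC_map_C.
  by exists (th g); apply/gauge_step_dg/th_gauge_dg.
- exact: rst_refl.
- exact: rst_sym.
- exact: rst_trans IH IH'.
Qed.

Lemma MC_map_H (xi : H 1) : MC_eq (opH R) xi -> MC_eq (opH R) (th xi).
Proof.
move=> /MC_eq_coh px0; apply/MC_eq_coh.
rewrite th_fstar /t11 -(th_tm _ _ (@cup11_bilin F E V)) /tproj tl_tmap.
by rewrite -/(t11 _ _) -/(tproj _ _) px0 linear0.
Qed.

Lemma mH01_bilin : bilin (mH01 R).
Proof. exact: (bilin_comp (@cup01_bilin F E V) (rinc R 0) (rinc R 1) (rproj R 1)). Qed.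
Lemma mH10_bilin : bilin (mH10 R).
Proof. exact: (bilin_comp (@cup10_bilin F E V) (rinc R 1) (rinc R 0) (rproj R 1)). Qed.

(** Schur's lemma reduces the relation to the two bilinear products [mH01] and [mH10], which [theta]
    respects. *)
Lemma gauge_map_H (rho_irr : absolutely_irreducible rho) (xi xi' : H 1) :
  gauge_equiv (opH R) xi xi' -> gauge_equiv (opH R) (th xi) (th xi').
Proof.
elim=> {xi xi'} [x x' [mx mx' [g gx]]|x|x x' _ IH|x x' x'' _ IH _ IH'].
- apply: rst_step; split; try exact: MC_map_H.
  have {}gx : gauge_coh R g x x' by apply/gauge_step_coh.
  exists (th g); apply/gauge_step_coh => //; rewrite /gauge_coh.
  by rewrite -(th_tm _ _ mH01_bilin) -(th_tm _ _ mH10_bilin) -!linearB /= gx.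
- exact: rst_refl.
- exact: rst_sym.
- exact: rst_trans IH IH'.
Qed.

Local Notation th1 := (tmap {:A'} theta).

Lemma th1_mul (u v : tens 'End(V) {:A}) : th1 (tmul u v) = tmul (th1 u) (th1 v).
Proof.
apply: (@tmap_tm F A A' fullv fullv theta).
- by move=> a b _ _; exact: memvf.
- by move=> a b _ _; exact: rmorphM.
- by move=> a _; exact: memvf.
- exact: comp_bilin.
Qed.

Lemma th1_pure (f : 'End(V)) (a : A) : th1 (tpure {:A} f a) = tpure {:A'} f (theta a).
Proof. by apply: (@tmap_pure F _ A A' _ _ theta); exact: memvf. Qed.

Lemma th1_one : th1 (tone V A) = tone V A'.
Proof. by rewrite /tone th1_pure rmorph1. Qed.

Lemma th1_tin (W : lmodType F) (t : tens W m) :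
  th1 (tmap {:A} id t) = tmap {:A'} id (th t).
Proof.
rewrite (@tmap_comp F W A A A' _ _ _ id theta) => [|u _]; last exact: memvf.
by rewrite (@tmap_comp F W A A' A' _ _ _ theta idfun) // => u; exact: amax_morph.
Qed.

Lemma th1_reduces (u : tens 'End(V) {:A}) f : reduces_to u f -> reduces_to (th1 u) f.
Proof.
move=> [t ->]; exists (th t).
by rewrite linearD /= th1_tin th1_pure rmorph1.
Qed.

Lemma Def_map_lift (sigma : E -> tens 'End(V) {:A}) :
  is_lift rho sigma -> is_lift rho (Def_map (rho := rho) theta sigma).
Proof.
move=> [lin one mul red]; split.
- by move=> c a b; rewrite /Def_map lin linearP.
- by rewrite /Def_map one th1_one.
- by move=> a b; rewrite /Def_map mul th1_mul.
- by move=> a; exact: th1_reduces.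
Qed.

Lemma Def_map_conj (sigma sigma' : E -> tens 'End(V) {:A}) : conjugate sigma sigma' ->
  conjugate (Def_map (rho := rho) theta sigma) (Def_map (rho := rho) theta sigma').
Proof.
move=> [g [g' [rg gg' g'g e]]]; exists (th1 g), (th1 g'); split.
- exact: th1_reduces.
- by rewrite -th1_mul gg' th1_one.
- by rewrite -th1_mul g'g th1_one.
- by move=> x; rewrite /Def_map e !th1_mul.
Qed.

Lemma th_rho_plus (x : C 1) :
  rho_plus rho (th x) = Def_map (rho := rho) theta (rho_plus rho x).
Proof.
apply/funext => a; rewrite /Def_map !rho_plusE linearD /= th1_pure rmorph1 /tev1 /ein /tin.
by rewrite th1_tin tl_tmap.
Qed.

End Functoriality.

Theorem theorem6p10 (F : fieldType) (E : algType F) (V : vectType F)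
    (rho : rep E V) (rho_irr : absolutely_irreducible rho) (R : retract rho) :
  exists (fbar : forall A : artAlg F,
            quotient_set (MC (opH R) A) -> quotient_set (MC (opC rho) A))
         (rbar : forall A : artAlg F,
            quotient_set (MC (opC rho) A) -> quotient_set (Def rho A)),
    (forall A : artAlg F,
       induces (P := MC (opH R) A) (Q := MC (opC rho) A)
         (@fstar F E V rho R A) (fbar A) /\ bijective (fbar A)) /\
    (forall A : artAlg F,
       induces (P := MC (opC rho) A) (Q := Def rho A)
         (@rho_plus F E V rho A) (rbar A) /\ bijective (rbar A)) /\
    exists actH actC actD,
      functor_action (P := fun A => MC (opH R) A) (@MC_map F _ (opH R)) actH /\
      functor_action (P := fun A => MC (opC rho) A) (@MC_map F _ (opC rho)) actC /\
      functor_action (P := fun A => Def rho A) (@Def_map F E V rho) actD /\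
      natural actH actC fbar /\ natural actC actD rbar.
Proof.
have eH A : equivalence (MC (opH R) A) := gauge_equivalence (opH R) A.
have eC A : equivalence (MC (opC rho) A) := gauge_equivalence (opC rho) A.
have eD A : equivalence (Def rho A) := conjugate_equivalence rho A.
pose fbar (A : artAlg F) := induced (P := MC (opH R) A) (Q := MC (opC rho) A)
  (@fstar_MC F E V rho R A) (fun x y _ _ => @fstar_gauge_equiv F E V rho rho_irr R A x y).
pose rbar (A : artAlg F) := induced (P := MC (opC rho) A) (Q := Def rho A)
  (fun x mx => (MC_lift rho x).1 ((MC_eq_dg rho x).1 mx))
  (fun x y _ _ => @gauge_equiv_conj F E V rho A x y).
pose actH (A A' : artAlg F) (theta : {lrmorphism A -> A'}) :=
  induced (P := MC (opH R) A) (Q := MC (opH R) A')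
  (@MC_map_H F E V rho R A A' theta)
  (fun x y _ _ => @gauge_map_H F E V rho R A A' theta rho_irr x y).
pose actC (A A' : artAlg F) (theta : {lrmorphism A -> A'}) :=
  induced (P := MC (opC rho) A) (Q := MC (opC rho) A')
  (@MC_map_C F E V rho A A' theta)
  (fun x y _ _ => @gauge_map_C F E V rho A A' theta x y).
pose actD (A A' : artAlg F) (theta : {lrmorphism A -> A'}) :=
  induced (P := Def rho A) (Q := Def rho A')
  (@Def_map_lift F E V rho A A' theta)
  (fun x y _ _ => @Def_map_conj F E V rho A A' theta x y).
exists (fun A => sval (fbar A)), (fun A => sval (rbar A)); split; [|split].
- move=> A; split; first exact: (svalP (fbar A)).
  apply: (induces_bij (eH A) (eC A) (svalP (fbar A))).
    by move=> x y mx my; exact: fstar_gauge_inj.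
  by move=> y; exact: fstar_surj.
- move=> A; split; first exact: (svalP (rbar A)).
  apply: (induces_bij (eC A) (eD A) (svalP (rbar A))).
    by move=> x y mx my; exact: conj_gauge_equiv.
  (* Every lift is of the form [rho_plus rho x] itself, not just up to conjugation. *)
  move=> sigma ls; have [x ex] := lift_rho_plus ls; exists x.
    by apply/MC_eq_dg/MC_lift; rewrite -ex.
  by have [rD _ _] := eD A; rewrite -ex; exact: rD.
exists (fun A A' theta => sval (actH A A' theta)), (fun A A' theta => sval (actC A A' theta)),
  (fun A A' theta => sval (actD A A' theta)).
split; first by move=> A A' theta; exact: (svalP (actH A A' theta)).
split; first by move=> A A' theta; exact: (svalP (actC A A' theta)).
split; first by move=> A A' theta; exact: (svalP (actD A A' theta)).
split=> A A' theta c.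
  apply: (induces_natural c (eH A) (eC A') (svalP (fbar A)) (svalP (fbar A'))
    (svalP (actH A A' theta)) (svalP (actC A A' theta))) => x.
  exact: th_fstar.
apply: (induces_natural c (eC A) (eD A') (svalP (rbar A)) (svalP (rbar A'))
  (svalP (actC A A' theta)) (svalP (actD A A' theta))) => x.
exact: th_rho_plus.
Qed.
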